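(* Let $\Omega\subset\mathbb R^n$ be open, let $X(\Omega)$ be a Banach function space, let $V,Z$ be Banach spaces, and let $f:V\to Z$ be a Lipschitz continuous mapping, with $f(0)=0$ in the case $|\Omega|=\infty$. Then $f\circ u\in R^1X(\Omega;Z)$ whenever $u\in R^1X(\Omega;V)$.
   Context: Banach spaces are real; $|A|$ is Lebesgue measure. $M(\Omega)$ is the set of real-valued measurable functions on $\Omega$ (identified when equal a.e.). A Banach space $X(\Omega)\subset M(\Omega)$ with norm $\|\cdot\|_X$ (put $\|f\|_X=\infty$ if $f\notin X(\Omega)$) is a Banach function space if: (P1) $|f|\le g$, $f\in M(\Omega)$, $g\in X(\Omega)$ imply $f\in X(\Omega)$ and $\|f\|_X\le\|g\|_X$; (P2) $0\le f_n\nearrow f$ a.e. implies $\|f_n\|_X\nearrow\|f\|_X$; (P3) $\chi_A\in X(\Omega)$ for every measurable $A\subset\Omega$ with $|A|<\infty$; (P4) for every measurable $A\subset\Omega$ with $|A|<\infty$ there is $C_A>0$ with $\int_A|f|\,dx\le C_A\|f\chi_A\|_X$ for all $f\in X(\Omega)$. For a Banach space $V$, $X(\Omega;V)$ is the space of strongly measurable $u:\Omega\to V$ with $\|u(\cdot)\|_V\in X(\Omega)$. $W^1X(\Omega)$ is the space of real-valued $u\in X(\Omega)$ whose weak (distributional) partial derivatives $\partial_ju$ exist as $L^1_{loc}$ functions and belong to $X(\Omega)$; $|\nabla u|=\big(\sum_{j=1}^n|\partial_ju|^2\big)^{1/2}$. $R^1X(\Omega;V)$ (Reshetnyak--Sobolev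 space) is the class of $u\in X(\Omega;V)$ such that: (A) $\langle v^*,u\rangle\in W^1X(\Omega)$ for every $v^*\in V^*$ with $\|v^*\|\le1$; (B) there is a non-negative $g\in X(\Omega)$ such that for every $v^*\in V^*$ with $\|v^*\|\le 1$, $|\nabla\langle v^*,u\rangle|\le g$ a.e. on $\Omega$. *)

(* Defs.v *)
From HB Require Import structures.
From mathcomp Require Import all_boot all_order all_algebra.
From mathcomp Require Import all_classical all_reals all_analysis.

Set Implicit Arguments.
Unset Strict Implicit.
Unset Printing Implicit Defensive.

Import Order.TTheory GRing.Theory Num.Theory.
Import numFieldNormedType.Exports.

Local Open Scope classical_set_scope.
Local Open Scope ring_scope.

(* The space R^n (n >= 1) is ['rV[R]_n.+1]; its library norm is the sup norm,
   which induces the usual topology. *)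

Section lebesgue_outer_measure.
Context {R : realType} {n : nat}.
Implicit Types (A : set 'rV[R]_n.+1) (a b : 'rV[R]_n.+1).

Definition box a b : set 'rV[R]_n.+1 :=
  [set x | forall i, a ord0 i < x ord0 i <= b ord0 i].

(* If [b i <= a i] for some [i], the box is empty and its volume is 0. *)
Definition box_volume a b : R :=
  \prod_(i < n.+1) Num.max 0 (b ord0 i - a ord0 i).

Definition box_cover A (B : nat -> 'rV[R]_n.+1 * 'rV[R]_n.+1) : Prop :=
  A `<=` \bigcup_k box (B k).1 (B k).2.

Definition lebesgue_outer A : \bar R :=
  ereal_inf [set (\sum_(k <oo) (box_volume (B k).1 (B k).2)%:E)%E
            | B in box_cover A].

Local Open Scope ereal_scope.

Let vol (B : 'rV[R]_n.+1 * 'rV[R]_n.+1) : \bar R := (box_volume B.1 B.2)%:E.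

Let vol_ge0 B : 0 <= vol B.
Proof.
by rewrite lee_fin; apply: prodr_ge0 => i _; rewrite le_max lexx.
Qed.

Let lebesgue_outer_ge0 A : 0 <= lebesgue_outer A.
Proof.
apply: le_ereal_inf_tmp => _ [B _ <-].
by apply: nneseries_ge0 => k _ _; exact: vol_ge0.
Qed.

Let lebesgue_outer0 : lebesgue_outer set0 = 0.
Proof.
apply/eqP; rewrite eq_le lebesgue_outer_ge0 andbT.
apply: ereal_inf_lbound; exists (fun=> (0%R, 0%R)) => //.
apply: eseries0 => k _ _; congr EFin.
by rewrite /box_volume big_ord_recl /= subrr maxxx mul0r.
Qed.

Let le_lebesgue_outer : {homo lebesgue_outer : A B / A `<=` B >-> A <= B}.
Proof.
move=> A A' AA'; apply: ereal_inf_le_tmp => _ [B A'B <-].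
by exists B => //; exact: subset_trans A'B.
Qed.

Let lebesgue_outer_sigma_subadditive : sigma_subadditive lebesgue_outer.
Proof.
move=> A; have [[i ioo]|] := pselect (exists i, lebesgue_outer (A i) = +oo).
  rewrite (eseries_pinfty _ _ ioo) ?leey// => k _.
  by rewrite -ltNye (lt_le_trans _ (lebesgue_outer_ge0 _)).
rewrite -forallNE => Aoo.
suff add2e (e : {posnum R}) : lebesgue_outer (\bigcup_n A n) <=
    \sum_(i <oo) lebesgue_outer (A i) + e%:num%:E.
  by apply/lee_addgt0Pr => _/posnumP[].
rewrite (le_trans _ (epsilon_trick _ _ _))//.
pose P k B := box_cover (A k) B /\
  \sum_(l <oo) vol (B l) <= lebesgue_outer (A k) + (e%:num / (2 ^ k.+1)%:R)%:E.
have [G PG] : {G & forall k, P k (G k)}.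
  apply: (@choice _ _ P) => k; rewrite /P /lebesgue_outer.
  set S := (X in ereal_inf X); move infS : (ereal_inf S) => iS.
  case: iS infS => [r Sr|Soo|Soo].
  - have en1 : (0 < e%:num / (2 ^ k.+1)%:R)%R by [].
    have /(lb_ereal_inf_adherent en1) : ereal_inf S \is a fin_num by rewrite Sr.
    move=> [x [B AnB muBx] xS].
    by exists B; split => //; rewrite muBx -Sr; exact/ltW.
  - by have := Aoo k; rewrite /lebesgue_outer Soo.
  - have := lebesgue_outer_ge0 (A k).
    by rewrite /lebesgue_outer Soo.
apply: (@le_trans _ _ (\esum_(i in setT) (vol \o uncurry G) i)).
  apply: ereal_inf_lbound => /=.
  have /card_esym/ppcard_eqP[f] := card_nat2.
  exists (uncurry G \o f).
    move=> t [i _] /(PG i).1[j _ Bijt]; exists (f^-1%FUN (i, j)) => //=.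
    by rewrite invK ?inE.
  rewrite -(esum_pred_image (vol \o uncurry G) _ xpredT) ?[fun=> _]set_true//.
    by rewrite image_eq.
  by move=> k _; exact: vol_ge0.
have -> : \esum_(i in setT) (vol \o uncurry G) i =
    \sum_(i <oo) \sum_(j <oo) vol (G i j).
  pose J : nat -> set (nat * nat) := fun i => [set (i, j) | j in setT].
  have -> : [set: nat * nat] = \bigcup_k J k.
    by rewrite predeqE => -[a b]; split => // _; exists a => //; exists b.
  have tJ : trivIset setT J.
    apply/trivIsetP => i j _ _ ij.
    rewrite predeqE => -[l m] /=; split => //= -[] [? _] [<- _] [? _] [ji _].
    by rewrite ji eqxx in ij.
  rewrite esum_bigcupT //=.
  rewrite -(image_id [set: nat]) -fun_true esum_pred_image//; last first.
    by move=> k _; apply: esum_ge0 => ? _; exact: vol_ge0.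
  apply: eq_eseriesr => /= j _.
  rewrite -(esum_pred_image (vol \o uncurry G) (pair j) predT)//=.
  - by congr esum; rewrite predeqE => -[a b]; split=> -[i ? <-]; exists i.
  - by move=> ? ? _ _; exact: (@can_inj _ _ _ snd).
apply: lee_nneseries => k _; last exact: (PG k).2.
by move=> _; apply: nneseries_ge0 => m _ _; exact: vol_ge0.
Qed.

HB.instance Definition _ := isOuterMeasure.Build R 'rV[R]_n.+1 lebesgue_outer
  lebesgue_outer0 lebesgue_outer_ge0 le_lebesgue_outer
  lebesgue_outer_sigma_subadditive.

End lebesgue_outer_measure.

(* R^n with the sigma-algebra of Lebesgue (= Caratheodory) measurable sets. *)
Notation lebesgue_space R n := (caratheodory_type (@lebesgue_outer R n)).

Definition lebesgue (R : realType) (n : nat) :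
  set (lebesgue_space R n) -> \bar R := @lebesgue_outer R n.
Arguments lebesgue R n _ : clear implicits.

HB.instance Definition _ (R : realType) (n : nat) :=
  isMeasure.Build _ (lebesgue_space R n) R (lebesgue R n)
    (caratheodory_measure0 (@lebesgue_outer R n))
    (caratheodory_measure_ge0 (mu := @lebesgue_outer R n))
    (caratheodory_measure_sigma_additive (mu := @lebesgue_outer R n)).

Section function_spaces.
Context {R : realType} {n : nat}.
Local Notation Rn := 'rV[R]_n.+1.
Local Notation leb := (lebesgue R n).

(* Functions on a set [Omega] are represented by total functions on R^n, of
   which only the values on [Omega] matter, up to a.e. equality. *)
Implicit Types (Omega : set Rn) (u v : Rn -> R).

Definition lmeasurable (A : set Rn) : Prop :=
  measurable (A : set (lebesgue_space R n)).

Definition lmeasurable_fun Omega u : Prop :=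
  measurable_fun (Omega : set (lebesgue_space R n))
                 (u : lebesgue_space R n -> R).

Definition L1loc Omega u : Prop :=
  lmeasurable_fun Omega u /\
  forall K : set Rn, compact K -> K `<=` Omega ->
    (\int[leb]_(x in K) `|u x|%:E < +oo)%E.

(* The norm [N] of the space [X], extended by +oo outside [X]. *)
Definition extended_norm (X : set (Rn -> R)) (N : (Rn -> R) -> R) u : \bar R :=
  if `[< X u >] then (N u)%:E else +oo%E.

Record banach_function_space Omega := BanachFunctionSpace {
  bfs_mem :> (Rn -> R) -> Prop ;
  bfs_norm : (Rn -> R) -> R ;
  (* [bfs_mem] is a union of classes modulo a.e. equality on [Omega], on which
     [bfs_norm] is constant. *)
  bfs_measurable : forall u, bfs_mem u -> lmeasurable_fun Omega u ;
  bfs_ae : forall u v, bfs_mem u -> lmeasurable_fun Omega v ->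
    u = v %[ae leb in Omega] -> bfs_mem v /\ bfs_norm v = bfs_norm u ;
  bfs0 : bfs_mem (cst 0) ;
  bfsD : forall u v, bfs_mem u -> bfs_mem v -> bfs_mem (u \+ v) ;
  bfsZ : forall (c : R) u, bfs_mem u -> bfs_mem (fun x => c * u x) ;
  bfs_norm_eq0 : forall u, bfs_mem u -> bfs_norm u = 0 ->
    u = cst 0 %[ae leb in Omega] ;
  bfs_normD : forall u v, bfs_mem u -> bfs_mem v ->
    bfs_norm (u \+ v) <= bfs_norm u + bfs_norm v ;
  bfs_normZ : forall (c : R) u, bfs_mem u ->
    bfs_norm (fun x => c * u x) = `|c| * bfs_norm u ;
  bfs_complete : forall u_ : nat -> Rn -> R,
    (forall k, bfs_mem (u_ k)) ->
    (forall e : R, 0 < e -> exists N : nat, forall k l : nat,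
      (N <= k)%N -> (N <= l)%N -> bfs_norm (u_ k \- u_ l) < e) ->
    exists2 u, bfs_mem u & bfs_norm (u_ k \- u) @[k --> \oo] --> (0 : R) ;
  bfs_le : forall u v, lmeasurable_fun Omega u -> bfs_mem v ->
    (\forall x \ae leb, Omega x -> `|u x| <= v x) ->
    bfs_mem u /\ bfs_norm u <= bfs_norm v ;
  bfs_monotone_cvg : forall (u_ : nat -> Rn -> R) u,
    (forall k, lmeasurable_fun Omega (u_ k)) -> lmeasurable_fun Omega u ->
    (\forall x \ae leb, Omega x ->
      [/\ forall k, 0 <= u_ k x, nondecreasing_seq (u_ ^~ x) &
          u_ ^~ x @ \oo --> u x]) ->
    nondecreasing_seq (fun k => extended_norm bfs_mem bfs_norm (u_ k)) /\
    extended_norm bfs_mem bfs_norm (u_ k) @[k --> \oo] -->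
      extended_norm bfs_mem bfs_norm u ;
  bfs_indic : forall A : set Rn, lmeasurable A -> A `<=` Omega ->
    (leb A < +oo)%E -> bfs_mem (\1_A) ;
  bfs_integral : forall A : set Rn, lmeasurable A -> A `<=` Omega ->
    (leb A < +oo)%E ->
    exists2 C : R, 0 < C & forall u, bfs_mem u ->
      (\int[leb]_(x in A) `|u x|%:E <=
       C%:E * extended_norm bfs_mem bfs_norm (u \* \1_A)%R)%E
}.

Definition partial (j : 'I_n.+1) u : Rn -> R :=
  fun x => 'D_(delta_mx ord0 j) u x.

Fixpoint continuously_differentiable (k : nat) u : Prop :=
  match k with
  | 0 => continuous u
  | k'.+1 => continuous u /\ forall j,
      (forall x, derivable u x (delta_mx ord0 j)) /\
      continuously_differentiable k' (partial j u)
  end.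

Definition test_function Omega (phi : Rn -> R) : Prop :=
  [/\ forall k, continuously_differentiable k phi,
      compact (closure [set x | phi x != 0]) &
      closure [set x | phi x != 0] `<=` Omega].

Definition weak_partial Omega j u v : Prop :=
  [/\ L1loc Omega u, L1loc Omega v & forall phi, test_function Omega phi ->
    \int[leb]_(x in Omega) (u x * partial j phi x) =
    - \int[leb]_(x in Omega) (v x * phi x)].

Definition weak_gradient Omega u (du : 'I_n.+1 -> Rn -> R) : Prop :=
  forall j, weak_partial Omega j u (du j).

Definition gradient_length (du : 'I_n.+1 -> Rn -> R) (x : Rn) : R :=
  Num.sqrt (\sum_j `|du j x| ^+ 2).

Definition W1 Omega (X : banach_function_space Omega) u : Prop :=
  X u /\ exists2 du, weak_gradient Omega u du & forall j, X (du j).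

Definition simple_fun (V : Type) Omega (s : Rn -> V) : Prop :=
  finite_set (s @` Omega) /\
  forall y, lmeasurable (Omega `&` s @^-1` [set y]).

Definition strongly_measurable (V : normedModType R) Omega (u : Rn -> V) :
    Prop :=
  exists2 s : nat -> Rn -> V, forall k, simple_fun Omega (s k) &
    \forall x \ae leb, Omega x -> s ^~ x @ \oo --> u x.

Definition bochner_space (V : normedModType R) Omega
    (X : banach_function_space Omega) (u : Rn -> V) : Prop :=
  strongly_measurable Omega u /\ X (fun x => `|u x|).

Definition dual_norm (V : normedModType R) (l : {linear V -> R^o}) : \bar R :=
  ereal_sup [set `|l y|%:E | y in [set y : V | `|y| <= 1]].

Definition dual_unit_ball (V : normedModType R) : set {linear V -> R^o} :=
  [set l : {linear V -> R^o} | continuous l /\ (dual_norm l <= 1)%E].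

(* The weak gradient of [l \o u] being unique up to a.e. equality, the last
   bound does not depend on the representative [du]. *)
Definition reshetnyak_sobolev (V : normedModType R) Omega
    (X : banach_function_space Omega) (u : Rn -> V) : Prop :=
  [/\ bochner_space X u,
      forall l : {linear V -> R^o}, dual_unit_ball l -> W1 X (l \o u) &
      exists g : Rn -> R,
        [/\ X g,
            \forall x \ae leb, Omega x -> 0 <= g x &
            forall l : {linear V -> R^o}, dual_unit_ball l ->
              exists2 du, weak_gradient Omega (l \o u) du &
                \forall x \ae leb, Omega x -> gradient_length du x <= g x]].

End function_spaces.

(* Main.v *)
(* Let [Phi = l o f] with [l] in the dual unit ball of [Z]. By McShane's formula,
   [Phi o u] is the limit of the functions
     min_k max_m (Phi (y_k) + L l_mk (u - y_k)),  k, m <= N,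
   where [y] is dense in the essential range of [u] and [l_mk] is a functional
   norming [y_m - y_k]. Each of them is a superposition [T (a_i)] of finitely many
   scalar functions [a_i = l_i o u], whose weak gradients have the common bound
   [g], with [T] Lipschitz for the sup norm. Replacing [a_i] by its averages
   over a smooth partition of unity on a fine lattice, and summing by parts, one gets
     |int T(a) d_j phi| <= M L int g |phi|
   with [M] independent of the number of functions, so the bound passes to
   [Phi o u]. Finally, a linear functional dominated by [int M L g |phi|] extends by
   Hahn-Banach, and is represented, by Radon-Nikodym, by a function bounded by
   [M L g], which is the weak partial derivative. *)

(* Only the scalar functions [l \o u] are weakly differentiable: in an arbitrary Banach space, [u]
   itself offers no derivative to which a chain rule could apply. Even for finitely many scalar
   functions the usual chain rule breaks down, since [T] may fail to be differentiable all along the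
   range of [a]. Averaging [a] before applying [T] avoids this: only differences of [T] at
   neighbouring averages occur, and the Lipschitz constant controls them. The sup norm is essential,
   because it turns the common bound [g] into a bound for [T] without a factor for the number of
   functions; that number enters only the approximation error, which vanishes while the number is
   still fixed. As [X] need not be reflexive, gradients of the approximations cannot be made to
   converge weakly in [X]; the limit is taken in the inequality on test functions, and the
   derivative is recovered from it by duality. Multiplicative constants are harmless, since (B) asks
   only for some bound in [X]. *)
Require Import Defs.
From HB Require Import structures.
From mathcomp Require Import all_boot all_order all_algebra.
From mathcomp Require Import finmap.
From mathcomp Require Import all_classical all_reals all_analysis.
From mathcomp Require Import measurable_realfun.
From mathcomp Require Import ring lra.

Set Implicit Arguments.
Unset Strict Implicit.
Unset Printing Implicit Defensive.

Import Order.TTheory GRing.Theory Num.Theory.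
Import numFieldNormedType.Exports.

Local Open Scope classical_set_scope.
Local Open Scope ring_scope.


(** * The Hahn-Banach theorem *)

Section hahn_banach.
Context {R : realType} {V : lmodType R}.
Implicit Types (A U W : set V) (p F : V -> R).

Definition subspace_set (M : lmodType R) (A : set M) : Prop :=
  A 0 /\ forall (t : R) x y, A x -> A y -> A (t *: x + y).

Definition linear_on A F : Prop :=
  forall (t : R) x y, A x -> A y -> F (t *: x + y) = t * F x + F y.

Definition sublinear_on W p : Prop :=
  (forall x y, W x -> W y -> p (x + y) <= p x + p y) /\
  (forall (t : R) x, 0 < t -> W x -> p (t *: x) = t * p x).

(** Single-valuedness is not part of the condition because it follows: if two values lie over one
    point, their difference and its opposite lie over 0, hence are at most [p 0], which is 0. *)
Let graph_below W p (G : set (V * R)) : Prop :=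
  subspace_set G /\ forall x r, G (x, r) -> W x /\ r <= p x.

(** A value [c] at [v] is admissible when r - p (x - v) <= c <= p (y + v) - s for all (x, r) and (y,
    s) in [G]. Subadditivity at (x - v) + (y + v) puts every lower bound below every upper bound,
    and [c] is the supremum of the lower ones. *)
Let graph_below_extend W p (G : set (V * R)) v : subspace_set W ->
  sublinear_on W p -> graph_below W p G -> W v ->
  exists G' : set (V * R),
    [/\ graph_below W p G', G `<=` G' & exists r, G' (v, r)].
Proof.
move=> [W0 Wlin] [pD pZ] [[G0 Glin] Gp] Wv.
have WD x y : W x -> W y -> W (x + y) by move=> Wx Wy; rewrite -[x]scale1r; exact: Wlin.
have WZ t x : W x -> W (t *: x) by move=> Wx; rewrite -[_ *: _]addr0; exact: Wlin.
have WB x y : W x -> W y -> W (x - y).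
  by move=> Wx Wy; rewrite -scaleN1r addrC; exact: Wlin.
pose S := [set z.2 - p (z.1 - v) | z in G].
have Sub y s : G (y, s) -> ubound S (p (y + v) - s).
  move=> Gys _ [[x r] Gxr <-] /=.
  have [[Wx _] [Wy _]] := (Gp _ _ Gxr, Gp _ _ Gys).
  have : G (x + y, r + s).
    by have := Glin 1 _ _ Gxr Gys; rewrite scale1r.
  move=> /Gp[_ rs].
  have := pD _ _ (WB _ _ Wx Wv) (WD _ _ Wy Wv).
  by rewrite addrACA addNr addr0; lra.
have S0 : S !=set0 by exists (0 - p (0 - v)); exists (0, 0).
have Shas : has_sup S by split=> //; exists (p (0 + v) - 0); exact: Sub.
pose c := sup S.
exists [set z | exists x r t, G (x, r) /\ z = (x + t *: v, r + t * c)].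
split; last 2 first.
- by move=> [x r] Gxr; exists x, r, 0; split=> //; rewrite scale0r mul0r !addr0.
- by exists c, 0, 0, 1; split=> //; rewrite scale1r mul1r !add0r.
split; first split.
- by exists 0, 0, 0; split=> //; rewrite scale0r mul0r !addr0.
- move=> t _ _ [x [r [a [Gxr ->]]]] [y [s [b [Gys ->]]]].
  exists (t *: x + y), (t * r + s), (t * a + b); split.
    exact: (Glin t _ _ Gxr Gys).
  congr (_, _); last by rewrite /= /GRing.scale /=; ring.
  by rewrite /= scalerDr scalerDl scalerA addrACA.
move=> _ _ [x [r [t [Gxr [-> ->]]]]].
have [Wx rp] := Gp _ _ Gxr.
split; first by apply: WD => //; exact: WZ.
have GZ a : G (a *: x, a * r).
  by have := Glin a _ _ Gxr G0; rewrite !addr0.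
(* After division by the absolute value of [t], the case t < 0 says that [c] is an upper bound of
   [S], and the case t > 0 that it is the least one. *)
have [t0|t0|->] := ltgtP t 0; last by rewrite scale0r mul0r !addr0.
- have s0 : 0 < - t by rewrite oppr_gt0.
  have : (- t)^-1 * r - p ((- t)^-1 *: x - v) <= c.
    by apply: ub_le_sup; [exact: Shas.2|exists ((- t)^-1 *: x, (- t)^-1 * r)].
  rewrite lerBlDr -(ler_pM2l s0) mulrA mulfV ?gt_eqF// mul1r mulrDr -pZ//; last first.
    by apply: WB => //; exact: WZ.
  by rewrite scalerBr scalerA mulfV ?gt_eqF// scale1r scaleNr opprK; lra.
- have : c <= p (t^-1 *: x + v) - t^-1 * r.
    by apply: ge_sup => //; exact: Sub.
  rewrite lerBrDr -(ler_pM2l t0) mulrDr mulrA mulfV ?gt_eqF// mul1r -pZ//; last first.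
    by apply: WD => //; exact: WZ.
  by rewrite scalerDr scalerA mulfV ?gt_eqF// scale1r; lra.
Qed.

Lemma hahn_banach W U p F0 : subspace_set W -> sublinear_on W p ->
    subspace_set U -> U `<=` W -> linear_on U F0 ->
    (forall x, U x -> F0 x <= p x) ->
  exists F, [/\ linear_on W F, forall x, W x -> F x <= p x &
                forall x, U x -> F x = F0 x].
Proof.
move=> Wsub psub [U0 Ulin] UW F0lin F0p.
pose G0 := [set z : V * R | U z.1 /\ z.2 = F0 z.1].
have F00 : F0 0 = 0.
  have := F0lin 1 0 0 U0 U0; rewrite scale1r mul1r addr0 => e.
  by apply: (addrI (F0 0)); rewrite addr0 -e.
have G0g : graph_below W p G0.
  split; first split => //=.
    move=> t [x r] [y s] [/= Ux ->] [/= Uy ->]; split; first exact: Ulin.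
    by rewrite F0lin.
  by move=> x r [/= Ux ->]; split; [exact: UW|exact: F0p].
(* Joining [G0] to every set makes the property hold for the union of the empty chain as well. *)
pose P (A : set (V * R)) := graph_below W p (G0 `|` A).
have [F FP Ftot|A [PA Amax]] := @Zorn_bigcup _ P.
  rewrite /P; have [[B FB]|F0'] := pselect (F !=set0); last first.
    rewrite (_ : \bigcup_(X in F) X = set0) ?setU0//.
    by rewrite -subset0 => x [B FB]; case: F0'; exists B.
  have inj X : F X -> G0 `|` X `<=` G0 `|` \bigcup_(X in F) X.
    by move=> FX; apply: setUS; exact: bigcup_sup.
  have surj z : (G0 `|` \bigcup_(X in F) X) z -> exists2 X, F X & (G0 `|` X) z.
    by move=> [?|[X FX ?]]; [exists B => //; left|exists X => //; right].
  split; first split.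
  - by left; split => //=; rewrite F00.
  - move=> t x y /surj[X FX Xx] /surj[Y FY Yy].
    have [XY|YX] := Ftot _ _ FX FY.
      apply: (inj Y FY); apply: (FP _ FY).1.2 => //.
      by move: Xx => [?|/XY ?]; [left|right].
    apply: (inj X FX); apply: (FP _ FX).1.2 => //.
    by move: Yy => [?|/YX ?]; [left|right].
  - by move=> x r /surj[X FX Xx]; exact: (FP _ FX).2.
pose G := G0 `|` A.
have dom v : W v -> exists r, G (v, r).
  move=> Wv; have [G' [G'g GG' [r G'r]]] := graph_below_extend Wsub psub PA Wv.
  have AG' : A `<=` G' by apply: subset_trans GG'; right.
  have [G'A|G'A] := pselect (G' `<=` A).
    by exists r; right; exact: G'A.
  exfalso; apply: (Amax G'); first by split.
  rewrite /P (_ : G0 `|` G' = G')//; apply/setUidPr.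
  by apply: subset_trans GG'; left.
have [[G00 Glin] Gp] : graph_below W p G by [].
have p0 : p 0 <= 0.
  have [pD _] := psub; have [_ pZ] := psub; have [W0 _] := Wsub.
  have := pZ 2 0 (ltr0n _ 2) W0; rewrite scaler0; lra.
have uniq v r s : G (v, r) -> G (v, s) -> r = s.
  move=> Gr Gs.
  have := Glin (-1) _ _ Gr Gs; have := Glin (-1) _ _ Gs Gr.
  rewrite /= !scaleN1r.
  have -> : - (v, s) + (v, r) = (0, r - s) :> V * R.
    by congr (_, _) => /=; rewrite ?addNr// addrC.
  have -> : - (v, r) + (v, s) = (0, s - r) :> V * R.
    by congr (_, _) => /=; rewrite ?addNr// addrC.
  by move=> /Gp[_ h1] /Gp[_ h2]; apply/eqP; rewrite eq_le; apply/andP; split; lra.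
pose F v := xget 0 [set r | G (v, r)].
have FG v : W v -> G (v, F v).
  by move=> /dom[r Gr]; rewrite /F; case: xgetP => [y _ //|/(_ r)[]].
exists F; split.
- move=> t x y Wx Wy; apply: (uniq (t *: x + y)).
    by apply: FG; exact: Wsub.2.
  exact: (Glin t _ _ (FG _ Wx) (FG _ Wy)).
- by move=> x /FG/Gp[].
- move=> x Ux; apply: (uniq x); first exact/FG/UW.
  by left.
Qed.

End hahn_banach.

(** On the line through [y], the functional sending t y to t times the norm of [y] lies below the
    norm, and Hahn-Banach extends it with this bound. *)
Lemma norming_functional (R : realType) (V : normedModType R) (y : V) :
  exists2 l : {linear V -> R^o},
    dual_unit_ball l & l y = `|y| /\ forall x, `|l x| <= `|x|.
Proof.
pose U := [set t *: y | t in [set: R]].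
have [y0|y0] := eqVneq y 0.
  exists (\0 : {linear V -> R^o}).
    split; first exact: cst_continuous.
    by apply: ge_ereal_sup => _ [x _ <-]; rewrite normr0 lee_fin.
  by rewrite y0 normr0; split => // x; rewrite normr0.
have ny0 : `|y| != 0 by rewrite normr_eq0.
pose F0 (x : V) := xget 0 [set t | x = t *: y] * `|y|.
have F0E t : F0 (t *: y) = t * `|y|.
  rewrite /F0; case: xgetP => [s _ /eqP|/(_ t)[]//].
  by rewrite -subr_eq0 -scalerBl scaler_eq0 (negbTE y0) orbF subr_eq0 => /eqP ->.
have [F [Flin Fp FU]] : exists F, [/\ linear_on setT F,
    forall x, setT x -> F x <= `|x| & forall x, U x -> F x = F0 x].
  apply: hahn_banach => //.
  - by split => [x z _ _|t x t0 _]; [exact: ler_normD|rewrite normrZ gtr0_norm].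
  - split; first by exists 0; rewrite ?scale0r.
    move=> t _ _ [a _ <-] [b _ <-] /=; exists (t * a + b) => //.
    by rewrite scalerDl scalerA.
  - move=> t _ _ [a _ <-] [b _ <-].
    by rewrite scalerA -scalerDl !F0E; ring.
  - move=> _ [a _ <-]; rewrite F0E normrZ; apply: ler_wpM2r => //.
    exact: ler_norm.
have lF : linear (F : V -> R^o) by move=> t x z; rewrite Flin.
pose l := GRing.isLinear.Build R V R^o _ (F : V -> R^o) lF.
pose L : {linear V -> R^o} := HB.pack (F : V -> R^o) l.
have LF x : L x = F x by [].
have Lle x : `|L x| <= `|x|.
  rewrite LF ler_norml Fp// andbT lerNl.
  have -> : - F x = F (- x) by rewrite -!LF linearN.
  by rewrite (le_trans (Fp _ I))// normrN.
exists L; last by split => //; rewrite LF FU; [rewrite -[y]scale1r F0E mul1r scale1r|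
  exists 1; rewrite ?scale1r].
split; last first.
  by apply: ge_ereal_sup => _ [x /= x1 <-]; rewrite lee_fin (le_trans (Lle x)).
apply: (@linear_bounded_continuous _ V R^o L).1.
apply/linear_boundedP; near=> r => x.
by rewrite (le_trans (Lle x))// ler_peMl.
Unshelve. all: by end_near. Qed.

(** * Lebesgue measure on R^n *)

Lemma integral_measure_preserving d (T : measurableType d) (R : realType)
    (mu : {measure set T -> \bar R}) (phi : T -> T) (f : T -> \bar R) :
  measurable_fun setT phi ->
  (forall A, measurable A -> mu (phi @^-1` A) = mu A) ->
  mu.-integrable setT f ->
  mu.-integrable setT (f \o phi) /\
  (\int[mu]_x f (phi x) = \int[mu]_x f x)%E.
Proof.
move=> mphi phiE intf.
have mf : measurable_fun setT f by exact: measurable_int intf.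
have mfv : measurable_fun setT (f \o phi) by exact: measurableT_comp.
have iv : mu.-integrable setT (f \o phi).
  apply/integrableP; split => //.
  move/integrableP : intf => [_]; apply: le_lt_trans.
  rewrite -(@ge0_integral_pushforward _ _ _ _ _ _ mphi mu setT (abse \o f))//=;
    last exact: measurableT_comp.
  rewrite (@eq_measure_integral _ _ _ setT mu (pushforward mu phi))// => A mA _.
  exact: phiE.
split=> //.
rewrite -(@integral_pushforward _ _ _ _ _ _ mphi mu setT f)//.
by apply: eq_measure_integral => A mA _; exact: phiE.
Qed.

Lemma rV_norm_le (R : realType) (n : nat) (x : 'rV[R]_n.+1) (M : R) :
  (`|x| <= M) <-> (forall i, `|x ord0 i| <= M).
Proof.
split=> [xM i|xM].
  apply: le_trans xM; rewrite [leRHS]/Num.norm/= mx_normrE.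
  exact: (le_bigmax _ (fun ij : 'I_1 * 'I_n.+1 => `|x ij.1 ij.2|) (ord0, i)).
rewrite [leLHS]/Num.norm/= mx_normrE; apply/bigmax_leP; split.
  exact: le_trans (xM ord0).
by move=> [i j] _ /=; rewrite ord1.
Qed.

Lemma rV_norm_lt (R : realType) (n : nat) (x : 'rV[R]_n.+1) (M : R) :
  (forall i, `|x ord0 i| < M) -> `|x| < M.
Proof.
move=> xM; rewrite [ltLHS]/Num.norm/= mx_normrE; apply/bigmax_ltP; split.
  exact: le_lt_trans (xM ord0).
by move=> [i j] _ /=; rewrite ord1.
Qed.

Lemma norm_le_closed (R : realType) (n : nat) (M : R) :
  closed [set x : 'rV[R]_n.+1 | `|x| <= M].
Proof.
apply: (@preimage_closed _ _ (fun x : 'rV[R]_n.+1 => `|x|) [set y | y <= M]).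
  by move=> x _; exact: norm_continuous.
exact: closed_le.
Qed.

Section lebesgue_measurable_sets.
Context {R : realType} {n : nat}.
Local Notation Rn := 'rV[R]_n.+1.
Local Notation leb := (lebesgue R n).
Implicit Types (A B : set Rn) (a b x v : Rn).

Let set_coord a (i : 'I_n.+1) (c : R) : Rn :=
  \row_k (if k == i then c else a ord0 k).

Let box_volume_ge0 a b : 0 <= box_volume a b.
Proof. by apply: prodr_ge0 => i _; rewrite le_max lexx. Qed.

Let box_volume_cut a b (i : 'I_n.+1) (c : R) :
  box_volume a (set_coord b i (Num.min (b ord0 i) c)) +
  box_volume (set_coord a i (Num.max (a ord0 i) c)) b = box_volume a b.
Proof.
rewrite /box_volume !(bigD1 (P := xpredT) i)//=.
under eq_bigr => k ki do rewrite mxE (negbTE ki).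
under [X in _ + _ * X = _]eq_bigr => k ki do rewrite mxE (negbTE ki).
rewrite !mxE eqxx -mulrDl; congr (_ * _).
have [ac|ac] := leP (a ord0 i) c; have [bc|bc] := leP (b ord0 i) c;
  rewrite /Num.max; do ![case: ifPn => //]; move: ac bc; rewrite -?leNgt; lra.
Qed.

(** A hyperplane orthogonal to an axis cuts each box of a cover into two boxes whose volumes add up,
    so a cover of [X] splits into covers of its two parts at no cost. This is Caratheodory's
    criterion. *)
Lemma lmeasurable_halfspace (i : 'I_n.+1) (c : R) :
  lmeasurable [set x : Rn | x ord0 i <= c].
Proof.
apply: le_caratheodory_measurable => X; apply: le_ereal_inf_tmp => _ [B XB <-].
pose B1 k := ((B k).1, set_coord (B k).2 i (Num.min ((B k).2 ord0 i) c)).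
pose B2 k := (set_coord (B k).1 i (Num.max ((B k).1 ord0 i) c), (B k).2).
rewrite [leRHS](_ : _ = \sum_(k <oo) (box_volume (B1 k).1 (B1 k).2)%:E +
                        \sum_(k <oo) (box_volume (B2 k).1 (B2 k).2)%:E)%E; last first.
  rewrite -nneseriesD; first by apply: eq_eseriesr => k _; rewrite -EFinD box_volume_cut.
  - by move=> k _ _; rewrite lee_fin.
  - by move=> k _ _; rewrite lee_fin.
apply: leeD; apply: ereal_inf_lbound.
- exists B1 => // x [Xx /= xc]; have [k _ Bx] := XB _ Xx.
  exists k => // j /=; rewrite mxE; have [->|_] := eqVneq j i; last exact: Bx.
  by case/andP: (Bx i) => -> xb /=; rewrite le_min xb.
- exists B2 => // x [Xx /= /negP]; rewrite -ltNge => xc; have [k _ Bx] := XB _ Xx.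
  exists k => // j /=; rewrite mxE; have [->|_] := eqVneq j i; last exact: Bx.
  by case/andP: (Bx i) => ax -> /=; rewrite gt_max ax xc.
Qed.

Lemma lmeasurable_box a b : lmeasurable (box a b).
Proof.
rewrite (_ : box a b = \bigcap_(i in [set: 'I_n.+1])
    ([set x : Rn | x ord0 i <= b ord0 i] `\` [set x : Rn | x ord0 i <= a ord0 i])).
  apply: fin_bigcap_measurable; first exact: finite_finset.
  by move=> i _; apply: measurableD; exact: lmeasurable_halfspace.
apply/seteqP; split=> x /= h i; last first.
  by have [/= -> /negP] := h i I; rewrite -ltNge => ->.
by move=> _; case/andP: (h i) => ax xb; split=> //=; apply/negP; rewrite -ltNge.
Qed.

Lemma lebesgue_box_le a b : (leb (box a b) <= (box_volume a b)%:E)%E.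
Proof.
have v0 : @box_volume R n 0 0 = 0.
  by rewrite /box_volume big_ord_recl /= subrr maxxx mul0r.
apply: ereal_inf_lbound.
exists (fun k => if k == 0%N then (a, b) else (0, 0)); first by move=> x abx; exists 0%N.
rewrite nneseries_recl//; last by move=> k _; rewrite lee_fin.
rewrite /= eseries_cond eseries0 ?adde0// => -[//|k] _ _ /=.
by rewrite v0.
Qed.

Lemma lebesgue_bounded_lty A (M : R) : (forall x, A x -> `|x| <= M) ->
  (leb A < +oo)%E.
Proof.
move=> AM; pose a : Rn := \row__ (- (M + 1)); pose b : Rn := \row__ M.
apply: (@le_lt_trans _ _ (leb (box a b))).
  apply: (@le_outer_measure R _ (@lebesgue_outer R n)) => x /AM/rV_norm_le xM i.
  rewrite !mxE; have := xM i; rewrite ler_norml => /andP[h ->]; rewrite andbT.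
  by lra.
by rewrite (le_lt_trans (lebesgue_box_le a b))// ltry.
Qed.

Lemma lebesgue_compact_lty A : compact A -> (leb A < +oo)%E.
Proof.
move=> /compact_bounded[M [_ /(_ (M + 1))]]; rewrite ltrDl ltr01 => /(_ isT) AM.
exact: lebesgue_bounded_lty AM.
Qed.

(** An open set is the union of the boxes with rational corners that it contains. *)
Lemma open_lmeasurable A : open A -> lmeasurable A.
Proof.
move=> Ao.
pose rbox (q : 'rV[rat]_n.+1 * 'rV[rat]_n.+1) : set Rn :=
  box (map_mx ratr q.1) (map_mx ratr q.2).
rewrite (_ : A = \bigcup_(q in [set q | rbox q `<=` A]) rbox q); last first.
  apply/seteqP; split; last by move=> x [q /= qA]; exact: qA.
  move=> x Ax; have /nbhs_ballP[e /= e0 xeA] := open_nbhs_nbhs (conj Ao Ax).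
  have /choice[q1 q1P] (i : 'I_n.+1) :
      exists q : rat, ratr q \in `](x ord0 i - e), (x ord0 i)[.
    by apply: rat_in_itvoo; rewrite ltrBlDr ltrDl.
  have /choice[q2 q2P] (i : 'I_n.+1) :
      exists q : rat, ratr q \in `](x ord0 i), (x ord0 i + e)[.
    by apply: rat_in_itvoo; rewrite ltrDl.
  exists (\row_i q1 i, \row_i q2 i); last first.
    move=> i; rewrite !mxE; have := q1P i; have := q2P i.
    by rewrite !in_itv/= => /andP[/ltW -> _] /andP[_ ->].
  move=> y /= qy; apply: xeA; rewrite -ball_normE /=; apply: rV_norm_lt => i.
  have := qy i; have := q1P i; have := q2P i.
  by rewrite !mxE !in_itv/= ltr_norml; lra.
rewrite bigcup_mkcond; apply: countable_bigcupT_measurable => // q.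
by case: ifP => _; [exact: lmeasurable_box|exact: measurable0].
Qed.

Lemma closed_lmeasurable A : closed A -> lmeasurable A.
Proof.
move=> Ac; rewrite -[A]setCK; apply: measurableC; apply: open_lmeasurable.
exact: closed_openC.
Qed.

Lemma lmeasurable_norm_le (M : R) : lmeasurable [set x : Rn | `|x| <= M].
Proof. by apply: closed_lmeasurable; exact: norm_le_closed. Qed.

Lemma compact_lmeasurable A : compact A -> lmeasurable A.
Proof.
move=> /compact_closed cA; apply: closed_lmeasurable.
by apply: cA; exact: norm_hausdorff.
Qed.

Lemma continuous_lmeasurable_fun A (f : Rn -> R) : lmeasurable A ->
  continuous f -> lmeasurable_fun A f.
Proof.
move=> mA cf; apply: (@measurable_funS _ _ _ _ setT) => //.
apply: (measurability _ (RGenOInfty.measurableE R)).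
move=> _ [_ [x ->] <-]; rewrite setTI; apply: open_lmeasurable.
by apply: open_comp => // y _; exact: cf.
Qed.

Let lebesgue_shift_le A v : (leb [set x : Rn | A (x + v)%R] <= leb A)%E.
Proof.
apply: le_ereal_inf_tmp => _ [B AB <-]; apply: ereal_inf_lbound.
exists (fun k => ((B k).1 - v, (B k).2 - v)).
  move=> x /AB[k _ Bx]; exists k => // i /=.
  by have := Bx i; rewrite !mxE; lra.
apply: eq_eseriesr => k _; congr EFin; apply: eq_bigr => i _.
by rewrite !mxE; congr Num.max; ring.
Qed.

Lemma lebesgue_shift A v : leb [set x : Rn | A (x + v)] = leb A.
Proof.
apply/eqP; rewrite eq_le lebesgue_shift_le /=.
rewrite (le_trans _ (lebesgue_shift_le _ (- v)))//=.
by under eq_set do rewrite subrK.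
Qed.

(** The sigma-algebra is that of Lebesgue sets, so continuity of the translation does not suffice:
    Caratheodory's condition is transported by the invariance of the outer measure, with the test
    set [X] translated back. *)
Lemma measurable_shift v :
  measurable_fun setT ((fun x => x + v) : lebesgue_space R n -> lebesgue_space R n).
Proof.
move=> _ A mA; rewrite setTI.
change ((@lebesgue_outer R n).-caratheodory [set x : Rn | A (x + v)]) => X.
have e (Y : set Rn) : @lebesgue_outer R n Y = lebesgue_outer [set x | Y (x - v)].
  by rewrite -[RHS](lebesgue_shift _ v)/=; under eq_set do rewrite addrK.
rewrite e [in RHS]e [X in (_ + X)%E]e.
have {}mA : (@lebesgue_outer R n).-caratheodory A by [].
rewrite (mA [set x : Rn | X (x - v)]) /=.
have shiftI (P : set Rn -> set Rn) :
    (forall Y, P [set x : Rn | Y (x + v)] = [set x | P Y (x + v)]) ->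
    [set x : Rn | X (x - v)] `&` P A = [set x | (X `&` P [set x | A (x + v)]) (x - v)].
  by move=> PE; rewrite PE; apply/seteqP; split=> x [] /=; rewrite subrK.
by rewrite -(shiftI id)// -(shiftI setC).
Qed.

Lemma lebesgue_integral_shift (f : Rn -> \bar R) v : leb.-integrable setT f ->
  leb.-integrable setT (fun x => f (x + v)) /\
  (\int[leb]_x f (x + v)%R = \int[leb]_x f x)%E.
Proof.
exact: (integral_measure_preserving (measurable_shift v) (fun A _ => lebesgue_shift A v)).
Qed.

End lebesgue_measurable_sets.

(** * Calculus of real-valued integrals *)

Section real_integrals.
Context d (T : measurableType d) (R : realType) (mu : {measure set T -> \bar R}).
Implicit Types f g h : T -> R.
Local Notation L1 f := (mu.-integrable [set: T] (EFin \o f)).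

Lemma L1_measurable f : L1 f -> measurable_fun setT f.
Proof. by move=> /measurable_int /measurable_EFinP. Qed.

Lemma L1_le f g : measurable_fun setT f -> (forall x, `|f x| <= g x) ->
  L1 g -> L1 f.
Proof.
move=> mf fg ig; apply: (le_integrable _ _ _ ig) => //.
  exact/measurable_EFinP.
by move=> x _ /=; rewrite lee_fin (le_trans (fg x))// ler_norm.
Qed.

Lemma L1D f g : L1 f -> L1 g -> L1 (fun x => f x + g x).
Proof.
by move=> fi gi; apply: (eq_integrable _ (fun x => (f x)%:E + (g x)%:E)%E) => //;
  exact: integrableD.
Qed.

Lemma L1Z (k : R) f : L1 f -> L1 (fun x => k * f x).
Proof.
move=> fi; apply: (eq_integrable _ (fun x => k%:E * (f x)%:E)%E) => //.
exact: integrableZl.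
Qed.

Lemma L1N f : L1 f -> L1 (fun x => - f x).
Proof.
by move=> /(L1Z (-1)); apply: eq_integrable => // x _ /=; rewrite mulN1r.
Qed.

Lemma L1B f g : L1 f -> L1 g -> L1 (fun x => f x - g x).
Proof. by move=> fi gi; apply: (L1D fi); exact: L1N. Qed.

Lemma L1_norm f : L1 f -> L1 (fun x => `|f x|).
Proof. by move=> fi; exact: (integrable_abse fi). Qed.

Lemma L1_sum (I : Type) (s : seq I) (F : I -> T -> R) :
  (forall i, L1 (F i)) -> L1 (fun x => \sum_(i <- s) F i x).
Proof.
move=> Fi; elim: s => [|i s ih].
  by under eq_fun do rewrite big_nil; exact: integrable0.
by under eq_fun do rewrite big_cons; exact: L1D.
Qed.

Lemma L1_max f g : L1 f -> L1 g -> L1 (fun x => Num.max (f x) (g x)).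
Proof.
move=> fi gi; apply: (@L1_le _ (fun x => `|f x| + `|g x|)).
- exact: measurable_maxr (L1_measurable fi) (L1_measurable gi).
- move=> x; have := normr_ge0 (f x); have := normr_ge0 (g x).
  by have [fg|fg] := leP (f x) (g x); lra.
- by apply: L1D; exact: L1_norm.
Qed.

Lemma L1_bounded_mul f g (M : R) : measurable_fun setT f ->
  (forall x, `|f x| <= M) -> L1 g -> L1 (fun x => f x * g x).
Proof.
move=> mf fM ig; apply: (@L1_le _ (fun x => M * `|g x|)).
- by apply: measurable_funM => //; exact: L1_measurable.
- by move=> x; rewrite normrM ler_wpM2r.
- by apply: L1Z; exact: L1_norm.
Qed.

Lemma L1_indic (A : set T) : measurable A -> (mu A < +oo)%E -> L1 (\1_A).
Proof.
move=> mA muA; apply/integrableP; split.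
  by apply/measurable_EFinP; exact: measurable_indic.
rewrite (eq_integral (fun x => (\1_A x)%:E)); last first.
  by move=> x _ /=; rewrite ger0_norm.
by rewrite integral_indic// setIT.
Qed.

Lemma RintD f g : L1 f -> L1 g ->
  \int[mu]_x (f x + g x) = \int[mu]_x f x + \int[mu]_x g x.
Proof. by move=> fi gi; rewrite RintegralD. Qed.

Lemma RintB f g : L1 f -> L1 g ->
  \int[mu]_x (f x - g x) = \int[mu]_x f x - \int[mu]_x g x.
Proof. by move=> fi gi; rewrite RintegralB. Qed.

Lemma RintZ (k : R) f : L1 f -> \int[mu]_x (k * f x) = k * \int[mu]_x f x.
Proof. by move=> fi; rewrite RintegralZl. Qed.

Lemma Rint_sum (I : Type) (s : seq I) (F : I -> T -> R) :
  (forall i, L1 (F i)) ->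
  \int[mu]_x (\sum_(i <- s) F i x) = \sum_(i <- s) \int[mu]_x F i x.
Proof.
move=> Fi; elim: s => [|i s ih].
  under eq_Rintegral do rewrite big_nil.
  by rewrite big_nil /Rintegral integral0.
under eq_Rintegral do rewrite big_cons.
by rewrite big_cons RintD ?ih//; exact: L1_sum.
Qed.

Lemma Rint_le f g : L1 f -> L1 g -> (forall x, f x <= g x) ->
  \int[mu]_x f x <= \int[mu]_x g x.
Proof. by move=> fi gi fg; apply: le_Rintegral. Qed.

Lemma Rint_le_ae f g : L1 f -> L1 g -> (\forall x \ae mu, f x <= g x) ->
  \int[mu]_x f x <= \int[mu]_x g x.
Proof.
move=> fi gi fg; rewrite -subr_ge0 -RintB// /Rintegral fine_ge0//.
rewrite (ae_eq_integral (fun x => `|g x - f x|%:E))//; last 3 first.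
- by apply: (measurable_int mu); exact: L1B.
- by apply: (measurable_int mu); apply: L1_norm; exact: L1B.
- by apply: filterS fg => x /= fx _; rewrite ger0_norm// subr_ge0.
- by apply: integral_ge0 => x _; rewrite lee_fin.
Qed.

Lemma Rint_norm f : L1 f -> `|\int[mu]_x f x| <= \int[mu]_x `|f x|.
Proof. by move=> fi; exact: le_normr_Rintegral. Qed.

Lemma Rint_dist f g h : L1 f -> L1 g -> L1 h ->
  \int[mu]_x `|f x - h x| <=
  \int[mu]_x `|f x - g x| + \int[mu]_x `|g x - h x|.
Proof.
move=> fi gi hi; rewrite -RintD; [|by apply: L1_norm; exact: L1B..].
apply: Rint_le; first by apply: L1_norm; exact: L1B.
  by apply: L1D; apply: L1_norm; exact: L1B.
by move=> x; have := ler_normD (f x - g x) (g x - h x); rewrite addrA subrK.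
Qed.

Lemma Rint_dct (f_ : nat -> T -> R) f g :
  (forall k, measurable_fun setT (f_ k)) -> measurable_fun setT f ->
  (\forall x \ae mu, f_ ^~ x @ \oo --> f x) -> L1 g ->
  (forall k x, `|f_ k x| <= g x) ->
  L1 f /\ \int[mu]_x f_ k x @[k --> \oo] --> \int[mu]_x f x.
Proof.
move=> mf_ mf ff ig fg.
have [iF _ cF] := @dominated_convergence _ _ _ mu setT measurableT
  (fun k => EFin \o f_ k) (EFin \o f) (EFin \o g)
  (fun k => (measurable_EFinP _ _).2 (mf_ k)) ((measurable_EFinP _ _).2 mf)
  ltac:(by apply: filterS ff => x fx _; apply/cvg_EFin; [exact: nearW|exact: fx])
  ig ltac:(by apply: aeW => x k _ /=; rewrite lee_fin).
split => //; apply: fine_cvg.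
rewrite fineK//; exact: integrable_fin_num.
Qed.

End real_integrals.

Lemma lipschitz_le_continuous (R : realType) (V W : normedModType R)
    (f : V -> W) (k : R) :
  (forall x y, `|f x - f y| <= k * `|x - y|) -> continuous f.
Proof.
move=> fk x; apply/cvgrPdist_le => e e0.
have k1 : 0 < `|k| + 1 by rewrite ltr_wpDl.
apply/nbhs_ballP; exists (e / (`|k| + 1)); first exact: divr_gt0.
move=> y; rewrite -ball_normE /= => /ltW; rewrite ler_pdivlMr// mulrC => h.
rewrite (le_trans (fk _ _))// (le_trans _ h)// ler_wpM2r//.
by rewrite (le_trans (ler_norm k))// lerDl.
Qed.

(** * Density of Lipschitz functions in L^1 *)

Section lipschitz_dense.
Import HBSimple.
Context {R : realType} {n : nat}.
Local Notation Rn := 'rV[R]_n.+1.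
Local Notation leb := (lebesgue R n).
Local Notation L1 f := (leb.-integrable [set: lebesgue_space R n] (EFin \o f)).
Implicit Types (f s : Rn -> R).

Definition lipschitz_on_space s : Prop :=
  exists2 k : R, 0 <= k & forall x y, `|s x - s y| <= k * `|x - y|.

Lemma lipschitz_on_space_continuous s : lipschitz_on_space s -> continuous s.
Proof. by move=> [k _ /(@lipschitz_le_continuous R Rn R^o s k)]. Qed.

Lemma lipschitz_on_spaceD f s : lipschitz_on_space f -> lipschitz_on_space s ->
  lipschitz_on_space (fun x => f x + s x).
Proof.
move=> [k k0 fk] [l l0 sl]; exists (k + l); first exact: addr_ge0.
move=> x y; rewrite opprD addrACA (le_trans (ler_normD _ _))// mulrDl.
by rewrite lerD.
Qed.

Lemma lipschitz_on_spaceZ (c : R) s : lipschitz_on_space s ->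
  lipschitz_on_space (fun x => c * s x).
Proof.
move=> [l l0 sl]; exists (`|c| * l); first by rewrite mulr_ge0.
by move=> x y; rewrite -mulrBr normrM -mulrA ler_wpM2l.
Qed.

Lemma distr_max (a b c e : R) :
  `|Num.max a b - Num.max c e| <= Num.max `|a - c| `|b - e|.
Proof.
set m := (X in _ <= X).
have : `|a - c| <= m by rewrite le_max lexx.
have : `|b - e| <= m by rewrite le_max lexx orbT.
rewrite !ler_distl; move: m => m /andP[? ?] /andP[? ?].
by have [ab|ab] := leP a b; have [ce|ce] := leP c e; apply/andP; split; lra.
Qed.

Lemma lipschitz_on_space_max f s : lipschitz_on_space f ->
  lipschitz_on_space s -> lipschitz_on_space (fun x => Num.max (f x) (s x)).
Proof.
move=> [k k0 fk] [l l0 sl]; exists (k + l); first exact: addr_ge0.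
move=> x y; rewrite (le_trans (distr_max _ _ _ _))// ge_max.
have := fk x y; have := sl x y; have := normr_ge0 (x - y).
by move=> xy slxy fkxy; apply/andP; split; nra.
Qed.

(** This is the L^1 closure of the integrable Lipschitz functions. Its stability under sums,
    multiples, maxima and limits makes it grow from boxes to all of L^1. Lipschitz approximations
    have a uniformly small oscillation over the supports of fine lattice hats. *)
Definition lipschitz_approx f : Prop :=
  L1 f /\ forall e : R, 0 < e -> exists s,
    [/\ lipschitz_on_space s, L1 s & \int[leb]_x `|f x - s x| <= e].

Lemma lipschitz_approx_lim f : L1 f ->
  (forall e : R, 0 < e ->
     exists2 g, lipschitz_approx g & \int[leb]_x `|f x - g x| <= e) ->
  lipschitz_approx f.
Proof.
move=> fi fg; split => // e e0.
have e2 : 0 < e / 2 by rewrite divr_gt0.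
have [g [gi gs] fge] := fg _ e2; have [s [sl si gse]] := gs _ e2.
exists s; split => //; rewrite (le_trans (Rint_dist fi gi si))//.
by rewrite [e]splitr lerD.
Qed.

Lemma lipschitz_approxD f g : lipschitz_approx f -> lipschitz_approx g ->
  lipschitz_approx (fun x => f x + g x).
Proof.
move=> [fi fs] [gi gs]; split; first exact: L1D.
move=> e e0; have e2 : 0 < e / 2 by rewrite divr_gt0.
have [s [sl si fse]] := fs _ e2; have [t [tl ti gte]] := gs _ e2.
exists (fun x => s x + t x); split;
  [exact: lipschitz_on_spaceD|exact: L1D|].
rewrite (@le_trans _ _ (\int[leb]_x (`|f x - s x| + `|g x - t x|)))//.
  apply: Rint_le.
  - by apply: L1_norm; apply: L1B; exact: L1D.
  - by apply: L1D; apply: L1_norm; exact: L1B.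
  - by move=> x; rewrite opprD addrACA ler_normD.
rewrite RintD; [|by apply: L1_norm; exact: L1B..].
by rewrite [leRHS]splitr lerD.
Qed.

Lemma lipschitz_approxZ (c : R) f : lipschitz_approx f ->
  lipschitz_approx (fun x => c * f x).
Proof.
move=> [fi fs]; split; first exact: L1Z.
move=> e e0; have c1 : 0 < `|c| + 1 by rewrite ltr_wpDl.
have [s [sl si fse]] := fs _ (divr_gt0 e0 c1).
exists (fun x => c * s x); split;
  [exact: lipschitz_on_spaceZ|exact: L1Z|].
under eq_Rintegral do rewrite -mulrBr normrM.
rewrite RintZ; last by apply: L1_norm; exact: L1B.
move: fse; rewrite ler_pdivlMr// => fse; apply: le_trans fse.
rewrite mulrC ler_wpM2l ?lerDl//.
by apply: Rintegral_ge0.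
Qed.

Lemma lipschitz_approx_max f g : lipschitz_approx f -> lipschitz_approx g ->
  lipschitz_approx (fun x => Num.max (f x) (g x)).
Proof.
move=> [fi fs] [gi gs]; split; first exact: L1_max.
move=> e e0; have e2 : 0 < e / 2 by rewrite divr_gt0.
have [s [sl si fse]] := fs _ e2; have [t [tl ti gte]] := gs _ e2.
exists (fun x => Num.max (s x) (t x)); split;
  [exact: lipschitz_on_space_max|exact: L1_max|].
rewrite (@le_trans _ _ (\int[leb]_x (`|f x - s x| + `|g x - t x|)))//.
  apply: Rint_le.
  - by apply: L1_norm; apply: L1B; exact: L1_max.
  - by apply: L1D; apply: L1_norm; exact: L1B.
  - move=> x; rewrite (le_trans (distr_max _ _ _ _))// ge_max lerDl lerDr.
    by rewrite !normr_ge0.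
rewrite RintD; [|by apply: L1_norm; exact: L1B..].
by rewrite [leRHS]splitr lerD.
Qed.

Lemma lipschitz_approx0 : lipschitz_approx (fun=> 0).
Proof.
have i0 : L1 (fun=> 0 : R) by exact: integrable0.
split => // e e0; exists (fun=> 0); split => //.
  by exists 0 => // x y; rewrite subrr normr0 mul0r.
under eq_Rintegral do rewrite subrr normr0.
by rewrite /Rintegral integral0 ltW.
Qed.

Lemma lipschitz_approx_sum (I : Type) (r : seq I) (F : I -> Rn -> R) :
  (forall i, lipschitz_approx (F i)) ->
  lipschitz_approx (fun x => \sum_(i <- r) F i x).
Proof.
move=> Fi; elim: r => [|i r ih].
  by under eq_fun do rewrite big_nil; exact: lipschitz_approx0.
by under eq_fun do rewrite big_cons; exact: lipschitz_approxD.
Qed.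

(** The minimum over [i] of k (x_i - a_i) and 1 - k (x_i - b_i), clamped to [0, 1]; minima are
    written as opposites of maxima, and the initial value -1 gives the cap 1. The ramps rise inside
    the box at [a] and fall outside it at [b], so that the pointwise limit is exactly the indicator
    of the half-open box. *)
Let trapezoid (a b : Rn) (k : nat) (x : Rn) : R :=
  Num.max 0 (- \big[Num.max/-1]_(i < n.+1)
    Num.max (- (k%:R * (x ord0 i - a ord0 i))) (k%:R * (x ord0 i - b ord0 i) - 1)).

Let trapezoid_lipschitz a b k : lipschitz_on_space (trapezoid a b k).
Proof.
have cst (c : R) : lipschitz_on_space (fun=> c).
  by exists 0 => // x y; rewrite subrr normr0 mul0r.
apply: lipschitz_on_space_max => //.
suff L : lipschitz_on_space (fun x => \big[Num.max/-1]_(i < n.+1)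
    Num.max (- (k%:R * (x ord0 i - a ord0 i))) (k%:R * (x ord0 i - b ord0 i) - 1)).
  by have := lipschitz_on_spaceZ (-1) L; under eq_fun do rewrite mulN1r.
elim: (index_enum _) => [|i r ih].
  by under eq_fun do rewrite big_nil; exact: cst.
under eq_fun do rewrite big_cons; apply: lipschitz_on_space_max => //.
have xi (x y : Rn) : `|x ord0 i - y ord0 i| <= `|x - y|.
  by have /rV_norm_le/(_ i) := lexx `|x - y|; rewrite !mxE.
apply: lipschitz_on_space_max; exists k%:R => // x y.
  rewrite (_ : _ - _ = - (k%:R * (x ord0 i - y ord0 i))); last by ring.
  by rewrite normrN normrM ger0_norm// ler_wpM2l.
rewrite (_ : _ - _ = k%:R * (x ord0 i - y ord0 i)); last by ring.
by rewrite normrM ger0_norm// ler_wpM2l.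
Qed.

Let trapezoid_ge0 a b k x : 0 <= trapezoid a b k x.
Proof. by rewrite /trapezoid le_max lexx. Qed.

Let trapezoid_le1 a b k x : trapezoid a b k x <= 1.
Proof.
rewrite /trapezoid ge_max ler01 lerNl.
by apply/bigmax_geP; left.
Qed.

Let trapezoid_eq0 (a b : Rn) k (x : Rn) (i : 'I_n.+1) :
  x ord0 i <= a ord0 i \/ 1 <= k%:R * (x ord0 i - b ord0 i) ->
  trapezoid a b k x = 0.
Proof.
move=> h; apply/eqP; rewrite eq_le trapezoid_ge0 andbT /trapezoid ge_max lexx lerNl oppr0.
apply/bigmax_geP; right; exists i => //.
rewrite le_max; case: h => h; apply/orP; [left|right].
  by rewrite oppr_ge0 mulr_ge0_le0 ?subr_le0.
by rewrite subr_ge0.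
Qed.

Let trapezoid_cvg (a b x : Rn) : trapezoid a b k x @[k --> \oo] --> (\1_(box a b) x : R).
Proof.
apply/cvgrPdist_le => e e0.
suff : \forall k \near \oo, (\1_(box a b) x : R) = trapezoid a b k x.
  by apply: filterS => k ->; rewrite subrr normr0 ltW.
have big (t : R) : 0 < t -> \forall k \near \oo, 1 <= k%:R * t.
  move=> t0; have := nbhs_infty_ger t^-1; apply: filterS => k.
  by rewrite -ler_pdivrMr// mul1r.
have [xab|] := pselect (box a b x); last first.
  move=> xab; rewrite indicE memNset//=.
  have [i xi] : exists i, x ord0 i <= a ord0 i \/ b ord0 i < x ord0 i.
    apply: contrapT => /forallNP h; apply: xab => i.
    have := h i => /not_orP[/negP]; rewrite -ltNge => ->.
    by move=> /negP; rewrite -leNgt.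
  case: xi => xi; first by apply: nearW => k; rewrite (@trapezoid_eq0 _ _ _ _ i)//; left.
  have := big (x ord0 i - b ord0 i); rewrite subr_gt0 => /(_ xi).
  by apply: filterS => k hk; rewrite (@trapezoid_eq0 _ _ _ _ i)//; right.
rewrite indicE mem_set//=.
have : \forall k \near \oo, forall i : 'I_n.+1, 1 <= k%:R * (x ord0 i - a ord0 i).
  apply: filter_forall => i; apply: big; rewrite subr_gt0.
  by case/andP: (xab i).
apply: filterS => k hk; apply/eqP; rewrite eq_le trapezoid_le1 andbT.
rewrite /trapezoid le_max lerNr; apply/orP; right; apply/bigmax_leP; split => // i _.
rewrite ge_max lerN2 hk /= gerDr.
by rewrite mulr_ge0_le0// subr_le0; case/andP: (xab i).
Qed.

Let lipschitz_approx_box a b : lipschitz_approx (\1_(box a b)).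
Proof.
pose b1 : Rn := \row_i (b ord0 i + 1).
have fin c e : (leb (box c e) < +oo)%E.
  by rewrite (le_lt_trans (lebesgue_box_le c e))// ltry.
have ib c e : L1 (\1_(box c e)).
  exact: (@L1_indic _ _ _ leb _ (lmeasurable_box _ _) (fin _ _)).
split => //.
have mt k : measurable_fun setT (trapezoid a b k : lebesgue_space R n -> R).
  apply: continuous_lmeasurable_fun; first exact: measurableT.
  exact/lipschitz_on_space_continuous/trapezoid_lipschitz.
(* With slope at least 1, the outer ramp has width at most 1, so every trapezoid is supported in the
   box enlarged by 1; its indicator dominates them all. *)
have le1 k x : `|trapezoid a b k.+1 x| <= \1_(box a b1) x.
  rewrite ger0_norm//.
  have [xab|xab] := pselect (box a b1 x); first by rewrite indicE mem_set.
  rewrite indicE memNset//=.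
  have [i xi] : exists i, x ord0 i <= a ord0 i \/ b ord0 i + 1 < x ord0 i.
    apply: contrapT => /forallNP h; apply: xab => i.
    have := h i => /not_orP[/negP]; rewrite -ltNge mxE => ->.
    by move=> /negP; rewrite -leNgt.
  rewrite (@trapezoid_eq0 _ _ _ _ i)//; case: xi => xi; [by left|right].
  rewrite -[leLHS]mulr1 ler_pM//; last by lra.
  by rewrite ler1n.
have it k : L1 (trapezoid a b k.+1) by exact: (L1_le (mt _) (le1 k)).
have mb := L1_measurable (ib a b).
have [|||||_] := @Rint_dct _ _ _ leb (fun k x => `|\1_(box a b) x - trapezoid a b k.+1 x|)
  (fun=> 0) (fun x => \1_(box a b1) x + \1_(box a b) x).
- by move=> k; apply: measurableT_comp; [exact: normr_measurable|exact: measurable_funB].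
- exact: measurable_cst.
- apply: aeW => x; apply/norm_cvg0P; rewrite -[X in _ --> X](subrr (\1_(box a b) x)).
  apply: cvgB; first exact: cvg_cst.
  by rewrite (cvg_shiftS (fun k => trapezoid a b k x)); exact: trapezoid_cvg.
- exact: L1D.
- move=> k x; rewrite normr_id (le_trans (ler_normB _ _))// addrC lerD//.
  by rewrite ger0_norm.
rewrite [X in _ --> X](_ : _ = 0); last by rewrite /Rintegral integral0.
move=> /cvgrPdist_le h e e0; near \oo => k.
exists (trapezoid a b k.+1); split; [exact: trapezoid_lipschitz|exact: it|].
have : `|0 - \int[leb]_x `|\1_(box a b) x - trapezoid a b k.+1 x| | <= e.
  by near: k; exact: h.
by rewrite sub0r normrN; apply: le_trans; exact: ler_norm.
Unshelve. all: by end_near. Qed.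

Let lipschitz_approx_indic (A : set Rn) : lmeasurable A -> (leb A < +oo)%E ->
  lipschitz_approx (\1_A).
Proof.
move=> mA Afin; apply: lipschitz_approx_lim; first exact: L1_indic.
move=> e e0.
have [_ [B AB <-] BA] : exists2 y : \bar R,
    [set (\sum_(k <oo) (box_volume (B k).1 (B k).2)%:E)%E | B in box_cover A] y &
    (y < leb A + (e / 2)%:E)%E.
  have Afn : lebesgue_outer A \is a fin_num by rewrite ge0_fin_numE//; exact: (measure_ge0 leb).
  by apply: ereal_inf_lt; rewrite -[ltLHS]adde0 lteD2lE// lte_fin divr_gt0.
pose C k := box (B k).1 (B k).2; pose U := \bigcup_k C k.
pose UN N := \bigcup_(k in `I_N) C k.
have mC k : lmeasurable (C k) by exact: lmeasurable_box.
have mU : lmeasurable U by apply: bigcupT_measurable => k; exact: mC.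
have mUN N : lmeasurable (UN N) by apply: bigcup_measurable => k _; exact: mC.
have vol0 k : (0 <= (box_volume (B k).1 (B k).2)%:E :> \bar R)%E.
  by rewrite lee_fin; apply: prodr_ge0 => i _; rewrite le_max lexx.
have tail_le N : (leb (U `\` UN N) <=
    \sum_(N <= k <oo) (box_volume (B k).1 (B k).2)%:E)%E.
  apply: (@le_trans _ _ (leb (\bigcup_(k in ~` `I_N) C k))).
    apply: (@le_outer_measure R _ (@lebesgue_outer R n)) => x [[k _ Ck] nUN].
    by exists k => //= kN; apply: nUN; exists k.
  apply: (le_trans (outer_measure_sigma_subadditive_tail _ _ _)).
  by apply: lee_nneseries => k _; [|exact: lebesgue_box_le].
have Ule : (leb U <= \sum_(k <oo) (box_volume (B k).1 (B k).2)%:E)%E.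
  have := tail_le 0%N; rewrite (_ : U `\` _ = U)//.
  by rewrite /UN II0 bigcup_set0 setD0.
have Ufin : (leb U < +oo)%E.
  by apply: (le_lt_trans Ule); apply: (lt_le_trans BA); rewrite leey.
have e2 : 0 < e / 2 by rewrite divr_gt0.
have [N tailN] : exists N, (leb (U `\` UN N) <= (e / 2)%:E)%E.
  have := nneseries_tail_cvg (lt_trans BA (lte_add_pinfty Afin (ltry _)))
    (fun k _ => vol0 k).
  move=> /fine_cvgP[ffin /cvgrPdist_le/(_ _ e2) h].
  near \oo => N; exists N; rewrite (le_trans (tail_le N))//.
  have fN : (\sum_(N <= k <oo) (box_volume (B k).1 (B k).2)%:E)%E \is a fin_num.
    by near: N; exact: ffin.
  rewrite -(fineK fN) lee_fin (le_trans (ler_norm _))//.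
  by rewrite -normrN -[X in `|X|]sub0r; near: N; exact: h.
have AU : A `<=` U by move=> x /AB[k _ Bx]; exists k.
have UA : (leb (U `\` A) <= (e / 2)%:E)%E.
  have Afn : leb A \is a fin_num by rewrite ge0_fin_numE.
  rewrite -(leeD2rE _ _ Afn).
  have -> : (leb (U `\` A) + leb A = leb U)%E.
    by rewrite [RHS](measureDI _ mU mA); congr (_ + leb _)%E; rewrite setIidr.
  by rewrite addeC; apply: ltW; exact: le_lt_trans BA.
have UNfin M : (leb (UN M) < +oo)%E.
  apply: le_lt_trans Ufin.
  apply: (@le_outer_measure R _ (@lebesgue_outer R n)) => x [k _ Ck].
  by exists k.
have subUfin (Y : set Rn) : (leb (U `\` Y) < +oo)%E.
  by apply: le_lt_trans Ufin; apply: (@le_outer_measure R _ (@lebesgue_outer R n)) => x [].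
exists (\1_(UN N)).
  elim: N {tailN} => [|M ih].
    rewrite /UN II0 bigcup_set0 indic0; exact: lipschitz_approx0.
  rewrite (_ : \1_(UN M.+1) = (fun x => Num.max (\1_(UN M) x) (\1_(C M) x))).
    by apply: lipschitz_approx_max => //; exact: lipschitz_approx_box.
  apply/funext => x; rewrite /UN IIS bigcup_setU bigcup_set1 !indicE in_setU.
  by case: (x \in _); case: (x \in C M); rewrite /= ?maxxx// ?(max_l ler01) ?(max_r ler01).
have iD (Y : set Rn) : lmeasurable Y -> L1 (\1_(U `\` Y)).
  move=> mY; apply: (@L1_indic _ _ _ leb _ _ (subUfin _)).
  exact: measurableD.
have RiD (Y : set Rn) : lmeasurable Y -> (leb (U `\` Y) <= (e / 2)%:E)%E ->
    \int[leb]_x \1_(U `\` Y) x <= e / 2.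
  move=> mY Ye; rewrite /Rintegral.
  rewrite (_ : (fun x => _) = (fun x => (\1_(U `\` Y) x)%:E))//.
  rewrite integral_indic; [|exact: measurableT|exact: measurableD].
  have fn : leb (U `\` Y) \is a fin_num.
    by rewrite ge0_fin_numE; [exact: subUfin|exact: (measure_ge0 leb)].
  by rewrite setIT -lee_fin fineK.
rewrite [leRHS]splitr (le_trans _ (lerD (RiD _ mA UA) (RiD _ (mUN N) tailN)))//.
rewrite -RintD; [|exact: iD..].
apply: Rint_le.
- apply: L1_norm; apply: L1B; first exact: L1_indic.
  exact: (@L1_indic _ _ _ leb _ (mUN N) (UNfin N)).
- by apply: L1D; exact: iD.
move=> x; rewrite !indicE !in_setD.
have [/set_mem/AU/mem_set ->|xA] := boolP (x \in A).
  by case: (x \in UN N); rewrite /= ?subrr ?subr0 ?normr0 ?normr1 ?add0r.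
have [|_] := boolP (x \in UN N); last by rewrite subrr normr0 addr_ge0.
move=> /set_mem[k _ Ck]; have -> : x \in U by apply: mem_set; exists k.
by rewrite sub0r normrN normr1 /= lerDl.
Unshelve. all: by end_near. Qed.

Lemma lipschitz_approx_L1 f : L1 f -> lipschitz_approx f.
Proof.
move=> fi; apply: lipschitz_approx_lim => // e e0.
have [g_ [gi _ gf]] := approximation_sfun_integrable measurableT fi.
have [k gk] : exists k, \int[leb]_x `|f x - g_ k x| <= e.
  move: gf => /fine_cvgP[_ /cvgrPdist_le/(_ _ e0) h]; near \oo => k; exists k.
  rewrite (le_trans (ler_norm _))// -normrN -[X in `|X|]sub0r.
  by near: k; exact: h.
exists (g_ k) => //.
rewrite [X in lipschitz_approx X](funext (fimfunEord (g_ k))).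
apply: lipschitz_approx_sum => i; set y := _`_i.
have [->|y0] := eqVneq y 0.
  by under eq_fun do rewrite mul0r; exact: lipschitz_approx0.
apply: lipschitz_approxZ; apply: lipschitz_approx_indic.
  exact: measurable_sfunP.
have y0' : 0 < `|y| by rewrite normr_gt0.
(* Markov's inequality: the level set of a nonzero value of an integrable function has finite
   measure. *)
have := @le_integral_abse _ _ _ leb setT measurableT (EFin \o g_ k) `|y|
  (measurable_int _ (gi k)) y0'.
rewrite setTI => h.
have : (`|y|%:E * leb [set x | (`|y|%:E <= `|(EFin \o g_ k) x|)%E] < +oo)%E.
  by apply: le_lt_trans h _; have /integrableP[] := gi k.
move=> {}h; rewrite ltNge leye_eq; apply/negP => /eqP goo.
move: h; rewrite (_ : leb _ = +oo%E) ?gt0_muley// ?lte_fin//.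
apply/eqP; rewrite -leye_eq -goo.
by apply: (@le_outer_measure R _ (@lebesgue_outer R n)) => x /= ->.
Unshelve. all: by end_near. Qed.

End lipschitz_dense.

(** * Smooth partitions of unity on a lattice *)

Section smooth_functions_of_one_variable.
Context {R : realType}.
Implicit Types (f g : R -> R) (k : nat).

(** Being of class C^k, with the derivative supplied as a witness, so that closure properties reduce
    to exhibiting a formula for it. *)
Fixpoint smooth1 k f : Prop :=
  match k with
  | 0 => continuous f
  | k'.+1 => exists2 f', (forall t, is_derive t (1 : R) f (f' t)) & smooth1 k' f'
  end.

Lemma is_derive1_continuous f f' :
  (forall t, is_derive t (1 : R) f (f' t)) -> continuous f.
Proof.
move=> df t; apply: differentiable_continuous; apply/derivable1_diffP.
by have [] := df t.
Qed.

Lemma smooth1_continuous k f : smooth1 k f -> continuous f.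
Proof. by case: k => // k [f' df _]; exact: is_derive1_continuous df. Qed.

Lemma smooth1S k f : smooth1 k.+1 f -> smooth1 k f.
Proof.
elim: k f => [|k ih] f [f' df sf']; first exact: is_derive1_continuous df.
by exists f' => //; exact: ih.
Qed.

Lemma smooth1D k f g : smooth1 k f -> smooth1 k g ->
  smooth1 k (fun t => f t + g t).
Proof.
elim: k f g => [|k ih] f g /=; first by move=> cf cg t; exact: (cvgD (cf t) (cg t)).
move=> [f' df sf] [g' dg sg]; exists (fun t => f' t + g' t); last exact: ih.
by move=> t; exact: is_deriveD.
Qed.

Lemma smooth1Z k (c : R) f : smooth1 k f -> smooth1 k (fun t => c * f t).
Proof.
elim: k f => [|k ih] f /=; first by move=> cf t; exact: (cvgM (cvg_cst _) (cf t)).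
move=> [f' df sf]; exists (fun t => c * f' t); last exact: ih.
by move=> t; exact: is_deriveZ.
Qed.

Lemma smooth1B k f g : smooth1 k f -> smooth1 k g ->
  smooth1 k (fun t => f t - g t).
Proof.
move=> sf sg; under eq_fun do rewrite -mulN1r.
by apply: smooth1D => //; exact: smooth1Z.
Qed.

Lemma smooth1M k f g : smooth1 k f -> smooth1 k g ->
  smooth1 k (fun t => f t * g t).
Proof.
elim: k f g => [|k ih] f g; first by move=> cf cg t; exact: (cvgM (cf t) (cg t)).
move=> /[dup] /smooth1S sf [f' df sf'] /[dup] /smooth1S sg [g' dg sg'].
exists (fun t => f t * g' t + g t * f' t).
  by move=> t; exact: is_deriveM.
by apply: smooth1D; exact: ih.
Qed.

Lemma is_derive_affine f (a b t df : R) : is_derive (a * t + b) (1 : R) f df ->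
  is_derive t (1 : R) (fun t => f (a * t + b)) (a * df).
Proof.
move=> h; have := @is_derive1_comp _ f (fun t => a * t + b) t df a h.
rewrite mulrC; apply.
rewrite -[X in is_derive _ _ _ X]addr0 -[X in is_derive _ _ _ (X + _)]mulr1.
by apply: is_deriveD; exact: is_deriveZ.
Qed.

Lemma smooth1_affine k f (a b : R) : smooth1 k f ->
  smooth1 k (fun t => f (a * t + b)).
Proof.
elim: k f => [|k ih] f /=.
  move=> cf t; apply: continuous_comp; last exact: cf.
  by apply: cvgD; [apply: cvgM; [exact: cvg_cst|exact: cvg_id]|exact: cvg_cst].
move=> [f' df sf]; exists (fun t => a * f' (a * t + b)).
  by move=> t; exact: is_derive_affine.
by apply: smooth1Z; exact: ih.
Qed.

(* The functions [t^-m exp(-1/t)], extended by 0, form a family stable under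
   differentiation. *)
Let flat (m : nat) (t : R) : R :=
  if 0 < t then t^-1 ^+ m * expR (- t^-1) else 0.

(** This follows from exp (1/t) >= t^-(m+2) / (m+2)!. The quadratic decay makes the difference
    quotients at 0 tend to 0. *)
Let flat_le m (t : R) : 0 < t -> `|flat m t| <= (m.+2)`!%:R * t ^+ 2.
Proof.
move=> t0; have s0 : 0 < t^-1 by rewrite invr_gt0.
rewrite /flat t0 ger0_norm; last by rewrite mulr_ge0 ?expR_ge0// exprn_ge0// ltW.
rewrite expRN ler_pdivrMr ?expR_gt0//.
have F0 : 0 < (m.+2)`!%:R :> R by rewrite ltr0n fact_gt0.
have h : t^-1 ^+ m.+2 / (m.+2)`!%:R <= expR t^-1.
  by apply: (le_trans _ (expR_ge1Dxn m.+1 (ltW s0))); rewrite lerDr.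
apply: le_trans (ler_wpM2l _ h); last by rewrite mulr_ge0 ?exprn_ge0// ltW.
rewrite [X in _ <= _ * X]mulrC mulrACA mulfV ?gt_eqF// mul1r.
by rewrite -(addn2 m) exprD mulrCA -exprMn mulfV ?gt_eqF// expr1n mulr1.
Qed.

Let flat_derive m t :
  is_derive t (1 : R) (flat m) (- m%:R * flat m.+1 t + flat m.+2 t).
Proof.
have [t0|t0|<-] := ltgtP 0 t.
- have e : \forall s \near t, s^-1 ^+ m * expR (- s^-1) = flat m s.
    by near=> s; rewrite /flat ifT//; near: s; exact: lt_nbhsr.
  apply: (near_eq_is_derive e).
  have dV : is_derive t (1 : R) (fun s : R => s^-1) (- t ^- 2).
    have := @is_deriveV _ id t 1 1 _ (is_derive_id _ _).
    by rewrite gt_eqF// => /(_ isT); rewrite scaler1.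
  have dE : is_derive t (1 : R) (fun s : R => expR (- s^-1)) (expR (- t^-1) * t ^- 2).
    apply: (@is_derive1_comp _ expR (fun s => - s^-1)).
    by rewrite -[t ^- 2]opprK; exact: is_deriveN.
  have dX := @is_deriveX _ _ (fun s : R => s^-1) m t 1 _ dV.
  have -> : (fun s : R => s^-1 ^+ m * expR (- s^-1)) =
      ((fun s : R => s^-1) ^+ m * (fun s : R => expR (- s^-1)))%R.
    by rewrite exprfctE mulrfctE.
  apply: is_derive_eq.
  rewrite /flat t0 !exprfctE /= /GRing.scale /=.
  have t1 : t != 0 by rewrite gt_eqF.
  case: m {dX e} => [|m].
    by rewrite !expr0 mulr0n mul0r oppr0 !mul0r mulr0 addr0 add0r -exprVn; ring.
  by rewrite -exprVn /= -mulr_natl !exprS; ring.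
- have e : \forall s \near t, cst 0 s = flat m s.
    near=> s; rewrite /flat ifF//; apply/negbTE; rewrite -leNgt ltW//.
    by near: s; exact: lt_nbhsl.
  apply: (near_eq_is_derive e).
  rewrite /flat [0 < t]ltNge (ltW t0)/= mulr0 addr0.
  exact: is_derive_cst.
rewrite /flat ltxx mulr0 addr0.
have C0 : 0 < (m.+2)`!%:R :> R by rewrite ltr0n fact_gt0.
have : h^-1 *: (flat m (h *: 1 + 0) - flat m 0) @[h --> 0^'] --> (0 : R).
  apply/cvgr0Pnorm_le => e e0; near=> h.
  rewrite {2}/flat ltxx subr0 addr0 /GRing.scale /= mulr1.
  have h0 : h != 0 by near: h; exact: nbhs_dnbhs_neq.
  have he : `|h| <= e / (m.+2)`!%:R.
    near: h; apply: dnbhs0_le; exact: divr_gt0.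
  have [hp|hn] := ltP 0 h; last by rewrite /flat ltNge hn /= mulr0 normr0 ltW.
  rewrite normrM normfV ler_pdivrMl ?normr_gt0// (le_trans (flat_le m hp))//.
  rewrite gtr0_norm// in he *.
  by rewrite expr2 mulrCA ler_pM2l// mulrC -ler_pdivlMr.
move=> c; apply: DeriveDef; first by apply/cvg_ex; exists 0.
exact/cvg_lim.
Unshelve. all: by end_near. Qed.

Let flat_smooth k m : smooth1 k (flat m).
Proof.
elim: k m => [|k ih] m /=; first exact: is_derive1_continuous (flat_derive m).
exists (fun t => - m%:R * flat m.+1 t + flat m.+2 t); first exact: flat_derive.
by apply: smooth1D => //; exact: smooth1Z.
Qed.

Lemma smooth_bump : exists b : R -> R, [/\ forall k, smooth1 k b,
  forall t, 0 <= b t, forall t, t <= 0 -> b t = 0,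
  forall t, 1 <= t -> b t = 0 & forall t, 0 < t < 1 -> 0 < b t].
Proof.
exists (fun t => flat 0 t * flat 0 (-1 * t + 1)); split.
- by move=> k; apply: smooth1M => //; exact: smooth1_affine.
- move=> t; rewrite /flat; case: ifP; case: ifP => *; rewrite ?mulr0 ?mul0r//.
  by rewrite !expr0 !mul1r mulr_ge0 ?expR_ge0.
- by move=> t t0; rewrite /flat ltNge t0 mul0r.
- move=> t t1; have -> : flat 0 (-1 * t + 1) = 0; last by rewrite mulr0.
  by rewrite /flat ifF//; apply/negbTE; rewrite -leNgt; lra.
- move=> t /andP[t0 t1]; rewrite /flat t0 ifT; last by lra.
  by rewrite !expr0 !mul1r mulr_gt0 ?expR_gt0.
Qed.

Lemma continuous_primitive f : continuous f -> (forall t, t <= 0 -> f t = 0) ->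
  exists F, (forall t, is_derive t (1 : R) F (f t)) /\
            (forall t, t <= 0 -> F t = 0).
Proof.
move=> cf f0.
(* The base point -1 lies strictly to the left of the support of [f], so that every t >= 0 is
   interior and the fundamental theorem of calculus applies there; at t < 0 the primitive is locally
   0. *)
pose F x := \int[@lebesgue_measure R]_(t in [set` `[(-1 : R), x]]) (f t).
have F0 t : t <= 0 -> F t = 0.
  move=> t0; rewrite /F.
  rewrite (@eq_Rintegral _ _ _ _ _ (fun=> 0)); first by rewrite /Rintegral integral0.
  by move=> s; rewrite inE /= in_itv /= => /andP[_ st]; rewrite f0// (le_trans st).
exists F; split => // t.
have [t0|t0] := ltP t 0.
  have e : \forall s \near t, cst 0 s = F s.
    by near=> s; rewrite F0// ltW//; near: s; exact: lt_nbhsl.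
  apply: (near_eq_is_derive e); rewrite f0 ?ltW//.
  exact: is_derive_cst.
have t1 : -1 < t by lra.
have tu : t < t + 1 by lra.
have fi : (@lebesgue_measure R).-integrable `[-1, t + 1] (EFin \o f).
  apply: continuous_compact_integrable; first exact: segment_compact.
  exact: continuous_subspaceT.
have [dF F'] := continuous_FTC1_closed tu fi t1 (cf t).
by apply: DeriveDef; [exact: dF|rewrite -derive1E F'].
Unshelve. all: by end_near. Qed.

Lemma is_derive_ge0_le f f' : (forall t, is_derive t (1 : R) f (f' t)) ->
  (forall t, 0 <= f' t) -> forall s t, s <= t -> f s <= f t.
Proof.
move=> df f'0 s t st.
have cf := is_derive1_continuous df.
have [c _ e] := MVT_segment st (fun x _ => df x) (continuous_subspaceT cf).
by rewrite -subr_ge0 e mulr_ge0// subr_ge0.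
Qed.

Lemma is_derive_eq0_cst f f' (a : R) :
  (forall t, is_derive t (1 : R) f (f' t)) ->
  (forall t, a <= t -> f' t = 0) -> forall t, a <= t -> f t = f a.
Proof.
move=> df f'0 t at_.
have cf := is_derive1_continuous df.
have [c cat e] := MVT_segment at_ (fun x _ => df x) (continuous_subspaceT cf).
apply/eqP; rewrite -subr_eq0 e f'0 ?mul0r//.
by move: cat; rewrite in_itv /= => /andP[].
Qed.

(* By telescoping, the integer translates of [theta] sum to 1. The translates of
   [tau t = E t - E (t - 1)] are smooth, nonnegative and compactly supported,
   with [tau' t = theta t - theta (t - 1)]. *)
Lemma smooth_partition_profile : exists S E : R -> R,
  let theta t := S t - S (t - 1) in
  [/\ forall k, smooth1 k S, forall k, smooth1 k E,
      forall t, is_derive t (1 : R) E (theta t) &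
  [/\ forall s t, s <= t -> S s <= S t,
      (forall t, t <= 0 -> S t = 0) /\ (forall t, 1 <= t -> S t = 1),
      forall s t, s <= t -> E s <= E t,
      forall t, t <= 0 -> E t = 0 & forall t, 2 <= t -> E t = E 2]].
Proof.
have [b [bs b0 bl br bp]] := smooth_bump.
have [B [dB Bl]] := continuous_primitive (smooth1_continuous (bs 0%N)) bl.
have Bmon := is_derive_ge0_le dB b0.
have Bsm k : smooth1 k B.
  by case: k => [|k]; [exact: is_derive1_continuous dB|exists b].
have Br := is_derive_eq0_cst dB br.
have B1 : 0 < B 1.
  have cB := smooth1_continuous (Bsm 0%N).
  (* By the mean value theorem [B 1] is a value of [b] inside (0, 1), hence positive; dividing by it
     normalizes [S] to 1 on the right. *)
  have [c] := MVT ltr01 (fun x _ => dB x) (continuous_subspaceT cB).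
  rewrite in_itv /= => /bp bc; rewrite subr0 mulr1 (Bl 0)// subr0 => -> //.
pose S t := (B 1)^-1 * B t.
have Smon s t : s <= t -> S s <= S t.
  by move=> st; rewrite /S ler_pM2l ?invr_gt0//; exact: Bmon.
have Sl t : t <= 0 -> S t = 0 by move=> t0; rewrite /S (Bl t)// mulr0.
have Sr t : 1 <= t -> S t = 1 by move=> t1; rewrite /S (Br t)// mulVf// gt_eqF.
have Ssm k : smooth1 k S by exact: smooth1Z.
pose th t := S t - S (t - 1).
have thsm k : smooth1 k th.
  apply: smooth1B => //; have := smooth1_affine 1 (-1) (Ssm k).
  by under eq_fun do rewrite mul1r.
have thl t : t <= 0 -> th t = 0 by move=> t0; rewrite /th !Sl ?subrr//; lra.
have thr t : 2 <= t -> th t = 0 by move=> t2; rewrite /th !Sr ?subrr//; lra.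
have th0 t : 0 <= th t by rewrite subr_ge0; apply: Smon; lra.
have [E [dE El]] := continuous_primitive (smooth1_continuous (thsm 0%N)) thl.
exists S, E; split => //; last split => //.
- by case=> [|k]; [exact: is_derive1_continuous dE|exists th].
- exact: is_derive_ge0_le dE th0.
- exact: is_derive_eq0_cst dE thr.
Qed.

End smooth_functions_of_one_variable.

Section products_of_smooth_functions.
Context {R : realType} {n : nat}.
Local Notation Rn := 'rV[R]_n.+1.
Implicit Types (F : 'I_n.+1 -> R -> R) (x : Rn) (j : 'I_n.+1).

Lemma is_derive_line (u : Rn -> R) x (v : Rn) (df : R) :
  is_derive (0 : R) (1 : R) (fun t => u (t *: v + x)) df -> is_derive x v u df.
Proof.
move=> [dg <-].
have e : (fun h : R => h^-1 *: ((u \o shift x) (h *: v) - u x)) =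
    (fun h : R => h^-1 *: (((fun t => u (t *: v + x)) \o shift (0 : R)) (h *: 1)
       - u (0 *: v + x))).
  by apply/funext => h /=; rewrite addr0 scale0r add0r /GRing.scale /= mulr1.
by apply: DeriveDef; rewrite /derivable /derive e.
Qed.

Definition prod_coord F : Rn -> R := fun x => \prod_i F i (x ord0 i).

Definition subst_coord F j (g : R -> R) : 'I_n.+1 -> R -> R :=
  fun i => if i == j then g else F i.

Lemma prod_coord_subst F j g x : prod_coord (subst_coord F j g) x =
  g (x ord0 j) * \prod_(i | i != j) F i (x ord0 i).
Proof.
rewrite /prod_coord (bigD1 j)//= /subst_coord eqxx; congr (_ * _).
by apply: eq_bigr => i /negbTE ->.
Qed.

Lemma is_derive_prod_coord F j (g : R -> R) x :
  (forall t, is_derive t (1 : R) (F j) (g t)) ->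
  is_derive x (delta_mx ord0 j) (prod_coord F) (prod_coord (subst_coord F j g) x).
Proof.
move=> dF; apply: is_derive_line.
rewrite prod_coord_subst; set c := \prod_(i | _) _.
have -> : (fun t : R => prod_coord F (t *: delta_mx ord0 j + x)) =
    (fun t => c * F j (1 * t + x ord0 j)).
  apply/funext => t; rewrite /prod_coord (bigD1 j)//= mulrC; congr (_ * _).
    by apply: eq_bigr => i ij; rewrite !mxE eqxx (negbTE ij) mulr0 add0r.
  by rewrite !mxE !eqxx mulr1 mul1r.
rewrite mulrC -[g _]mul1r.
apply: is_deriveZ; apply: is_derive_affine.
by rewrite mulr0 add0r; exact: dF.
Qed.

Lemma continuous_prod_coord F : (forall i, continuous (F i)) ->
  continuous (prod_coord F).
Proof.
move=> cF x; rewrite /prod_coord; elim: (index_enum _) => [|i r ih].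
  by under eq_fun do rewrite big_nil; exact: cst_continuous.
under eq_fun do rewrite big_cons.
apply: continuousM; last exact: ih.
apply: (@continuous_comp _ _ _ (fun x : Rn => x ord0 i)); last exact: cF.
exact: coord_continuous.
Qed.

(** A partial derivative only replaces one factor by its derivative, so it is again a product of
    one-variable functions and the induction goes on. *)
Lemma prod_coord_continuously_differentiable k F :
  (forall i, smooth1 k (F i)) -> continuously_differentiable k (prod_coord F).
Proof.
elim: k F => [|k ih] F sF; first exact: continuous_prod_coord.
have cF : continuous (prod_coord F).
  by apply: continuous_prod_coord => i; exact: smooth1_continuous (sF i).
split=> // j; have [g dg sg] := sF j.
split; first by move=> x; have [] := is_derive_prod_coord x dg.
rewrite (_ : partial j _ = prod_coord (subst_coord F j g)).
  apply: ih => i; rewrite /subst_coord; case: ifP => // _.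
  by apply: smooth1S; exact: sF.
by apply/funext => x; rewrite /partial; have [] := is_derive_prod_coord x dg.
Qed.

End products_of_smooth_functions.

Section lattice_kernels.
Context {R : realType} {n : nat} (S E : R -> R).
Let theta t := S t - S (t - 1).
Let tau t := E t - E (t - 1).
Context (Ssm : forall k, smooth1 k S) (Esm : forall k, smooth1 k E)
  (dE : forall t : R, is_derive t (1 : R) E (theta t)).
Context (Smon : forall s t, s <= t -> S s <= S t)
  (Sl : forall t : R, t <= 0 -> S t = 0) (Sr : forall t : R, 1 <= t -> S t = 1)
  (Emon : forall s t, s <= t -> E s <= E t)
  (El : forall t : R, t <= 0 -> E t = 0) (Er : forall t : R, 2 <= t -> E t = E 2).
Local Notation Rn := 'rV[R]_n.+1.
Local Notation leb := (lebesgue R n).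
Implicit Types (x y : Rn) (z : 'I_n.+1 -> R) (h : R) (j : 'I_n.+1).

Lemma theta_ge0 t : 0 <= theta t.
Proof. by rewrite subr_ge0; apply: Smon; lra. Qed.

Lemma tau_ge0 t : 0 <= tau t.
Proof. by rewrite subr_ge0; apply: Emon; lra. Qed.

Lemma theta_supp t : theta t != 0 -> 0 < t < 2.
Proof.
apply: contraNT; rewrite negb_and -!leNgt => /orP[t0|t2].
  by rewrite /theta !Sl ?subrr//; lra.
by rewrite /theta !Sr ?subrr//; lra.
Qed.

Lemma tau_supp t : tau t != 0 -> 0 < t < 3.
Proof.
apply: contraNT; rewrite negb_and -!leNgt => /orP[t0|t3].
  by rewrite /tau !El ?subrr//; lra.
by rewrite /tau [E t]Er ?[E (t - 1)]Er ?subrr//; lra.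
Qed.

Lemma theta_smooth k : smooth1 k theta.
Proof.
apply: smooth1B => //; have := smooth1_affine 1 (-1) (Ssm k).
by under eq_fun do rewrite mul1r.
Qed.

Lemma tau_smooth k : smooth1 k tau.
Proof.
apply: smooth1B => //; have := smooth1_affine 1 (-1) (Esm k).
by under eq_fun do rewrite mul1r.
Qed.

Lemma is_derive_tau t : is_derive t (1 : R) tau (theta t - theta (t - 1)).
Proof.
apply: is_deriveB => //; rewrite -[theta _]mul1r -{2}[t]mul1r.
have -> : (fun t => E (t - 1)) = (fun t => E (1 * t + -1)).
  by apply/funext => s; rewrite mul1r.
by apply: is_derive_affine; exact: dE.
Qed.

Definition lattice_hat h z : Rn -> R :=
  prod_coord (fun i t => theta (h^-1 * t + - z i)).

(** Since tau' is theta minus its translate by 1, h times the [j]-th derivative of this function is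
    the hat at [z] minus the hat at [z] + e_j. It is compactly supported, hence a legitimate test
    function. *)
Definition lattice_hat_primitive j h z : Rn -> R :=
  prod_coord (subst_coord (fun i t => theta (h^-1 * t + - z i)) j
    (fun t => tau (h^-1 * t + - z j))).

Let psi := lattice_hat.
Let chi := lattice_hat_primitive.

Definition shift_index z j : 'I_n.+1 -> R := fun i => z i + (i == j)%:R.

Lemma lattice_hat_ge0 h z x : 0 <= psi h z x.
Proof. by apply: prodr_ge0 => i _; exact: theta_ge0. Qed.

Lemma lattice_hat_primitive_ge0 j h z x : 0 <= chi j h z x.
Proof.
by apply: prodr_ge0 => i _; rewrite /subst_coord; case: ifP => _;
  [exact: tau_ge0|exact: theta_ge0].
Qed.

Lemma lattice_hat_supp h z x : 0 < h -> psi h z x != 0 ->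
  forall i, 0 < x ord0 i - h * z i < 2 * h.
Proof.
move=> h0 /prodf_neq0 nz i; have := theta_supp (nz i isT).
rewrite -[in X in X -> _](ltr_pM2l h0) -[in X in _ && X -> _](ltr_pM2l h0).
by rewrite mulr0 mulrDr mulrN mulVKf ?gt_eqF// [2 * h]mulrC.
Qed.

Lemma lattice_hat_primitive_supp j h z x : 0 < h -> chi j h z x != 0 ->
  forall i, 0 < x ord0 i - h * z i < 3 * h.
Proof.
move=> h0 /prodf_neq0 nz i; have := nz i isT; rewrite /subst_coord.
have e : x ord0 i - h * z i = h * (h^-1 * x ord0 i + - z i).
  by rewrite mulrDr mulrN mulVKf ?gt_eqF.
rewrite e; have [->|_] := eqVneq i j => [/tau_supp|/theta_supp] /andP[t0 t3];
  by apply/andP; split; [rewrite mulr_gt0|nra].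
Qed.

Lemma lattice_hat_continuous h z : continuous (psi h z).
Proof.
apply: continuous_prod_coord => i.
exact: (smooth1_continuous (smooth1_affine _ _ (theta_smooth 0%N))).
Qed.

Lemma lattice_hat_primitive_smooth j h z k :
  continuously_differentiable k (chi j h z).
Proof.
apply: prod_coord_continuously_differentiable => i; rewrite /subst_coord.
case: ifP => _; apply: smooth1_affine; [exact: tau_smooth|exact: theta_smooth].
Qed.

Lemma partial_lattice_hat_primitive j h z x :
  partial j (chi j h z) x = h^-1 * (psi h z x - psi h (shift_index z j) x).
Proof.
have dj t : is_derive t (1 : R)
   (subst_coord (fun i t => theta (h^-1 * t + - z i)) j (fun t => tau (h^-1 * t + - z j)) j)
   (h^-1 * (theta (h^-1 * t + - z j) - theta (h^-1 * t + - z j - 1))).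
  by rewrite /subst_coord eqxx; apply: is_derive_affine; exact: is_derive_tau.
rewrite /partial; have [_ ->] := is_derive_prod_coord x dj.
rewrite /psi /lattice_hat /prod_coord !(bigD1 (P := xpredT) j)//= /subst_coord eqxx.
have -> : \prod_(i | i != j) theta (h^-1 * x ord0 i + - shift_index z j i) =
          \prod_(i | i != j) theta (h^-1 * x ord0 i + - z i).
  by apply: eq_bigr => i /negbTE ij; rewrite /shift_index ij addr0.
rewrite (eq_bigr (fun i => theta (h^-1 * x ord0 i + - z i))); last first.
  by move=> i /negbTE ->.
rewrite /shift_index eqxx.
rewrite (_ : h^-1 * x ord0 j + - (z j + true%:R) = h^-1 * x ord0 j + - z j - 1).
  ring.
by rewrite opprD addrA.
Qed.

Lemma lattice_hat_shift j h z x : h != 0 ->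
  psi h z (x + h *: delta_mx ord0 j) =
  psi h (fun i => z i - (i == j)%:R) x.
Proof.
move=> h0; apply: eq_bigr => i _; congr (theta _); rewrite !mxE eqxx /=.
by rewrite mulrDr mulKf//; ring.
Qed.

Lemma lattice_hat_translate h z z' x : h != 0 ->
  psi h z (x + \row_i (h * (z i - z' i))) = psi h z' x.
Proof.
move=> h0; apply: eq_bigr => i _; congr (theta _); rewrite !mxE.
by rewrite mulrDr mulKf//; ring.
Qed.

End lattice_kernels.

Section lattice_sums.
Context {R : realType} {n : nat} (S E : R -> R).
Let theta t := S t - S (t - 1).
Let tau t := E t - E (t - 1).
Context (Ssm : forall k, smooth1 k S)
  (Smon : forall s t, s <= t -> S s <= S t)
  (Sl : forall t : R, t <= 0 -> S t = 0) (Sr : forall t : R, 1 <= t -> S t = 1)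
  (Emon : forall s t, s <= t -> E s <= E t)
  (El : forall t : R, t <= 0 -> E t = 0) (Er : forall t : R, 2 <= t -> E t = E 2).
Local Notation Rn := 'rV[R]_n.+1.
Local Notation leb := (lebesgue R n).
Local Notation psi := (@lattice_hat R n S).
Local Notation chi := (@lattice_hat_primitive R n S E).
Local Notation L1 f := (leb.-integrable [set: lebesgue_space R n] (EFin \o f)).
Implicit Types (x y : Rn) (z : 'I_n.+1 -> R) (h : R) (j : 'I_n.+1).

Let S_le1 t : S t <= 1.
Proof.
have [t1|/ltW t1] := leP t 1; last by rewrite Sr.
by rewrite -(Sr (lexx 1)); exact: Smon.
Qed.

Let S_ge0 t : 0 <= S t.
Proof.
have [t0|/ltW t0] := leP 0 t; last by rewrite Sl.
by rewrite -(Sl (lexx 0)); exact: Smon.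
Qed.

Let E_ge0 t : 0 <= E t.
Proof.
have [t0|/ltW t0] := leP 0 t; last by rewrite El.
by rewrite -(El (lexx 0)); exact: Emon.
Qed.

Let E_le t : E t <= E 2.
Proof.
have [t1|/ltW t1] := leP t 2; last by rewrite Er.
exact: Emon.
Qed.

Section indices.
Context (N : nat).
Local Notation index := {ffun 'I_n.+1 -> 'I_N.*2.+1}.

Definition lattice_point (k : index) : 'I_n.+1 -> R :=
  fun i => (k i : nat)%:R - N%:R.

Let sum_translates (F : R -> R) (t : R) :
  \sum_(m < N.*2.+1) (F (t + - (m%:R - N%:R)) - F (t + - (m%:R - N%:R) - 1)) =
  F (t + N%:R) - F (t - N%:R - 1).
Proof.
transitivity (\sum_(0 <= m < N.*2.+1)
    ((- F (t + N%:R - m.+1%:R)) - (- F (t + N%:R - m%:R)))).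
  rewrite big_mkord; apply: eq_bigr => m _.
  rewrite -[m.+1]addn1 natrD opprK [RHS]addrC; congr (F _ - F _); ring.
rewrite telescope_sumr// opprK [LHS]addrC subr0; congr (F _ - F _).
rewrite -addnn -[(_ + _).+1]addn1 !natrD; ring.
Qed.

(** The sum over the lattice of a product is the product of one-variable sums, and each of these
    telescopes to S (t + N) - S (t - N - 1). *)
Lemma sum_lattice_hat_le1 h x : \sum_k psi h (lattice_point k) x <= 1.
Proof.
rewrite /lattice_hat /prod_coord.
rewrite -(bigA_distr_bigA (fun i (m : 'I_N.*2.+1) =>
  theta (h^-1 * x ord0 i + - (m%:R - N%:R)))).
apply: prodr_ile1 => i _; rewrite /theta sum_translates.
apply/andP; split; first by rewrite subr_ge0; apply: Smon; have := ler0n R N; lra.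
by rewrite lerBlDr (le_trans (S_le1 _))// lerDl.
Qed.

Lemma sum_lattice_hat h x : 0 < h ->
  (forall i, `|x ord0 i| <= h * (N%:R - 1)) ->
  \sum_k psi h (lattice_point k) x = 1.
Proof.
move=> h0 xN; rewrite /lattice_hat /prod_coord.
rewrite -(bigA_distr_bigA (fun i (m : 'I_N.*2.+1) =>
  theta (h^-1 * x ord0 i + - (m%:R - N%:R)))).
apply: big1 => i _; rewrite /theta sum_translates.
have : `|h^-1 * x ord0 i| <= N%:R - 1.
  by rewrite normrM gtr0_norm ?invr_gt0// ler_pdivrMl.
by rewrite ler_norml => /andP[? ?]; rewrite Sr ?Sl ?subr0//; lra.
Qed.

(** In direction [j] the telescoping yields a difference of values of [E], in the others a
    difference of values of [S]. This bound on the overlap, uniform in [h] and [N], is the origin of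
    the constant [M] of the final estimate. *)
Lemma sum_lattice_hat_primitive_le j h x :
  \sum_k chi j h (lattice_point k) x <= E 2.
Proof.
rewrite /lattice_hat_primitive /prod_coord.
rewrite (eq_bigr (fun k : index => \prod_i
  ((if i == j then tau else theta) (h^-1 * x ord0 i + - ((k i)%:R - N%:R))))); last first.
  by move=> k _; apply: eq_bigr => i _; rewrite /subst_coord; case: eqVneq => // ->.
rewrite -(bigA_distr_bigA (fun i (m : 'I_N.*2.+1) =>
  (if i == j then tau else theta) (h^-1 * x ord0 i + - (m%:R - N%:R)))).
rewrite (bigD1 j)//= eqxx sum_translates.
rewrite -[leRHS]mulr1 ler_pM//.
- by rewrite subr_ge0; apply: Emon; have := ler0n R N; lra.
- apply: prodr_ge0 => i /negbTE ->; rewrite /theta sum_translates.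
  by rewrite subr_ge0; apply: Smon; have := ler0n R N; lra.
- by rewrite lerBlDr (le_trans (E_le _))// lerDl.
apply: prodr_ile1 => i /negbTE ->; rewrite /theta sum_translates.
apply/andP; split; first by rewrite subr_ge0; apply: Smon; have := ler0n R N; lra.
by rewrite lerBlDr (le_trans (S_le1 _))// lerDl.
Qed.

(** The sum is reindexed by the cyclic successor in the [j]-th coordinate. The wrap-around links the
    faces N and -N of the lattice cube; there [b] vanishes on both sides, because it is evaluated at
    -N - 1 and at N. *)
Lemma lattice_sum_by_parts (A b : ('I_n.+1 -> R) -> R) j :
  (forall z, `|z j| >= N%:R -> b z = 0) ->
  \sum_(k : index) A (lattice_point k) *
    b (fun i => lattice_point k i - (i == j)%:R) =
  \sum_(k : index) A (shift_index (lattice_point k) j) * b (lattice_point k).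
Proof.
move=> b0.
pose s (k : index) : index := [ffun i => if i == j then ordS (k i) else k i].
have s_inj : injective s.
  move=> k l /ffunP kl; apply/ffunP => i; have := kl i; rewrite !ffunE.
  by case: ifP => // _; exact: (can_inj (@ordSK _)).
rewrite (reindex_inj s_inj) /=; apply: eq_bigr => k _.
have [kM|kM] := eqVneq (k j : nat) N.*2.
  rewrite [X in _ = _ * X]b0 ?[X in X * _ = _]mulr0 ?mulr0; last first.
    by rewrite /lattice_point kM -addnn natrD addrK ger0_norm.
  rewrite [X in _ * X]b0 ?mulr0// /lattice_point ffunE eqxx /= kM modnn sub0r.
  by rewrite -opprD normrN ger0_norm ?addr_ge0// lerDl.
have kS i : (s k i : nat) = (k i + (i == j))%N.
  rewrite ffunE; have [->|_] := eqVneq i j; last by rewrite addn0.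
  by rewrite /= modn_small ?addn1// ltnS ltn_neqAle kM -ltnS ltn_ord.
congr (A _ * b _); apply/funext => i; rewrite /shift_index /lattice_point kS natrD.
  by rewrite addrAC.
by rewrite addrAC addrK.
Qed.

End indices.

Lemma lattice_hat_le1 h z x : psi h z x <= 1.
Proof.
apply: prodr_ile1 => i _; apply/andP; split; first exact: theta_ge0.
by rewrite lerBlDr (le_trans (S_le1 _))// lerDl.
Qed.

Lemma tau_le t : tau t <= E 2.
Proof. by rewrite lerBlDr (le_trans (E_le _))// lerDl. Qed.

Lemma lattice_hat_primitive_le1 j h z x : chi j h z x <= E 2.
Proof.
rewrite /lattice_hat_primitive prod_coord_subst -[leRHS]mulr1 ler_pM//.
- by rewrite subr_ge0; apply: Emon; lra.
- by apply: prodr_ge0 => i _; exact: theta_ge0.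
- exact: tau_le.
apply: prodr_ile1 => i _; apply/andP; split; first exact: theta_ge0.
by rewrite lerBlDr (le_trans (S_le1 _))// lerDl.
Qed.

Lemma L1_bounded_support (f : Rn -> R) (M C : R) :
  lmeasurable_fun setT f -> (forall x, `|f x| <= C) ->
  (forall x, f x != 0 -> `|x| <= M) -> L1 f.
Proof.
move=> mf fC fM.
have mB := lmeasurable_norm_le (n := n) M.
have iB := L1Z C (@L1_indic _ _ _ leb _ mB (lebesgue_bounded_lty (fun x xM => xM))).
apply: (L1_le mf _ iB) => x.
have [xM|xM] := pselect (`|x| <= M).
  by rewrite indicE mem_set// mulr1.
rewrite indicE memNset//= mulr0; have [->|/fM//] := eqVneq (f x) 0.
by rewrite normr0.
Qed.

Lemma Rint_shift (f : Rn -> R) (v : Rn) : L1 f ->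
  L1 (fun x => f (x + v)) /\ \int[leb]_x f (x + v) = \int[leb]_x f x.
Proof.
move=> fi; have [iv ev] := lebesgue_integral_shift v fi; split; first exact: iv.
by rewrite /Rintegral; congr fine; exact: ev.
Qed.

Lemma lattice_hat_measurable h z : lmeasurable_fun setT (psi h z).
Proof.
apply: continuous_lmeasurable_fun; first exact: measurableT.
exact: lattice_hat_continuous.
Qed.

Lemma lattice_hat_L1 h z : 0 < h -> L1 (psi h z).
Proof.
move=> h0; apply: (@L1_bounded_support _ (`|\row_i (h * z i)| + 2 * h) 1).
- exact: lattice_hat_measurable.
- by move=> x; rewrite ger0_norm ?lattice_hat_le1 ?lattice_hat_ge0.
move=> x /(lattice_hat_supp Sl Sr h0) xz.
rewrite -[x](subrK (\row_i (h * z i))) addrC (le_trans (ler_normD _ _))//.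
rewrite lerD2l; apply/rV_norm_le => i; rewrite !mxE.
by have /andP[? ?] := xz i; rewrite gtr0_norm// ltW.
Qed.

Lemma Rint_lattice_hat h z z' : 0 < h ->
  \int[leb]_x psi h z x = \int[leb]_x psi h z' x.
Proof.
move=> h0; have := (Rint_shift (\row_i (h * (z i - z' i))) (lattice_hat_L1 z h0)).2.
move=> <-; apply: eq_Rintegral => x _.
by rewrite lattice_hat_translate// gt_eqF.
Qed.

End lattice_sums.

(** * Quasi-interpolation of Lipschitz superpositions *)

Section quasi_interpolation.
Context {R : realType} {n : nat} (S E : R -> R).
Let theta t := S t - S (t - 1).
Context (Ssm : forall k, smooth1 k S) (Esm : forall k, smooth1 k E)
  (dE : forall t : R, is_derive t (1 : R) E (theta t))
  (Smon : forall s t, s <= t -> S s <= S t)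
  (Sl : forall t : R, t <= 0 -> S t = 0) (Sr : forall t : R, 1 <= t -> S t = 1)
  (Emon : forall s t, s <= t -> E s <= E t)
  (El : forall t : R, t <= 0 -> E t = 0) (Er : forall t : R, 2 <= t -> E t = E 2).
Local Notation Rn := 'rV[R]_n.+1.
Local Notation leb := (lebesgue R n).
Local Notation psi := (@lattice_hat R n S).
Local Notation chi := (@lattice_hat_primitive R n S E).
Local Notation L1 f := (leb.-integrable [set: lebesgue_space R n] (EFin \o f)).
Context (I : finType) (a : I -> Rn -> R) (T : (I -> R) -> R) (L : R)
  (h : R) (N : nat).
Context (ai : forall i, L1 (a i)) (L0 : 0 <= L) (h0 : 0 < h)
  (TL : forall (p q : I -> R) (d : R), 0 <= d -> (forall i, `|p i - q i| <= d) ->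
    `|T p - T q| <= L * d).
Local Notation index := {ffun 'I_n.+1 -> 'I_N.*2.+1}.
Local Notation pt := (@lattice_point R n N).

Let c := \int[leb]_x psi h (fun=> 0) x.

Definition local_average (f : Rn -> R) (z : 'I_n.+1 -> R) : R :=
  c^-1 * \int[leb]_x (psi h z x * f x).

(** [T] acts on the averages and not on the functions [a i] themselves: a difference in [x] then
    falls on the averages, which are integrals of [a i] against smooth kernels, and [T] need not be
    differentiated. *)
Definition quasi_interpolant (x : Rn) : R :=
  \sum_(k : index) T (fun i => local_average (a i) (pt k)) * psi h (pt k) x.

Let psi_norm_le1 z x : `|psi h z x| <= 1.
Proof. by rewrite ger0_norm ?lattice_hat_ge0 ?lattice_hat_le1. Qed.

Let L1_psiM z f : L1 f -> L1 (fun x => psi h z x * f x).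
Proof.
by apply: L1_bounded_mul => //; exact: lattice_hat_measurable.
Qed.

Let psi_int z : \int[leb]_x psi h z x = c.
Proof. exact: Rint_lattice_hat. Qed.

Let cV_ge0 : 0 <= c^-1.
Proof.
by rewrite invr_ge0; apply: Rintegral_ge0 => x _; exact: lattice_hat_ge0.
Qed.

Lemma local_average_ge0 f z : (forall x, 0 <= f x) -> 0 <= local_average f z.
Proof.
move=> f0; apply: mulr_ge0 => //; apply: Rintegral_ge0 => x _.
by apply: mulr_ge0 => //; exact: lattice_hat_ge0.
Qed.

Lemma quasi_interpolant_L1 : L1 quasi_interpolant.
Proof. by apply: L1_sum => k; apply: L1Z; exact: lattice_hat_L1. Qed.

Lemma local_average_le f g z : L1 (fun x => psi h z x * f x) ->
  L1 (fun x => psi h z x * g x) ->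
  (forall x, psi h z x != 0 -> f x <= g x) ->
  local_average f z <= local_average g z.
Proof.
move=> fi gi fg; apply: ler_wpM2l => //.
apply: Rint_le => // x.
have [->|p0] := eqVneq (psi h z x) 0; first by rewrite !mul0r.
by rewrite ler_wpM2l ?fg// lattice_hat_ge0.
Qed.

Let L1_psi_cst z (t : R) : L1 (fun y => psi h z y * t).
Proof.
by under eq_fun do rewrite mulrC; apply: L1Z; exact: lattice_hat_L1.
Qed.

Lemma local_average_cst (t : R) z : c != 0 -> local_average (fun=> t) z = t.
Proof.
move=> c0; rewrite /local_average; under eq_Rintegral do rewrite mulrC.
rewrite RintZ; last exact: lattice_hat_L1.
by rewrite psi_int mulrCA mulVf ?mulr1.
Qed.

Lemma local_averageB f g z : L1 f -> L1 g ->
  local_average (fun x => f x - g x) z = local_average f z - local_average g z.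
Proof.
move=> fi gi; rewrite /local_average -mulrBr; congr (_ * _).
rewrite -RintB; [|exact: L1_psiM..].
by apply: eq_Rintegral => x _; rewrite mulrBr.
Qed.

Lemma norm_local_average f z : L1 f ->
  `|local_average f z| <= local_average (fun x => `|f x|) z.
Proof.
move=> fi; rewrite /local_average normrM ger0_norm//; apply: ler_wpM2l => //.
rewrite (le_trans (Rint_norm (L1_psiM _ fi)))// le_eqVlt; apply/orP; left; apply/eqP.
by apply: eq_Rintegral => x _; rewrite normrM ger0_norm ?lattice_hat_ge0.
Qed.

Lemma sum_local_average_le f : c != 0 -> L1 f -> (forall x, 0 <= f x) ->
  \sum_(k : index) c * local_average f (pt k) <= \int[leb]_x f x.
Proof.
move=> c0 fi f0.
rewrite (eq_bigr (fun k : index => \int[leb]_x (psi h (pt k) x * f x))); last first.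
  by move=> k _; rewrite mulrA mulfV// mul1r.
rewrite -Rint_sum; last by move=> k; exact: L1_psiM.
apply: Rint_le => //; first by apply: L1_sum => k; exact: L1_psiM.
by move=> x; rewrite -mulr_suml ler_piMl// sum_lattice_hat_le1.
Qed.

(** On the support of a hat containing [x], the average of [a i] differs from [a i x] by at most the
    average of |a i - s i|, plus the oscillation [e] of [s i], plus |a i - s i| at [x]. Integration
    of this bound uses that the hats sum to 1 on [D] and to at most 1 elsewhere. *)
Lemma quasi_interpolation_error (s : I -> Rn -> R) (e : R) (D : set Rn) :
  c != 0 -> 0 <= e -> (forall i, L1 (s i)) -> (forall i, \int[leb]_x `|a i x - s i x| <= e) ->
  (forall i (x y : Rn), (forall q, `|x ord0 q - y ord0 q| <= 2 * h) ->
    `|s i x - s i y| <= e) ->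
  lmeasurable D -> (leb D < +oo)%E ->
  (forall x : Rn, D x -> forall q, `|x ord0 q| <= h * (N%:R - 1)) ->
  L1 (fun x => T (a ^~ x) * (\1_D x : R)) ->
  \int[leb]_x (`|quasi_interpolant x - T (a ^~ x)| * (\1_D x : R)) <=
  L * (#|I|%:R * (e + e * fine (leb D) + e)).
Proof.
move=> c0 e0 si ase sosc mD Dfin DN Ti.
(* The maximum over [i] is bounded crudely by the sum, whence the factor #|I|; it is harmless
   because [I] stays fixed while [e] tends to 0. *)
pose G i x := \sum_(k : index) local_average (fun x => `|a i x - s i x|) (pt k) *
  psi h (pt k) x + e * \1_D x + `|a i x - s i x|.
have di i : L1 (fun x => `|a i x - s i x|) by apply: L1_norm; exact: L1B.
have iD : L1 (\1_D : Rn -> R) by exact: (@L1_indic _ _ _ leb).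
have iDe i : L1 (fun x => \sum_(k : index) local_average (fun x => `|a i x - s i x|) (pt k) *
  psi h (pt k) x).
  by apply: L1_sum => k; apply: L1Z; exact: lattice_hat_L1.
have iG i : L1 (G i) by apply: L1D => //; apply: L1D => //; exact: L1Z.
have GE i : \int[leb]_x G i x <= e + e * fine (leb D) + e.
  rewrite /G RintD//; last by apply: L1D => //; exact: L1Z.
  rewrite RintD//; last exact: L1Z.
  rewrite RintZ// lerD// lerD//.
    rewrite Rint_sum; last by move=> k; apply: L1Z; exact: lattice_hat_L1.
    apply: le_trans (ase i).
    apply: le_trans (sum_local_average_le c0 (di i) (fun=> normr_ge0 _)).
    apply: ler_sum => k _; rewrite RintZ ?psi_int; last exact: lattice_hat_L1.
    by rewrite mulrC.
  by rewrite /Rintegral integral_indic// setIT.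
have pointwise x : D x ->
    `|quasi_interpolant x - T (a ^~ x)| <= L * \sum_i G i x.
  move=> Dx; have sum1 := sum_lattice_hat Sl Sr h0 (DN x Dx).
  have -> : quasi_interpolant x - T (a ^~ x) = \sum_(k : index)
      (T (fun i => local_average (a i) (pt k)) - T (a ^~ x)) * psi h (pt k) x.
    by under eq_bigr do rewrite mulrBl; rewrite sumrB -mulr_sumr sum1 mulr1.
  pose d i (k : index) := local_average (fun x => `|a i x - s i x|) (pt k) + e + `|a i x - s i x|.
  have dE' i : G i x = \sum_(k : index) d i k * psi h (pt k) x.
    rewrite /d; under eq_bigr do rewrite -addrA mulrDl.
    by rewrite big_split/= -mulr_sumr sum1 mulr1 /G indicE mem_set// mulr1 addrA.
  apply: le_trans (ler_norm_sum _ _ _) _.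
  rewrite (eq_bigr (fun i => \sum_(k : index) d i k * psi h (pt k) x))//.
  rewrite exchange_big /= mulr_sumr; apply: ler_sum => k _.
  rewrite -mulr_suml mulrA normrM [(`|psi _ _ _|)]ger0_norm ?lattice_hat_ge0//.
  have [->|p0] := eqVneq (psi h (pt k) x) 0; first by rewrite !mulr0.
  apply: ler_wpM2r; first exact: lattice_hat_ge0.
  have d0 i : 0 <= d i k.
    by rewrite /d !addr_ge0// local_average_ge0.
  apply: TL => [|i]; first exact: sumr_ge0.
  apply: le_trans (_ : d i k <= _); last first.
    by rewrite (bigD1 i)//= lerDl sumr_ge0.
  have -> : local_average (a i) (pt k) - a i x =
     (local_average (a i) (pt k) - local_average (s i) (pt k)) +
     (local_average (s i) (pt k) - s i x) - (a i x - s i x) by ring.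
  rewrite (le_trans (ler_normB _ _))// lerD2r (le_trans (ler_normD _ _))// lerD//.
    by rewrite -local_averageB// norm_local_average//; exact: L1B.
  have osc y : psi h (pt k) y != 0 -> `|s i x - s i y| <= e.
    move=> py; apply: sosc => q.
    have := lattice_hat_supp Sl Sr h0 p0 q; have := lattice_hat_supp Sl Sr h0 py q.
    by move=> /andP[? ?] /andP[? ?]; rewrite ler_norml; lra.
  rewrite ler_distl -[s i x - e](local_average_cst _ (pt k) c0).
  rewrite -[s i x + e](local_average_cst _ (pt k) c0).
  apply/andP; split; (apply: local_average_le => [||y /osc];
    [try exact: L1_psiM; exact: L1_psi_cst..|]);
    by rewrite ler_norml => /andP[? ?]; lra.
have c_gt0 : 0 < c by rewrite lt_neqAle eq_sym c0 -invr_ge0.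
have iGs : L1 (fun x => L * \sum_i G i x) by apply: L1Z; exact: L1_sum.
apply: (@le_trans _ _ (\int[leb]_x (L * \sum_i G i x))).
  apply: Rint_le => // [|x].
    have Wi : L1 (fun x => quasi_interpolant x * (\1_D x : R)).
      under eq_fun do rewrite mulrC.
      apply: (@L1_bounded_mul _ _ _ _ _ _ 1); last exact: quasi_interpolant_L1.
        exact: measurable_indic.
      by move=> x; rewrite indicE; case: (_ \in _); rewrite ?normr1 ?normr0.
    have := L1_norm (L1B Wi Ti); apply: eq_integrable => // x _ /=; congr EFin.
    by rewrite -mulrBl normrM [(`|\1_D _|)]ger0_norm.
  have [Dx|Dx] := pselect (D x); first by rewrite indicE mem_set// mulr1 pointwise.
  rewrite indicE memNset//= mulr0 mulr_ge0// sumr_ge0// => i _.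
  rewrite /G !addr_ge0//; last by rewrite mulr_ge0.
  apply: sumr_ge0 => k _; rewrite mulr_ge0 ?lattice_hat_ge0//.
  by apply: local_average_ge0.
rewrite RintZ; last exact: L1_sum.
apply: ler_wpM2l => //; rewrite Rint_sum//.
rewrite -sum1_card natr_sum mulr_suml; apply: ler_sum => i _; by rewrite mul1r GE.
Qed.

(* Summation by parts leaves the differences of [T] at neighbouring averages.
   The average over the hat at [z] minus the one over the hat at [z + e_j] is an
   integral against the [j]-th derivative of [chi j h z]: a single test function
   serves all the [a i], and this is why the [a i] need only a common [g]. *)
Lemma quasi_interpolant_difference (g phi : Rn -> R) (j : 'I_n.+1) (e : R) :
  c != 0 -> 0 <= e -> L1 g -> (forall x, 0 <= g x) ->
  L1 phi -> (exists C : R, forall x, `|phi x| <= C) ->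
  (forall x, phi x != 0 -> forall q, `|x ord0 q| <= h * (N%:R - 2)) ->
  (forall x y : Rn, (forall q, `|x ord0 q - y ord0 q| <= 3 * h) ->
    `|phi x - phi y| <= e) ->
  (forall z i, (exists2 x, psi h z x != 0 & phi x != 0) ->
    `|\int[leb]_x (a i x * partial j (chi j h z) x)| <=
    \int[leb]_x (g x * chi j h z x)) ->
  `|\int[leb]_x (quasi_interpolant x * (phi x - phi (x - h *: delta_mx ord0 j)))| <=
  h * (L * (E 2 * \int[leb]_x (g x * (`|phi x| + e)))).
Proof.
move=> c0 e0 gi g0 phii [C phiC] phiN phiosc achi.
have c_gt0 : 0 < c by rewrite lt_neqAle eq_sym c0 -invr_ge0.
have hn0 : h != 0 by rewrite gt_eqF.
pose v : Rn := h *: delta_mx ord0 j.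
have [phivi _] := Rint_shift (- v) phii.
pose B z := T (fun i => local_average (a i) z).
pose b z := \int[leb]_x (psi h z x * phi x).
(* A translation by one lattice step moves from [phi] to the hat, where it becomes a shift of the
   index. *)
have bE z : \int[leb]_x (psi h z x * phi (x - v)) = b (fun i => z i - (i == j)%:R).
  have [_ <-] := Rint_shift v (L1_psiM z phivi).
  by apply: eq_Rintegral => x _; rewrite addrK lattice_hat_shift.
(* A hat occupies the interval from h z_j to h z_j + 2 h in direction [j]; the margin N - 2 keeps
   the support of [phi] away from all hats with |z_j| >= N. *)
have b0 z : `|z j| >= N%:R -> b z = 0.
  move=> zN; rewrite /b (@eq_Rintegral _ _ _ _ _ (fun=> 0)).
    by rewrite /Rintegral integral0.
  move=> x _; apply/eqP; rewrite mulf_eq0; apply/negPn/negP => /norP[p0 f0].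
  have := lattice_hat_supp Sl Sr h0 p0 j; have := phiN x f0 j.
  rewrite ler_norml => /andP[? ?] /andP[? ?].
  move: zN; apply/negP; rewrite -ltNge ltr_norml -(ltr_pM2l h0) -[_ < N%:R](ltr_pM2l h0).
  by apply/andP; split; nra.
have -> : \int[leb]_x (quasi_interpolant x * (phi x - phi (x - v))) =
    \sum_(k : index) (B (pt k) - B (shift_index (pt k) j)) * b (pt k).
  transitivity (\sum_(k : index) B (pt k) *
      (b (pt k) - b (fun i => pt k i - (i == j)%:R))).
    under eq_Rintegral do rewrite mulr_suml.
    rewrite Rint_sum; last first.
      move=> k; under eq_fun do rewrite -mulrA mulrBr.
      by apply: L1Z; apply: L1B; exact: L1_psiM.
    apply: eq_bigr => k _; rewrite -bE -RintB; [|exact: L1_psiM..].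
    rewrite -RintZ; last by apply: L1B; exact: L1_psiM.
    by apply: eq_Rintegral => x _; rewrite -mulrA mulrBr.
  under eq_bigr do rewrite mulrBr; under [RHS]eq_bigr do rewrite mulrBl.
  by rewrite !sumrB (lattice_sum_by_parts B b0).
have chi_bound z x : `|chi j h z x| <= E 2.
  by rewrite ger0_norm ?lattice_hat_primitive_ge0 ?lattice_hat_primitive_le1.
have mchi z : lmeasurable_fun setT (chi j h z).
  apply: continuous_lmeasurable_fun; first exact: measurableT.
  exact: (lattice_hat_primitive_smooth Ssm Esm j h z 0).
have chiL1 z f : L1 f -> L1 (fun x => f x * chi j h z x).
  by move=> fi; under eq_fun do rewrite mulrC; exact: (L1_bounded_mul (mchi z) (chi_bound z)).
have gphi : L1 (fun x => g x * (`|phi x| + e)).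
  have ie : L1 (fun x => `|phi x| * g x + e * g x).
    apply: L1D; last exact: L1Z.
    apply: (@L1_bounded_mul _ _ _ _ _ _ C); last exact: gi.
      by apply: measurableT_comp; [exact: normr_measurable|exact: L1_measurable phii].
    by move=> x; rewrite normr_id.
  by apply: eq_integrable ie => // x _ /=; rewrite mulrDr mulrC [e * _]mulrC.
pose M k := \int[leb]_x (g x * (`|phi x| + e) * chi j h (pt k) x).
have term (k : index) : `|(B (pt k) - B (shift_index (pt k) j)) * b (pt k)| <= h * (L * M k).
  have M0 : 0 <= M k.
    apply: Rintegral_ge0 => x _; rewrite !mulr_ge0 ?addr_ge0//.
    exact: lattice_hat_primitive_ge0.
  (* Terms whose hat misses the support of [phi] vanish, so the estimate on [a i] is required only
     for kernels close to this support. *)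
  have [ex|noex] := pselect (exists2 x, psi h (pt k) x != 0 & phi x != 0); last first.
    suff -> : b (pt k) = 0 by rewrite mulr0 normr0 !mulr_ge0// ltW.
    rewrite /b (@eq_Rintegral _ _ _ _ _ (fun=> 0)); first by rewrite /Rintegral integral0.
    move=> x _; apply/eqP; rewrite mulf_eq0; apply/negPn/negP => /norP[p0 f0].
    by apply: noex; exists x.
  pose G := \int[leb]_x (g x * chi j h (pt k) x).
  have G0 : 0 <= G.
    apply: Rintegral_ge0 => x _; rewrite mulr_ge0//.
    exact: lattice_hat_primitive_ge0.
  have BL : `|B (pt k) - B (shift_index (pt k) j)| <= L * (c^-1 * (h * G)).
    apply: TL => [|i]; first by rewrite !mulr_ge0// ltW.
    rewrite /local_average -mulrBr normrM (ger0_norm cV_ge0) ler_wpM2l//.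
    rewrite -RintB; [|exact: L1_psiM..].
    have -> : \int[leb]_x (psi h (pt k) x * a i x - psi h (shift_index (pt k) j) x * a i x) =
        h * \int[leb]_x (a i x * partial j (chi j h (pt k)) x).
      rewrite -RintZ; last first.
        have := L1Z h^-1 (L1B (L1_psiM (pt k) (ai i)) (L1_psiM (shift_index (pt k) j) (ai i))).
        apply: eq_integrable => // x _ /=; congr EFin.
        by rewrite (partial_lattice_hat_primitive dE) -mulrBl; ring.
      apply: eq_Rintegral => x _; rewrite (partial_lattice_hat_primitive dE).
      by rewrite mulrCA mulVKf// -mulrBl mulrC.
    by rewrite normrM gtr0_norm// ler_pM2l// achi.
  (* For every [x] in the support of [chi], |b| is at most c (|phi x| + e): both kernels live in a
     common cube of side 3 h, over which [phi] oscillates by at most [e]. This brings the weight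
     |phi| under the integral of [g]. *)
  have bP : `|b (pt k)| * G <= c * M k.
    rewrite -RintZ; last exact: chiL1.
    rewrite /M -RintZ; last exact: chiL1.
    apply: Rint_le => [||x]; [by apply: L1Z; exact: chiL1..|].
    have [->|x0] := eqVneq (chi j h (pt k) x) 0; first by rewrite !mulr0.
    rewrite mulrCA [leRHS](_ : _ = g x * (chi j h (pt k) x * (c * (`|phi x| + e))));
      last by ring.
    rewrite ler_wpM2l// [leLHS]mulrC ler_wpM2l ?lattice_hat_primitive_ge0//.
    apply: le_trans (Rint_norm (L1_psiM _ phii)) _.
    rewrite -(psi_int (pt k)) mulrC -RintZ; last exact: lattice_hat_L1.
    apply: Rint_le => [||y].
    - by apply: L1_norm; exact: L1_psiM.
    - by apply: L1Z; exact: lattice_hat_L1.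
    rewrite normrM ger0_norm ?lattice_hat_ge0// mulrC.
    have [->|y0] := eqVneq (psi h (pt k) y) 0; first by rewrite !mulr0.
    rewrite ler_wpM2r ?lattice_hat_ge0//.
    have : `|phi y - phi x| <= e.
      apply: phiosc => q.
      have := lattice_hat_supp Sl Sr h0 y0 q.
      have := lattice_hat_primitive_supp Sl Sr El Er h0 x0 q.
      by move=> /andP[? ?] /andP[? ?]; rewrite ler_norml; lra.
    by move=> H; rewrite -lerBlDl; apply: le_trans H; exact: lerB_dist.
  rewrite normrM; apply: (@le_trans _ _ (L * (c^-1 * (h * G)) * `|b (pt k)|)).
    exact: ler_wpM2r.
  rewrite (_ : L * _ * _ = h * (L * (c^-1 * (`|b (pt k)| * G)))); last by ring.
  rewrite ler_pM2l// ler_wpM2l//.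
  by rewrite ler_pdivrMl.
apply: le_trans (ler_norm_sum _ _ _) _; apply: le_trans (ler_sum _ (fun k _ => term k)) _.
rewrite -!mulr_sumr ler_pM2l// ler_wpM2l//.
rewrite -Rint_sum; last by move=> k; exact: chiL1.
rewrite -RintZ//; apply: Rint_le => [||x]; [by apply: L1_sum => k; exact: chiL1|exact: L1Z|].
rewrite -mulr_sumr [leRHS]mulrC ler_wpM2l ?mulr_ge0 ?addr_ge0//.
exact: sum_lattice_hat_primitive_le.
Qed.

End quasi_interpolation.

(** * Continuous functions with compact support *)

Section compactly_supported_functions.
Context {R : realType} {n : nat}.
Local Notation Rn := 'rV[R]_n.+1.
Implicit Types (f : Rn -> R) (x y : Rn).

Lemma norm_le_compact (M : R) : compact [set x : Rn | `|x| <= M].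
Proof.
apply: bounded_closed_compact.
  exists M; split; first exact: num_real.
  by move=> r Mr x /= xM; rewrite (le_trans xM)// ltW.
exact: norm_le_closed.
Qed.

Lemma compact_norm_le (K : set Rn) : compact K -> exists B : R, forall x, K x -> `|x| <= B.
Proof.
move=> /compact_bounded[M [_ MP]]; exists (`|M| + 1) => x Kx.
by apply: (MP (`|M| + 1)) => //; rewrite (le_lt_trans (ler_norm _))// ltrDl.
Qed.

Lemma continuous_bounded f (M : R) : continuous f ->
  (forall x, f x != 0 -> `|x| <= M) ->
  exists2 C : R, 0 <= C & forall x, `|f x| <= C.
Proof.
move=> cf fM.
have : compact (f @` [set x : Rn | `|x| <= M]).
  apply: continuous_compact; last exact: norm_le_compact.
  exact: continuous_subspaceT.
move=> /compact_bounded[C [_ /(_ (`|C| + 1))]].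
have C1 : C < `|C| + 1 by rewrite (le_lt_trans (ler_norm C))// ltrDl.
move=> /(_ C1) h; exists (`|C| + 1); first by rewrite addr_ge0.
move=> x; have [->|/fM xM] := eqVneq (f x) 0; first by rewrite normr0 addr_ge0.
by apply: h; exists x.
Qed.

Lemma continuous_uniform f (M : R) (e : R) : continuous f ->
  (forall x, f x != 0 -> `|x| <= M) -> 0 < e ->
  exists2 d : R, 0 < d & forall x y, `|x - y| < d -> `|f x - f y| <= e.
Proof.
move=> cf fM e0.
(* The radius M + 1 goes with a modulus below 1: if |x| > M + 1, then every point at distance less
   than 1 from [x] also lies outside the support. *)
have /compact_near_coveringP cov := @norm_le_compact (M + 1).
have : \forall d \near (0 : R)^'+, [set x : Rn | `|x| <= M + 1] `<=`
    [set x | forall y, `|x - y| < d -> `|f x - f y| <= e].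
  apply: (cov _ _ (fun d x => forall y, `|x - y| < d -> `|f x - f y| <= e)).
  move=> x _; have e2 : 0 < e / 2 by rewrite divr_gt0.
  have /(@cvgrPdist_lt _ R^o _ (nbhs x) _ f)/(_ _ e2)/nbhs_ballP[d /= d0 dx] := cf x.
  have d2 : 0 < d / 2 by rewrite divr_gt0.
  exists (ball x (d / 2), [set t | t < d / 2]) => /=.
    by split; [exact: nbhsx_ballx|exact: nbhs_right_lt].
  move=> [x' t] /= [xx' td] y x'y.
  have hx' : `|f x - f x'| < e / 2.
    by apply: dx; apply: le_ball xx'; lra.
  have hy : `|f x - f y| < e / 2.
    apply: dx; rewrite -ball_normE /= in xx' *.
    have := ler_normD (x - x') (x' - y); rewrite addrA subrK => /le_lt_trans; apply.
    by rewrite [d]splitr ltrD// (lt_trans x'y).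
  have := ler_normD (f x' - f x) (f x - f y); rewrite addrA subrK => /le_trans; apply.
  by rewrite distrC [e]splitr ltW// ltrD.
move=> /(@filterI _ _ _ _ _ (nbhs_right_gt 0))/(@filterI _ _ _ _ _ (nbhs_right_lt ltr01)).
move=> /filter_ex[d /= [d1 [d0 hd]]]; exists d => // x y xy.
have [xM|xM] := leP `|x| (M + 1); first exact: hd.
have [fx0|/fM xM'] := eqVneq (f x) 0; last by lra.
have [->|/fM yM] := eqVneq (f y) 0; first by rewrite fx0 subrr normr0 ltW.
have := lerB_dist x y; lra.
Qed.

Lemma mean_value_line f (v x : Rn) (h : R) : 0 <= h ->
  (forall y, derivable f y v) ->
  exists2 t, 0 <= t <= h & f (x + h *: v) - f x = 'D_v f (x + t *: v) * h.
Proof.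
move=> h0 df; pose g t := f (x + t *: v).
have dg t : is_derive t (1 : R) g ('D_v f (x + t *: v)).
  have e : (fun s : R => s^-1 *: ((g \o shift t) (s *: 1) - g t)) =
      (fun s : R => s^-1 *: ((f \o shift (x + t *: v)) (s *: v) - f (x + t *: v))).
    apply/funext => s /=; rewrite /g; congr (_ *: (f _ - _)).
    by rewrite [s%:A]mulr1 scalerDl addrCA addrA.
  by apply: DeriveDef; rewrite /derivable /derive e//; exact: df.
have [t] := MVT_segment h0 (fun s _ => dg s)
  (continuous_subspaceT (is_derive1_continuous dg)).
rewrite in_itv/= subr0 /g scale0r addr0 => th ->.
by exists t.
Qed.

Lemma derive_closed_support f (K : set Rn) (v x : Rn) : closed K ->
  (forall x, f x != 0 -> K x) -> 'D_v f x != 0 -> K x.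
Proof.
move=> cK fK; apply: contraNP => nKx.
rewrite (@near_eq_derive _ _ _ f (cst 0)) ?derive_cst//.
have : open (~` K) by exact: closed_openC.
move=> /(_ x nKx); apply: filterS => y nKy.
by apply/eqP; apply: contra_notT nKy => /fK.
Qed.

End compactly_supported_functions.

(** * Integral bound for superpositions of finitely many scalar functions *)

Section lipschitz_superposition.
Context {R : realType} {n : nat}.
Local Notation Rn := 'rV[R]_n.+1.
Local Notation leb := (lebesgue R n).
Local Notation L1 f := (leb.-integrable [set: lebesgue_space R n] (EFin \o f)).

(** The superposition is replaced by its quasi-interpolant and the derivative of [phi] by a backward
    difference quotient whose step is the mesh of the lattice, so that the summation by parts is
    exact. Kernels meeting the support of [phi] spill over by a few meshes; this is the room granted
    by [r] and [K]. *)
Lemma lipschitz_superposition_bound : exists2 M : R, 0 <= M &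
  forall (I : finType) (a : I -> Rn -> R) (T : (I -> R) -> R) (L : R)
    (g phi : Rn -> R) (j : 'I_n.+1) (K : set Rn) (r B : R),
  (forall i, L1 (a i)) -> 0 <= L ->
  (forall (p q : I -> R) (d : R), 0 <= d -> (forall i, `|p i - q i| <= d) ->
    `|T p - T q| <= L * d) ->
  lmeasurable_fun setT (fun x => T (a ^~ x)) ->
  L1 g -> (forall x, 0 <= g x) ->
  continuously_differentiable 1 phi ->
  (forall x, phi x != 0 -> `|x| <= B) ->
  0 < r -> (forall x y, phi x != 0 -> `|x - y| <= r -> K y) ->
  (forall i (chi : Rn -> R), (forall k, continuously_differentiable k chi) ->
     (forall x, chi x != 0 -> K x) ->
     `|\int[leb]_x (a i x * partial j chi x)| <= \int[leb]_x (g x * `|chi x|)) ->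
  `|\int[leb]_x (T (a ^~ x) * partial j phi x)| <=
  M * (L * \int[leb]_x (g x * `|phi x|)).
Proof.
have [S [E [Ssm Esm dE [Smon [Sl Sr] Emon El Er]]]] := @smooth_partition_profile R.
have E0 : 0 <= E 2 by rewrite -(El 0 (lexx 0)); apply: Emon.
exists (E 2) => // I a T L g phi j K r B ai L0 TL mT gi g0 phi1 phiB r0 phiK achi.
have [cphi dphi_] := phi1; have [dphi cP] := dphi_ j.
set P := partial j phi in cP *.
have PB x : P x != 0 -> `|x| <= `|B|.
  apply: (derive_closed_support (K := [set x | `|x| <= `|B|])) => [|y].
    exact: norm_le_closed.
  by move=> /phiB yB; exact: le_trans (ler_norm _).
pose Bn := `|B| + 1.
have phiBn x : phi x != 0 -> `|x| <= `|B| by move=> /phiB /le_trans; apply; exact: ler_norm.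
have [Cphi Cphi0 phiC] := continuous_bounded cphi phiBn.
have [C C0 PC] := continuous_bounded cP PB.
pose D := [set x : Rn | `|x| <= Bn].
have mD : lmeasurable D by apply: compact_lmeasurable; exact: norm_le_compact.
have Dfin : (leb D < +oo)%E by exact: (lebesgue_bounded_lty (M := Bn)).
have iD : L1 (\1_D : Rn -> R) by exact: (@L1_indic _ _ _ leb).
have mc f : continuous f -> lmeasurable_fun setT (f : Rn -> R).
  by move=> cf; apply: continuous_lmeasurable_fun => //; exact: measurableT.
have phii : L1 phi by exact: (L1_bounded_support (mc _ cphi) phiC phiBn).
have Ti : L1 (fun x => T (a ^~ x) * (\1_D x : R)).
  apply: (@L1_le _ _ _ leb _ (fun x : Rn => `|T (fun=> 0)| * (\1_D x : R) + L * \sum_i `|a i x|)).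
  - by apply: measurable_funM => //; exact: measurable_indic.
  - move=> x; rewrite normrM [(`|\1_D _|)]ger0_norm//.
    have : `|T (a ^~ x)| <= `|T (fun=> 0)| + L * \sum_i `|a i x|.
      have : `|T (a ^~ x) - T (fun=> 0)| <= L * \sum_i `|a i x|.
        apply: TL => [|i]; first exact: sumr_ge0.
        by rewrite subr0 (bigD1 i)//= lerDl sumr_ge0.
      by move=> h; rewrite -lerBlDl; apply: le_trans h; exact: lerB_dist.
    have S0 : 0 <= L * \sum_i `|a i x| by rewrite mulr_ge0// sumr_ge0.
    rewrite indicE; case: (_ \in _); rewrite /= ?mulr1 ?mulr0 ?add0r//.
  - by apply: L1D; [exact: L1Z|apply: L1Z; apply: L1_sum => i; exact: L1_norm].
have absTi : L1 (fun x => `|T (a ^~ x)| * (\1_D x : R)).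
  have := L1_norm Ti; apply: eq_integrable => // x _ /=.
  by rewrite normrM [(`|\1_D _|)]ger0_norm.
have gphi0 : 0 <= \int[leb]_x (g x * `|phi x|).
  by apply: Rintegral_ge0 => x _; rewrite mulr_ge0.
have TPD (Q : Rn -> R) : (forall x, Q x != 0 -> `|x| <= Bn) ->
    forall x, T (a ^~ x) * Q x = Q x * (T (a ^~ x) * (\1_D x : R)).
  move=> QB x; have [->|Qx] := eqVneq (Q x) 0; first by rewrite mulr0 mul0r.
  by rewrite indicE mem_set ?mulr1 1?mulrC//; exact: QB.
have PBn x : P x != 0 -> `|x| <= Bn by move=> /PB; rewrite /Bn; lra.
pose m := fine (leb D).
have m0 : 0 <= m by exact: fine_ge0.
pose It := \int[leb]_x (`|T (a ^~ x)| * (\1_D x : R)).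
have It0 : 0 <= It by apply: Rintegral_ge0 => x _; rewrite mulr_ge0.
pose Ig := \int[leb]_x g x.
have Ig0 : 0 <= Ig by exact: Rintegral_ge0.
(* The coefficients of [e] in the three error estimates [t1], [t2] and [t3] below. *)
pose Q := It + C * (L * (#|I|%:R * (2 + m))) + E 2 * (L * Ig).
have Q0 : 0 <= Q by rewrite !addr_ge0// !mulr_ge0// addr_ge0.
apply/ler_addgt0Pr => e0 e0_gt0.
pose e := e0 / (Q + 1).
have Q1 : 0 < Q + 1 by lra.
have e_gt0 : 0 < e by rewrite divr_gt0.
suff : `|\int[leb]_x (T (a ^~ x) * P x)| <=
    E 2 * (L * \int[leb]_x (g x * `|phi x|)) + Q * e.
  move=> /le_trans; apply; rewrite lerD2l /e mulrA ler_pdivrMr// mulrC.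
  by rewrite ler_wpM2l ?(ltW e0_gt0)// lerDl.
have /choice[s sP] (i : I) : exists s : Rn -> R,
   [/\ lipschitz_on_space s, L1 s & \int[leb]_x `|a i x - s x| <= e].
  exact: (lipschitz_approx_L1 (ai i)).2.
have /choice[l lP] (i : I) : exists l : R, 0 <= l /\ forall x y, `|s i x - s i y| <= l * `|x - y|.
  by have [[l l0 sl] _ _] := sP i; exists l.
pose lt := \sum_i l i.
have l_le i : l i <= lt by rewrite /lt (bigD1 i)//= lerDl sumr_ge0// => k _; have [] := lP k.
have lt0 : 0 <= lt by apply: sumr_ge0 => i _; have [] := lP i.
have [d1 d10 phiu] := continuous_uniform cphi phiBn e_gt0.
have [d2 d20 Pu] := continuous_uniform cP PB e_gt0.
have [h [h0 h1 hd1 hd2 [hr hl]]] : exists h : R,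
    [/\ 0 < h, h <= 1, 3 * h < d1, h < d2 & 6 * h <= r /\ lt * (2 * h) <= e].
  have lt1 : 0 < lt + 1 by lra.
  (* The entries ensure, in turn: the support of the difference quotient stays in [D]; [phi]
     oscillates by at most [e] over a kernel; its derivative does so over one step; kernels meeting
     the support of [phi] stay in [K]; every [s i] oscillates by at most [e] over a hat. *)
  pose h := Num.min 1 (Num.min (d1 / 4) (Num.min (d2 / 2) (Num.min (r / 6) (e / (2 * (lt + 1)))))).
  have q0 : 0 < 2 * (lt + 1) by lra.
  have h0 : 0 < h by rewrite !lt_min ltr01 !divr_gt0.
  exists h.
  have : h <= h by []; rewrite {2}/h !le_min => /andP[h1 /andP[h2 /andP[h3 /andP[h4]]]].
  rewrite ler_pdivlMr ?mulr_gt0// => h5.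
  by clear -h0 h1 h2 h3 h4 h5; split => //; [lra|lra|split; [lra|nra]].
have [N hN] : exists N : nat, Bn / h + 2 <= N%:R.
  have := nbhs_infty_ger (Bn / h + 2) => /filter_ex[N NB]; by exists N.
have {}hN : Bn <= h * (N%:R - 2) by rewrite -ler_pdivrMl// mulrC; clear -hN; lra.
pose v : Rn := h *: delta_mx ord0 j.
have v1 : `|v| <= h.
  apply/rV_norm_le => i; rewrite !mxE eqxx /=.
  by case: (_ == _); rewrite /= ?mulr1 ?mulr0 ?normr0 ?(gtr0_norm h0)// ltW.
(* By the mean value theorem this is the derivative of [phi] at a point within distance [h]; its
   bound and its support are inherited from there. *)
pose Dh x := h^-1 * (phi x - phi (x - v)).
have DhP x : exists2 y, `|y - x| <= h & Dh x = P y.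
  have [t /andP[t0 th] e1] := mean_value_line (x - v) (ltW h0) dphi.
  exists (x - v + t *: delta_mx ord0 j).
    rewrite (_ : _ - x = (t - h) *: delta_mx ord0 j); last first.
      by rewrite /v scalerBl [LHS]addrC !addrA addNr add0r addrC.
    apply/rV_norm_le => i; rewrite !mxE eqxx /=.
    case: (_ == _); rewrite /= ?mulr1 ?mulr0 ?normr0 ?(ltW h0)//.
    by rewrite ler_norml; clear -t0 th; apply/andP; split; lra.
  by rewrite /Dh -[in phi x](subrK v x) /v e1 mulrC mulfK// gt_eqF.
have DhC x : `|Dh x| <= C by have [y _ ->] := DhP x.
have DhB x : Dh x != 0 -> `|x| <= Bn.
  have [y yx ->] := DhP x => /PB yB.
  have := lerB_dist x y; rewrite distrC /Bn; clear -h1 yx yB; lra.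
have mP := mc _ cP.
have mDh : lmeasurable_fun setT Dh.
  exact: L1_measurable (L1Z h^-1 (L1B phii (Rint_shift (- v) phii).1)).
have TPi : L1 (fun x => T (a ^~ x) * P x).
  under eq_fun do rewrite (TPD P PBn).
  exact: (L1_bounded_mul mP PC Ti).
have TDhi : L1 (fun x => T (a ^~ x) * Dh x).
  under eq_fun do rewrite (TPD Dh DhB).
  exact: (L1_bounded_mul mDh DhC Ti).
pose c := \int[leb]_x lattice_hat S h (fun=> 0) x.
have DN x : D x -> forall q, `|x ord0 q| <= h * (N%:R - 2).
  by move=> /= xB q; apply: le_trans hN; move: q; apply/rV_norm_le.
have DN1 x : D x -> forall q, `|x ord0 q| <= h * (N%:R - 1).
  by move=> Dx q; apply: le_trans (DN x Dx q) _; clear -h0; nra.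
(* If the hats had integral 0, so would their sum, which is 1 on [D]. Then [D] would be null, and
   the integral on the left, carried by [D], would vanish. *)
have [c0|c0] := eqVneq c 0.
  suff : `|\int[leb]_x (T (a ^~ x) * P x)| <= 0.
    move=> /le_trans; apply; apply: addr_ge0; first by rewrite !mulr_ge0.
    by rewrite mulr_ge0// ltW.
  have D0 : m <= 0.
    have -> : m = \int[leb]_x (\1_D x : R).
      by rewrite /Rintegral integral_indic// setIT.
    have <- : \int[leb]_x (\sum_(k : {ffun 'I_n.+1 -> 'I_N.*2.+1})
        lattice_hat S h (lattice_point k) x) = 0.
      rewrite Rint_sum; last by move=> k; exact: lattice_hat_L1.
      by apply: big1 => k _; rewrite -c0; exact: Rint_lattice_hat.
    apply: Rint_le => // [|x]; first by apply: L1_sum => k; exact: lattice_hat_L1.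
    have [Dx|Dx] := pselect (D x).
      by rewrite indicE mem_set// (sum_lattice_hat Sl Sr h0 (DN1 x Dx)).
    rewrite indicE memNset//=; apply: sumr_ge0 => k _; exact: lattice_hat_ge0.
  have LD : leb D = 0%E.
    have Dfn : leb D \is a fin_num by rewrite ge0_fin_numE.
    by apply/eqP; rewrite eq_le measure_ge0 andbT -(fineK Dfn) lee_fin.
  apply: le_trans (Rint_norm TPi) _.
  have i0 : L1 (fun=> 0 : R) by exact: integrable0.
  have -> : 0 = \int[leb]_x (0 : R) by rewrite /Rintegral integral0.
  apply: Rint_le_ae => //; first exact: L1_norm.
  exists D; split => // x /= /negP; rewrite -ltNge normr_gt0 mulf_eq0 negb_or.
  by move=> /andP[_ /PBn].
have Wi : L1 (quasi_interpolant S a T h N) by exact: quasi_interpolant_L1.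
pose W := quasi_interpolant S a T h N.
have WDhi : L1 (fun x => W x * Dh x).
  by under eq_fun do rewrite mulrC; exact: (L1_bounded_mul mDh DhC Wi).
have err := @quasi_interpolation_error R n S Ssm Smon Sl Sr I a T L h N ai L0 h0 TL s e D
  c0 (ltW e_gt0) (fun i => let: And3 _ si _ := sP i in si)
  (fun i => let: And3 _ _ se := sP i in se) _ mD Dfin DN1 Ti.
have {}err : \int[leb]_x (`|W x - T (a ^~ x)| * (\1_D x : R)) <=
    L * (#|I|%:R * (e + e * m + e)).
  apply: err => i x y xy; have [l0 sl] := lP i; apply: le_trans (sl x y) _.
  have xy2 : `|x - y| <= 2 * h by apply/rV_norm_le => q; rewrite !mxE.
  by apply: le_trans hl; apply: ler_pM.
have dif : `|\int[leb]_x (W x * (phi x - phi (x - v)))| <=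
    h * (L * (E 2 * \int[leb]_x (g x * (`|phi x| + e)))).
  apply: (@quasi_interpolant_difference R n S E Ssm Esm dE Smon Sl Sr Emon El Er) => //.
  - exact: ltW.
  - by exists Cphi.
  - move=> x /phiBn xB; apply: DN; rewrite /D /= /Bn.
    by rewrite (le_trans xB)// lerDl.
  - move=> x y xy; apply: phiu; apply: le_lt_trans hd1.
    by apply/rV_norm_le => q; rewrite !mxE.
  move=> z i [x px phix].
  rewrite (_ : \int[leb]_x (g x * _) = \int[leb]_x (g x *
    `|lattice_hat_primitive S E j h z x|)); last first.
    by apply: eq_Rintegral => y _; rewrite ger0_norm ?lattice_hat_primitive_ge0.
  apply: achi => [k|y cy]; first exact: lattice_hat_primitive_smooth.
  apply: (phiK x) => //; apply: le_trans hr; apply/rV_norm_le => q; rewrite !mxE.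
  have := lattice_hat_supp Sl Sr h0 px q.
  have := lattice_hat_primitive_supp Sl Sr El Er h0 cy q.
  move=> /andP[u1 u2] /andP[u3 u4]; rewrite ler_norml.
  by clear -u1 u2 u3 u4; apply/andP; split; lra.
(* Three contributions: derivative against difference quotient, superposition against interpolant,
   and the term treated by summation by parts. *)
have -> : \int[leb]_x (T (a ^~ x) * P x) =
    \int[leb]_x (T (a ^~ x) * P x - T (a ^~ x) * Dh x) -
    \int[leb]_x (W x * Dh x - T (a ^~ x) * Dh x) + \int[leb]_x (W x * Dh x).
  by rewrite !RintB//; ring.
have t1 : `|\int[leb]_x (T (a ^~ x) * P x - T (a ^~ x) * Dh x)| <= e * It.
  apply: le_trans (Rint_norm (L1B TPi TDhi)) _.
  rewrite /It -RintZ//; apply: Rint_le; [by apply: L1_norm; exact: L1B|exact: L1Z|].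
  move=> x; rewrite -mulrBr.
  have [Dx|Dx] := pselect (D x).
    rewrite indicE mem_set// mulr1 normrM mulrC ler_wpM2r//.
    have [y yx ->] := DhP x; apply: Pu.
    by rewrite distrC; exact: le_lt_trans hd2.
  rewrite indicE memNset//= mulr0 mulr0.
  have -> : P x = 0 by apply/eqP/negPn/negP => /PBn.
  have -> : Dh x = 0 by apply/eqP/negPn/negP => /DhB.
  by rewrite subrr mulr0 normr0.
have t2 : `|\int[leb]_x (W x * Dh x - T (a ^~ x) * Dh x)| <=
    C * (L * (#|I|%:R * (e + e * m + e))).
  apply: le_trans (Rint_norm (L1B WDhi TDhi)) _.
  apply: le_trans (ler_wpM2l C0 err).
  have WTD : L1 (fun x => `|W x - T (a ^~ x)| * (\1_D x : R)).
    have WD : L1 (fun x => W x * (\1_D x : R)).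
      under eq_fun do rewrite mulrC.
      apply: (@L1_bounded_mul _ _ _ _ _ _ 1); last exact: Wi.
        exact: measurable_indic.
      by move=> x; rewrite indicE; case: (_ \in _); rewrite ?normr1 ?normr0.
    have := L1_norm (L1B WD Ti); apply: eq_integrable => // x _ /=; congr EFin.
    by rewrite -mulrBl normrM [(`|\1_D _|)]ger0_norm.
  rewrite -RintZ//; apply: Rint_le; [by apply: L1_norm; exact: L1B|exact: L1Z|].
  move=> x; rewrite -mulrBl normrM.
  have [Dx|Dx] := pselect (D x).
    by rewrite indicE mem_set// mulr1 mulrC ler_wpM2r.
  have -> : Dh x = 0 by apply/eqP/negPn/negP => /DhB.
  by rewrite normr0 mulr0 !mulr_ge0.
have t3 : `|\int[leb]_x (W x * Dh x)| <=
    E 2 * (L * \int[leb]_x (g x * `|phi x|)) + E 2 * (L * (e * Ig)).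
  have -> : \int[leb]_x (W x * Dh x) = h^-1 * \int[leb]_x (W x * (phi x - phi (x - v))).
    rewrite -RintZ.
      by apply: eq_Rintegral => x _; rewrite /Dh mulrCA.
    have := L1Z h WDhi; apply: eq_integrable => // x _ /=; congr EFin.
    by rewrite /Dh mulrCA [h * _]mulrA mulfV ?mul1r// gt_eqF.
  rewrite normrM gtr0_norm ?invr_gt0// ler_pdivrMl//; apply: le_trans dif _.
  rewrite ler_pM2l//.
  have g1 : L1 (fun x => g x * `|phi x|).
    under eq_fun do rewrite mulrC.
    apply: (@L1_bounded_mul _ _ _ _ _ _ Cphi); last exact: gi.
      by apply: measurableT_comp; [exact: normr_measurable|exact: L1_measurable phii].
    by move=> x; rewrite normr_id.
  have -> : \int[leb]_x (g x * (`|phi x| + e)) =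
      \int[leb]_x (g x * `|phi x|) + e * Ig.
    rewrite -RintZ// -RintD//; last exact: L1Z.
    by apply: eq_Rintegral => x _; rewrite mulrDr [e * _]mulrC.
  by rewrite le_eqVlt; apply/orP; left; apply/eqP; ring.
apply: le_trans (ler_normD _ _) _; apply: le_trans (lerD (ler_normB _ _) t3) _.
apply: le_trans (lerD (lerD t1 t2) (lexx _)) _.
by rewrite le_eqVlt; apply/orP; left; apply/eqP; rewrite /Q; ring.
Qed.

End lipschitz_superposition.

(** * Functionals dominated by a weighted L^1 seminorm *)

Section dominated_functionals.
Context d (T : measurableType d) (R : realType)
  (mu : {sigma_finite_measure set T -> \bar R}).
Local Notation L1 f := (mu.-integrable [set: T] (EFin \o f)).
Local Notation fctType := (T -> R^o).
Implicit Types (psi xi : T -> R) (A : set T).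

Context (g rho : T -> R) (mg : measurable_fun setT g)
  (mrho : measurable_fun setT rho)
  (mrhoV : measurable_fun setT (fun x => (rho x)^-1)) (g0 : forall x, 0 <= g x)
  (rho0 : forall x, 0 < rho x) (grho : L1 (fun x => g x * rho x)).

Let W : set fctType :=
  [set psi | measurable_fun setT (psi : T -> R) /\ L1 (fun x => g x * psi x)].

Let p (psi : fctType) : R := \int[mu]_x (g x * `|psi x|).

Let W_abs psi : W psi -> L1 (fun x => g x * `|psi x|).
Proof.
move=> [_ gi]; have := L1_norm gi; apply: eq_integrable => // x _ /=.
by rewrite normrM ger0_norm.
Qed.

Let W_sub : subspace_set W.
Proof.
split.
  split; first exact: measurable_cst.
  by under eq_fun do rewrite mulr0; exact: integrable0.
move=> t f h [mf fi] [mh hi]; split.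
  by apply: measurable_funD => //; exact: measurable_funM.
have := L1D (L1Z t fi) hi; apply: eq_integrable => // x _ /=; congr EFin.
by rewrite mulrDr mulrCA.
Qed.

Let p_sublinear : sublinear_on W p.
Proof.
split.
  move=> f h Wf Wh; rewrite /p -RintD; [|exact: W_abs..].
  apply: Rint_le => [||x].
  - by have := W_sub.2 1 _ _ Wf Wh; rewrite scale1r => /W_abs.
  - by apply: L1D; exact: W_abs.
  - by rewrite -mulrDr ler_wpM2l// ler_normD.
move=> t f t0 Wf; rewrite /p -RintZ; last exact: W_abs.
by apply: eq_Rintegral => x _; rewrite /= normrM gtr0_norm// mulrCA.
Qed.

Lemma Rint_eq_ae psi xi : L1 psi -> L1 xi -> (\forall x \ae mu, psi x = xi x) ->
  \int[mu]_x psi x = \int[mu]_x xi x.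
Proof.
move=> pi xii e; apply/eqP; rewrite eq_le.
by apply/andP; split; apply: Rint_le_ae => //; apply: filterS e => x ->.
Qed.

Import HBNNSimple.

Section extended.
Context (F : fctType -> R) (Flin : linear_on W F)
  (Fp : forall psi, W psi -> F psi <= p psi).

Let W0 : W 0. Proof. exact: W_sub.1. Qed.

Let F0 : F 0 = 0.
Proof.
have := Flin 1 W0 W0; rewrite scale1r mul1r addr0 => e.
by apply: (addrI (F 0)); rewrite addr0 -e.
Qed.

Let WZ t psi : W psi -> W (t *: (psi : fctType)).
Proof. by move=> Wf; rewrite -[_ *: _]addr0; exact: W_sub.2. Qed.

Let FZ t psi : W psi -> F (t *: (psi : fctType)) = t * F psi.
Proof. by move=> Wf; rewrite -[_ *: _]addr0 Flin// F0 addr0. Qed.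

Let WD psi xi : W psi -> W xi -> W ((psi : fctType) + xi).
Proof. by move=> Wf Wh; rewrite -[psi : fctType]scale1r; exact: W_sub.2. Qed.

Let FD psi xi : W psi -> W xi -> F ((psi : fctType) + xi) = F psi + F xi.
Proof. by move=> Wf Wh; rewrite -[psi : fctType]scale1r Flin// mul1r scale1r. Qed.

Let FB psi xi : W psi -> W xi -> F (fun x => psi x - xi x) = F psi - F xi.
Proof.
move=> Wf Wh; rewrite -[RHS]addrC -mulN1r -Flin//; congr F.
by apply/funext => x; rewrite addrC -[in LHS]mulN1r.
Qed.

Let WB psi xi : W psi -> W xi -> W (fun x => psi x - xi x).
Proof.
move=> Wf Wh; rewrite (_ : (fun x => _) = -1 *: (xi : fctType) + (psi : fctType)).
  exact: W_sub.2.
by apply/funext => x; rewrite addrC -[in LHS]mulN1r.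
Qed.

Let F_norm psi : W psi -> `|F psi| <= p psi.
Proof.
move=> Wf; rewrite ler_norml Fp// andbT lerNl -mulN1r -FZ//.
apply: le_trans (Fp (WZ (-1) Wf)) _; rewrite le_eqVlt; apply/orP; left; apply/eqP.
by apply: eq_Rintegral => x _; rewrite /= normrM normrN1 mul1r.
Qed.

(** Since |F| is bounded by the weighted seminorm, dominated convergence in the weighted space
    carries over to [F]. *)
Let F_continuous (psi_ : nat -> T -> R) psi xi :
  (forall k, measurable_fun setT (psi_ k)) -> W psi -> W xi ->
  (forall x, psi_ ^~ x @ \oo --> psi x) ->
  (forall k x, `|psi_ k x| <= xi x) ->
  F (psi_ k) @[k --> \oo] --> F psi.
Proof.
move=> mk Wpsi Wxi cvgk dom.
have Wk k : W (psi_ k).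
  split => //; apply: (@L1_le _ _ _ mu _ (fun x => g x * xi x)); last by case: Wxi.
    exact: measurable_funM.
  by move=> x; rewrite normrM ger0_norm// ler_wpM2l.
have domp x : `|psi x| <= xi x.
  have c : `|psi_ k x| @[k --> \oo] --> `|psi x| by exact: cvg_norm.
  rewrite -(cvg_lim _ c)//; apply: limr_le; first by apply/cvg_ex; eexists; exact: c.
  by apply: nearW => k.
have [|||||_] := @Rint_dct _ _ _ mu (fun k x => g x * `|psi_ k x - psi x|) (fun=> 0)
    (fun x => 2 * (g x * xi x)).
- move=> k; apply: measurable_funM => //; apply: measurableT_comp.
    exact: normr_measurable.
  by apply: measurable_funB => //; case: Wpsi.
- exact: measurable_cst.
- apply: aeW => x; rewrite -[X in _ --> X](mulr0 (g x)).
  apply: cvgM; first exact: cvg_cst.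
  apply/norm_cvg0P; rewrite -[X in _ --> X](subrr (psi x)).
  by apply: cvgB; [exact: cvgk|exact: cvg_cst].
- by apply: L1Z; case: Wxi.
- move=> k x; rewrite normrM ger0_norm// normr_id mulrCA ler_wpM2l//.
  rewrite (le_trans (ler_normB _ _))// mulr2n mulrDl mul1r; exact: lerD.
have -> : \int[mu]_x (0 : R) = 0 by rewrite /Rintegral integral0.
move=> h; apply/subr_cvg0/norm_cvg0P.
apply: (@squeeze_cvgr _ _ _ _ (cst 0)) h; last exact: cvg_cst.
by apply: nearW => k; rewrite normr_ge0 -FB//=; apply: F_norm; exact: WB.
Qed.

(* The weight [rho] makes [cut A] belong to [W] even when [mu A] is infinite, so
   that [nu] is a finite charge. *)
Let cut A : T -> R := fun x => \1_A x * rho x.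

Let Wind A : measurable A -> W (cut A).
Proof.
move=> mA; split; first by apply: measurable_funM.
rewrite /cut; under eq_fun do rewrite mulrCA.
apply: (@L1_bounded_mul _ _ _ _ _ _ 1) => // x.
by rewrite indicE; case: (_ \in _); rewrite ?normr1 ?normr0.
Qed.

Let nu A : \bar R := (F (cut A))%:E.

Let nu0 : nu set0 = 0%E.
Proof.
rewrite /nu (_ : cut set0 = 0) ?F0//.
by apply/funext => x; rewrite /cut indic0 mul0r.
Qed.

Let nu_fin A : measurable A -> nu A \is a fin_num. Proof. by []. Qed.

Let W_rho : W rho. Proof. by []. Qed.

(** Partial sums are the values on finite unions, and their cuts converge pointwise under the common
    bound [rho]. *)
Let nu_sigma_additive : semi_sigma_additive nu.
Proof.
move=> A mA tA mU.
have e k : (\sum_(0 <= i < k) nu (A i))%E = nu (\bigcup_(i < k) A i).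
  elim: k => [|k ih]; first by rewrite big_geq// II0 bigcup_set0.
  rewrite big_nat_recr//= ih IIS bigcup_setU bigcup_set1 /nu -EFinD; congr EFin.
  have mUk : measurable (\bigcup_(i < k) A i) by apply: bigcup_measurable => i _; exact: mA.
  rewrite -FD; [|exact: Wind..].
  congr F; apply/funext => x.
  suff eU : \1_((\bigcup_(i < k) A i) `|` A k) x =
      \1_(\bigcup_(i < k) A i) x + \1_(A k) x :> R.
    by rewrite /cut eU mulrDl.
  have /seteqP[dis _] : (\bigcup_(i < k) A i) `&` A k = set0.
    rewrite setI_bigcupl; apply: bigcup0 => i /= ik.
    have /trivIsetP := tA; apply => //.
    by rewrite ltn_eqF.
  rewrite !indicE in_setU; have [/set_mem h1|h1] := boolP (x \in \bigcup_(i < k) A i);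
    have [/set_mem h2|h2] := boolP (x \in A k); rewrite /= ?addr0 ?add0r//.
  by have := dis x (conj h1 h2).
under eq_fun do rewrite e; rewrite /nu.
apply: cvg_EFin; first exact: nearW.
apply: (F_continuous _ _ W_rho) => [k||x|k x].
- by apply: (Wind _).1; apply: bigcup_measurable => i _; exact: mA.
- exact: Wind.
- rewrite /cut; apply: cvgM; last exact: cvg_cst.
  apply/cvgrPdist_le => t t0.
  have [[i _ Aix]|nU] := pselect ((\bigcup_i A i) x).
    exists i.+1 => // k /= ik; rewrite !indicE !mem_set ?subrr ?normr0 ?ltW//.
      by exists i.
    by exists i.
  apply: nearW => k; rewrite !indicE !memNset ?subrr ?normr0 ?ltW// => -[i _ Aix].
  by apply: nU; exists i.
- rewrite normrM (gtr0_norm (rho0 _)); apply: ler_piMl; first exact: ltW.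
  by rewrite indicE; case: (_ \in _); rewrite ?normr1 ?normr0.
Qed.

Let nu_charge : {charge set T -> \bar R} :=
  HB.pack nu (isCharge.Build _ T R nu nu0 nu_fin nu_sigma_additive).

Let nu_dominated : nu `<< mu.
Proof.
apply/null_content_dominatesP => A mA A0; rewrite /nu; congr EFin.
apply/eqP; rewrite -normr_le0; apply: le_trans (F_norm (Wind mA)) _.
have i0 : L1 (fun=> 0 : R) by exact: integrable0.
have -> : 0 = \int[mu]_x (0 : R) by rewrite /Rintegral integral0.
apply: Rint_le_ae => //; first by apply: W_abs; exact: Wind.
exists A; split => // x /= xA; apply: contrapT => nxA; apply: xA.
by rewrite /cut indicE memNset// mul0r normr0 mulr0.
Qed.

(** The Radon-Nikodym density of [nu] represents [F] on the cuts after division by [rho]. Linearity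
    extends this to simple functions times [rho], continuity to nonnegative functions, and a
    splitting by sign to all of [W]. *)
Lemma dominated_extended_functional_representation :
  exists v : T -> R, [/\ measurable_fun setT v, forall x, `|v x| <= g x &
    forall psi, W psi -> F psi = \int[mu]_x (v x * psi x)].
Proof.
pose f x := fine (Radon_Nikodym nu_charge mu x).
have fE x : (f x)%:E = Radon_Nikodym nu_charge mu x.
  by rewrite fineK//; exact: (@Radon_Nikodym_fin_num _ _ _ nu_charge mu x nu_dominated).
have fi : L1 f.
  have := @Radon_Nikodym_integrable _ _ _ nu_charge mu nu_dominated.
  by apply: eq_integrable => // x _ /=; rewrite fE.
have mf := L1_measurable fi.
have nuf A : measurable A -> F (cut A) = \int[mu]_x (\1_A x * f x).
  move=> mA; have := @Radon_Nikodym_integral _ _ _ nu_charge mu A nu_dominated mA.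
  rewrite -[LHS]/((F (cut A))%:E) => e; rewrite -[LHS]/(fine (F (cut A))%:E) e.
  rewrite /Rintegral; congr fine; rewrite [LHS]integral_mkcond.
  apply: eq_integral => x _; rewrite patchE indicE -fE.
  by case: ifP => _; rewrite ?mul1r ?mul0r.
pose gr x := g x * rho x.
have ind_norm A x : `|\1_A x : R| <= 1.
  by rewrite indicE; case: (_ \in _); rewrite ?normr1 ?normr0.
have indL1 A xi : measurable A -> L1 xi -> L1 (fun x => (\1_A x : R) * xi x).
  by move=> mA; apply: L1_bounded_mul => // ; exact: measurable_indic.
have cut_abs A : measurable A -> \int[mu]_x (g x * `|cut A x|) = \int[mu]_x ((\1_A x : R) * gr x).
  move=> mA; apply: eq_Rintegral => x _.
  by rewrite /cut normrM (gtr0_norm (rho0 x)) ger0_norm// mulrCA.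
(* On the set [A] where s f exceeds g rho, the integral of the excess is s F (cut A) minus the
   seminorm of the cut, hence nonpositive; so the excess vanishes a.e. The signs 1 and -1 together
   bound |f|. *)
have half (s : R) : `|s| = 1 -> \forall x \ae mu, s * f x <= gr x.
  move=> s1; pose A := [set x | gr x < s * f x].
  have mA : measurable A.
    have : measurable_fun setT (fun x => gr x < s * f x).
      apply: measurable_fun_ltr; first exact: measurable_funM.
      by apply: measurable_funM => //; exact: measurable_cst.
    by move=> /(_ measurableT [set true]); rewrite setTI; apply.
  pose q x := (\1_A x : R) * (s * f x - gr x).
  have qi : L1 q by apply: indL1 => //; apply: L1B => //; exact: L1Z.
  have q0 x : 0 <= q x.
    rewrite /q indicE; have [/set_mem|_] := boolP (x \in A); last by rewrite mul0r.
    by rewrite mul1r subr_ge0 => /ltW.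
  have : \int[mu]_x q x <= 0.
    have -> : \int[mu]_x q x = s * F (cut A) - \int[mu]_x ((\1_A x : R) * gr x).
      rewrite nuf// -RintZ; last exact: indL1.
      rewrite -RintB; [|by apply: L1Z; exact: indL1|exact: indL1].
      by apply: eq_Rintegral => x _; rewrite /q mulrBr mulrCA.
    rewrite subr_le0 -cut_abs//; apply: le_trans (F_norm (Wind mA)).
    by rewrite -[leRHS]mul1r -s1 -normrM ler_norm.
  move=> qle.
  have : (\int[mu]_(x in setT) `|(EFin \o q) x| = 0)%E.
    have -> : (\int[mu]_(x in setT) `|(EFin \o q) x| = \int[mu]_x (q x)%:E)%E.
      by apply: eq_integral => x _ /=; rewrite ger0_norm.
    rewrite -[LHS]fineK; last exact: integrable_fin_num.
    congr EFin; apply/eqP; rewrite eq_le qle /=.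
    by apply: Rintegral_ge0.
  move=> /(ae_eq_integral_abs _ measurableT (measurable_int _ qi)).
  apply: filterS => x /(_ I) /= [] /eqP.
  rewrite /q mulf_eq0 => /orP[|]; last by rewrite subr_eq0 => /eqP ->.
  rewrite indicE; have [//|/negP nA _] := boolP (x \in A).
    by rewrite oner_eq0.
  by rewrite leNgt; apply/negP => ?; apply: nA; exact: mem_set.
have fgr : \forall x \ae mu, `|f x| <= gr x.
  have h1 := half 1 (normr1 _); have h2 := half (-1) (normrN1 _).
  apply: filterS2 h1 h2 => x; rewrite mul1r mulN1r => h1 h2.
  by rewrite ler_norml h1 lerNl h2.
(* The bound on [f] holds a.e. only; the value 0 on the exceptional set makes |v| <= g hold
   everywhere. *)
pose v x := if `|f x| <= gr x then f x / rho x else 0.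
have mv : measurable_fun setT v.
  apply: measurable_fun_ifT.
  - apply: measurable_fun_ler; last exact: measurable_funM.
    by apply: measurableT_comp => //; exact: normr_measurable.
  - exact: measurable_funM.
  - exact: measurable_cst.
have vg x : `|v x| <= g x.
  rewrite /v; case: ifP => [fx|_]; last by rewrite normr0.
  by rewrite normrM normfV (gtr0_norm (rho0 x)) ler_pdivrMr.
have L1v psi : W psi -> L1 (fun x => v x * psi x).
  move=> [mpsi gpsi]; apply: (@L1_le _ _ _ mu _ (fun x => g x * `|psi x|)).
  - exact: measurable_funM.
  - by move=> x; rewrite normrM ler_wpM2r.
  - exact: W_abs.
have Fcut A : measurable A -> F (cut A) = \int[mu]_x (v x * cut A x).
  move=> mA; rewrite nuf//; apply: Rint_eq_ae; [exact: indL1|by apply: L1v; exact: Wind|].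
  apply: filterS fgr => x fx; rewrite /v fx /cut mulrCA.
  by rewrite divfK// gt_eqF.
have Fsum (m : nat) (c : 'I_m -> R) (A : 'I_m -> set T) (r : seq 'I_m) :
    (forall i, measurable (A i)) ->
    W (fun x => \sum_(i <- r) c i * cut (A i) x) /\
    F (fun x => \sum_(i <- r) c i * cut (A i) x) =
      \int[mu]_x (v x * \sum_(i <- r) c i * cut (A i) x).
  move=> mA; elim: r => [|i r [ihW ihF]].
    under eq_fun do rewrite big_nil.
    split; first exact: W0.
    rewrite F0; under eq_Rintegral do rewrite big_nil mulr0.
    by rewrite /Rintegral integral0.
  rewrite (_ : (fun x => _) = c i *: (cut (A i) : fctType) +
      (fun x => \sum_(i <- r) c i * cut (A i) x)); last first.
    by apply/funext => x; rewrite big_cons.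
  have Wi := Wind (mA i).
  split; first exact: W_sub.2.
  rewrite Flin// ihF Fcut// -RintZ; last exact: L1v.
  rewrite -RintD; [|by apply: L1Z; exact: L1v|exact: L1v].
  by apply: eq_Rintegral => x _; rewrite big_cons mulrDr mulrCA.
have Fge0 psi : W psi -> (forall x, 0 <= psi x) -> F psi = \int[mu]_x (v x * psi x).
  move=> Wpsi psi0; have [mpsi gpsi] := Wpsi.
  (* Simple functions increasing to psi / rho, multiplied back by [rho], are combinations of cuts
     and stay below [psi], which therefore serves as the dominating function. *)
  pose s x := psi x / rho x.
  have s0 x : 0 <= s x by rewrite divr_ge0// ltW.
  have ms : measurable_fun setT (EFin \o s).
    by apply/measurable_EFinP; exact: measurable_funM.
  pose s_ k : T -> R := nnsfun_approx measurableT ms k.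
  have s_cvg x : s_ ^~ x @ \oo --> s x.
    have s0E y (_ : setT y) : (0 <= (EFin \o s) y)%E by rewrite lee_fin.
    by have /fine_cvgP[_] := cvg_nnsfun_approx measurableT ms s0E (I : setT x).
  have s_le k x : s_ k x <= s x.
    rewrite -(cvg_lim _ (s_cvg x))//; apply: nondecreasing_cvgn_le.
      by move=> i l il; have /lefP := nd_nnsfun_approx measurableT ms il; apply.
    by apply/cvg_ex; exists (s x); exact: s_cvg.
  have s_0 k x : 0 <= s_ k x by [].
  pose psi_ k x := s_ k x * rho x.
  have psi_E k : psi_ k = fun x => \sum_(i < #|`fset_set (range (s_ k))|)
      (fset_set (range (s_ k)))`_i * cut (s_ k @^-1` [set (fset_set (range (s_ k)))`_i]) x.
    apply/funext => x; rewrite /psi_ [LHS](congr1 (fun t => t * rho x)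
      (fimfunEord (nnsfun_approx measurableT ms k) x)) mulr_suml.
    by apply: eq_bigr => i _; rewrite -mulrA.
  have mcut k (i : 'I_#|`fset_set (range (s_ k))|) :
      measurable (s_ k @^-1` [set (fset_set (range (s_ k)))`_i]).
    exact: measurable_sfunP.
  have WF k : W (psi_ k) /\ F (psi_ k) = \int[mu]_x (v x * psi_ k x).
    by rewrite psi_E; apply: Fsum => i; exact: mcut.
  have psi_le k x : `|psi_ k x| <= psi x.
    rewrite ger0_norm; last by rewrite mulr_ge0// ltW.
    by rewrite -ler_pdivlMr//; exact: s_le.
  have psi_cvg x : psi_ ^~ x @ \oo --> psi x.
    rewrite -[X in _ --> X](divfK (lt0r_neq0 (rho0 x))).
    by apply: cvgM; [exact: s_cvg|exact: cvg_cst].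
  have c1 : F (psi_ k) @[k --> \oo] --> F psi.
    by apply: (F_continuous _ Wpsi Wpsi psi_cvg psi_le) => k; case: (WF k) => -[].
  have [|||||_ c2] := @Rint_dct _ _ _ mu (fun k x => v x * psi_ k x)
      (fun x => v x * psi x) (fun x => g x * psi x).
  - by move=> k; apply: measurable_funM => //; case: (WF k) => -[].
  - exact: measurable_funM.
  - by apply: aeW => x; apply: cvgM; [exact: cvg_cst|exact: psi_cvg].
  - exact: gpsi.
  - by move=> k x; rewrite normrM ler_pM.
  have e : (fun k => F (psi_ k)) = (fun k => \int[mu]_x (v x * psi_ k x)).
    by apply/funext => k; case: (WF k).
  by rewrite e in c1; rewrite -(cvg_lim _ c1)// -(cvg_lim _ c2).
exists v; split => // psi Wpsi; have [mpsi gpsi] := Wpsi.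
have Wpart (s : R) : `|s| = 1 -> W (fun x => Num.max (s * psi x) 0).
  move=> s1; split.
    by apply: measurable_maxr => //; apply: measurable_funM.
  apply: (@L1_le _ _ _ mu _ (fun x => g x * `|psi x|)); last exact: W_abs.
    by apply: measurable_funM => //; apply: measurable_maxr => //; apply: measurable_funM.
  move=> x; rewrite normrM (ger0_norm (g0 x)) ler_wpM2l// ger0_norm; last first.
    by rewrite le_max lexx orbT.
  by rewrite ge_max normr_ge0 andbT (le_trans (ler_norm _))// normrM s1 mul1r.
have W1 := Wpart 1 (normr1 _); have W2 := Wpart (-1) (normrN1 _).
have psiE : psi = (fun x => Num.max (1 * psi x) 0 - Num.max (-1 * psi x) 0).
  apply/funext => x; rewrite mul1r mulN1r.
  have /orP[x0|x0] := le_total 0 (psi x).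
    by rewrite max_l// max_r ?subr0// oppr_le0.
  by rewrite max_r// max_l ?sub0r ?opprK// oppr_ge0.
rewrite [in LHS]psiE FB// !Fge0//; [|by move=> x; rewrite le_max lexx orbT..].
rewrite -RintB; [|exact: L1v..].
by apply: eq_Rintegral => x _; rewrite -mulrBr [in RHS]psiE.
Qed.

End extended.

(** [U] may contain no cut of a set, so the charge cannot be read off from [F] itself; Hahn-Banach
    first extends [F] to the whole weighted space under the same bound. *)
Lemma dominated_functional_representation (U : set fctType) (F : fctType -> R) :
  subspace_set U -> linear_on U F ->
  (forall psi, U psi -> [/\ measurable_fun setT (psi : T -> R),
     L1 (fun x => g x * psi x) & F psi <= \int[mu]_x (g x * `|psi x|)]) ->
  exists v : T -> R, [/\ measurable_fun setT v, forall x, `|v x| <= g x &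
    forall psi, U psi -> F psi = \int[mu]_x (v x * psi x)].
Proof.
move=> Usub Flin UF.
have UW : U `<=` W by move=> psi /UF[].
have [G [Glin Gp GF]] := hahn_banach W_sub p_sublinear Usub UW Flin
  (fun psi Upsi => let: And3 _ _ h := UF psi Upsi in h).
have [v [mv vg vG]] := dominated_extended_functional_representation Glin Gp.
exists v; split => // psi Upsi.
by rewrite -GF// vG//; exact: UW.
Qed.

End dominated_functionals.

(** On the [k]-th level set of [N] the weight is 2^-(k+1) / (1 + G k), where [G k] is the integral
    of [g] there; the total is at most the sum of the 2^-(k+1). The weight is a function of [N]
    alone, so it and its inverse are measurable. *)
Lemma integrable_weight d (T : measurableType d) (R : realType)
    (mu : {measure set T -> \bar R}) (g : T -> R) (N : T -> nat) :
  measurable_fun setT g -> (forall x, 0 <= g x) ->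
  (forall k, measurable (N @^-1` [set k])) ->
  (forall k, mu.-integrable (N @^-1` [set k]) (EFin \o g)) ->
  exists rho : T -> R, [/\ measurable_fun setT rho,
    measurable_fun setT (fun x => (rho x)^-1), forall x, 0 < rho x &
    mu.-integrable setT (EFin \o (fun x => g x * rho x))].
Proof.
move=> mg g0 mN gi.
pose F k := N @^-1` [set k].
pose G k := \int[mu]_(x in F k) g x.
have G0 k : 0 <= G k by apply: Rintegral_ge0 => x _.
pose r k : R := (2 ^ k.+1)%:R^-1 / (1 + G k).
have G1 k : 0 < 1 + G k by rewrite ltr_pwDl.
have p2 k : 0 < (2 ^ k.+1)%:R :> R by rewrite ltr0n expn_gt0.
have r0 k : 0 < r k by rewrite divr_gt0// invr_gt0.
have mcomp (h : nat -> R) : measurable_fun setT (h \o N).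
  move=> _ Y _; rewrite setTI.
  rewrite (_ : _ @^-1` _ = \bigcup_(k in [set k | Y (h k)]) F k).
    by apply: bigcup_measurable => k _; exact: mN.
  apply/seteqP; split=> x; first by move=> Yx; exists (N x).
  by move=> [k /= Yk Nk]; rewrite /preimage /= Nk.
exists (r \o N); split => //; [exact: (mcomp (fun k => (r k)^-1))|by move=> x; exact: r0|].
have UF : [set: T] = \bigcup_k F k by apply/esym; rewrite -subTset => x _; exists (N x).
have mgr : measurable_fun setT (fun x => g x * (r \o N) x) by exact: measurable_funM.
apply/integrableP; split; first exact/measurable_EFinP.
rewrite (eq_integral (fun x => (g x * r (N x))%:E)); last first.
  by move=> x _ /=; rewrite ger0_norm// mulr_ge0// ltW.
rewrite UF ge0_integral_bigcup//; last 3 first.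
- by rewrite -UF; exact/measurable_EFinP.
- by move=> x _; rewrite lee_fin mulr_ge0// ltW.
- apply/trivIsetP => i j _ _ ij; rewrite -subset0 => x [/= Ni Nj].
  by move: ij; rewrite -Ni -Nj eqxx.
apply: (@le_lt_trans _ _ 1%:E); last exact: ltry.
apply: le_trans (epsilon_trick0 xpredT ler01).
apply: lee_nneseries => [k _ _|k _].
  by apply: integral_ge0 => x _; rewrite lee_fin mulr_ge0// ltW.
rewrite (eq_integral (fun x => (r k)%:E * (g x)%:E)%E); last first.
  by move=> x; rewrite inE /F /= => Nx; rewrite Nx -EFinM mulrC.
rewrite integralZl; [|exact: mN|exact: gi].
rewrite -(@fineK _ (\int[mu]_(x in F k) (g x)%:E)%E); last by apply: integrable_fin_num (gi k).
rewrite -EFinM lee_fin /r mul1r -[leRHS]mulr1 -mulrA; apply: ler_wpM2l.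
  by rewrite invr_ge0 ler0n.
by rewrite ler_pdivrMl// mulr1 -/(G k) lerDr.
Qed.

Section lebesgue_sigma_finite.
Context (R : realType) (n : nat).
Local Notation Rn := 'rV[R]_n.+1.
Local Notation leb := (lebesgue R n).

Let lebesgue_sigma_finite : sigma_finite setT leb.
Proof.
exists (fun k : nat => [set x : Rn | `|x| <= k%:R]).
  apply/esym; rewrite -subTset => x _; have /filter_ex[k xk] := nbhs_infty_ger `|x|.
  by exists k.
move=> k; split; first exact: lmeasurable_norm_le.
exact: (lebesgue_bounded_lty (M := k%:R)).
Qed.

HB.instance Definition _ := Measure_isSigmaFinite.Build _ _ _ leb lebesgue_sigma_finite.

End lebesgue_sigma_finite.

Section local_representation.
Context {R : realType} {n : nat}.
Local Notation Rn := 'rV[R]_n.+1.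
Local Notation leb := (lebesgue R n).
Local Notation L1 f := (leb.-integrable [set: lebesgue_space R n] (EFin \o f)).

Lemma local_functional_representation (g : Rn -> R) (U : set (Rn -> R^o))
    (F : (Rn -> R^o) -> R) :
  lmeasurable_fun setT g -> (forall x, 0 <= g x) ->
  (forall M : R, leb.-integrable [set x : Rn | `|x| <= M] (EFin \o g)) ->
  subspace_set U -> linear_on U F ->
  (forall psi, U psi -> [/\ lmeasurable_fun setT (psi : Rn -> R),
     L1 (fun x => g x * psi x) & F psi <= \int[leb]_x (g x * `|psi x|)]) ->
  exists v : Rn -> R, [/\ lmeasurable_fun setT v, forall x, `|v x| <= g x &
    forall psi, U psi -> F psi = \int[leb]_x (v x * psi x)].
Proof.
move=> mg g0 gloc Usub Flin UF.
(* The level sets are the shells k <= |x| < k + 1, on each of which [g] is integrable. *)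
pose N (x : Rn) := Num.truncn `|x|.
have NE k : N @^-1` [set k] =
    [set x : Rn | `|x| <= k.+1%:R] `&`
    ((fun x : Rn => `|x|) @^-1` [set t : R | k%:R <= t < k.+1%:R]).
  apply/seteqP; split=> x /=.
    move=> Nx; have := truncn_itv (normr_ge0 x); rewrite -/(N x) Nx => h.
    by split => //; case/andP: h => _ /ltW.
  by move=> [_ h]; exact: truncn_def.
have mnorm : lmeasurable_fun setT (fun x : Rn => `|x|).
  apply: continuous_lmeasurable_fun; first exact: measurableT.
  by move=> x; exact: norm_continuous.
have mN k : lmeasurable (N @^-1` [set k]).
  rewrite NE; apply: measurableI; first exact: lmeasurable_norm_le.
  have mI : measurable ([set` `[k%:R, k.+1%:R[] : set R) by exact: measurable_itv.
  rewrite (_ : _ @^-1` _ = [set: Rn] `&` (fun x : Rn => `|x|) @^-1` [set` `[k%:R, k.+1%:R[]).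
    exact: (mnorm measurableT _ mI).
  by rewrite setTI; apply/seteqP; split=> x; rewrite /preimage /= in_itv.
have gN k : leb.-integrable (N @^-1` [set k]) (EFin \o g).
  apply: (@integrableS _ _ _ leb [set x : Rn | `|x| <= k.+1%:R]) => //.
  - exact: lmeasurable_norm_le.
  - exact: mN.
  - by rewrite NE => x [].
have [rho [mr mrV r0 gr]] := @integrable_weight _ _ _ leb g N mg g0 mN gN.
exact: (@dominated_functional_representation _ _ _ leb g rho mg mr mrV g0 r0 gr U F).
Qed.

End local_representation.

(** * Finite McShane formulas *)

Section minimax.
Context {R : realType}.

(** The initial values of the minimum and of the maxima are themselves entries of the families, so
    they do not alter the result. *)
Definition minimax (I : finType) (i0 : I) (F : I -> I -> R) : R :=
  \big[Num.min/ \big[Num.max/F i0 i0]_m F m i0]_k \big[Num.max/F i0 k]_m F m k.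

Variables (I : finType) (i0 : I).
Implicit Types (F G : I -> I -> R).

Lemma minimax_le F k c : (forall m, F m k <= c) -> minimax i0 F <= c.
Proof. by move=> Fc; apply: (bigmin_inf k) => //; apply: bigmax_le. Qed.

Lemma le_minimax F c : (forall k, exists m, c <= F m k) -> c <= minimax i0 F.
Proof.
move=> Fc; have cF k : c <= \big[Num.max/F i0 k]_m F m k.
  by have [m cm] := Fc k; apply: (bigmax_sup m).
by apply: le_bigmin.
Qed.

Lemma minimax_dist F G e : (forall m k, `|F m k - G m k| <= e) ->
  `|minimax i0 F - minimax i0 G| <= e.
Proof.
move=> FG.
have maxFG k : `|\big[Num.max/F i0 k]_m F m k - \big[Num.max/G i0 k]_m G m k| <= e.
  elim/big_rec2: _ => [|m y1 y2 _ le12]; first exact: FG.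
  by apply: le_trans (distr_max _ _ _ _) _; rewrite ge_max FG.
rewrite /minimax; elim/big_rec2: _ => [|k y1 y2 _ le12]; first exact: maxFG.
rewrite -[Num.min _ y2]opprK -[Num.min _ y1]opprK !oppr_min -opprD normrN.
apply: le_trans (distr_max _ _ _ _) _.
by rewrite -!opprD !normrN ge_max maxFG le12.
Qed.

Lemma measurable_minimax d (T : measurableType d) (F : T -> I -> I -> R) :
  (forall m k, measurable_fun setT (fun x => F x m k)) ->
  measurable_fun setT (fun x => minimax i0 (F x)).
Proof.
move=> mF.
have mmax k (s : seq I) :
    measurable_fun setT (fun x => \big[Num.max/F x i0 k]_(m <- s) F x m k).
  elim: s => [|m s IH]; first by under eq_fun do rewrite big_nil; exact: mF.
  under eq_fun do rewrite big_cons.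
  exact: (measurable_maxr (mF m k) IH).
have mmin (s : seq I) : measurable_fun setT (fun x =>
    \big[Num.min/ \big[Num.max/F x i0 i0]_m F x m i0]_(k <- s)
      \big[Num.max/F x i0 k]_m F x m k).
  elim: s => [|k s IH]; first by under eq_fun do rewrite big_nil; exact: mmax.
  under eq_fun do rewrite big_cons.
  exact: (measurable_minr (mmax k _) IH).
exact: mmin.
Qed.

End minimax.

(* McShane's formula [Phi v = inf_k (Phi (y k) + L `|v - y k|)] for [y] dense,
   where the norm is replaced by a supremum of functionals norming [y m - y k]. *)
Lemma mcshane_minimax (R : realType) (V : normedModType R) (Phi : V -> R) (L : R)
    (y : nat -> V) (l : nat -> nat -> V -> R) (N m : nat) (v : V) :
  0 <= L -> (forall x z, `|Phi x - Phi z| <= L * `|x - z|) ->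
  (forall i k x, `|l i k x| <= `|x|) ->
  (forall i k x z, l i k (x - z) = l i k x - l i k z) ->
  (forall i k, l i k (y i - y k) = `|y i - y k|) -> (m <= N)%N ->
  `|minimax (ord0 : 'I_N.+1)
      (fun i k => Phi (y k) + L * (l i k v - l i k (y k))) - Phi v| <=
  2 * (L * `|v - y m|).
Proof.
move=> L0 PhiL lle lB leq mN; set e := `|v - y m|.
have mN1 : (m < N.+1)%N by [].
rewrite ler_distl; apply/andP; split.
  (* For each [k] the functional norming y_m - y_k is nearly norming for v - y_k: replacing [v] by
     y_m costs at most 2 |v - y_m|. Then Phi v <= Phi (y_k) + L |v - y_k| gives the lower bound. *)
  apply: le_minimax => k; exists (Ordinal mN1) => /=.
  rewrite -lB.
  have h1 : `|v - y k| - 2 * e <= l m k (v - y k).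
    have -> : v - y k = (v - y m) - (y k - y m) by rewrite opprB addrA subrK.
    rewrite lB.
    have -> : l m k (y k - y m) = - `|y m - y k|.
      by rewrite -leq !lB opprB.
    have := lle m k (v - y m); rewrite ler_norml => /andP[h _].
    have h2 : `|v - y m - (y k - y m)| <= e + `|y m - y k|.
      by rewrite -(distrC (y k)); exact: ler_normB.
    rewrite -/e in h; lra.
  have := PhiL v (y k); rewrite ler_distl => /andP[_ h3].
  have := ler_wpM2l L0 h1; rewrite mulrBr => h2.
  have -> : 2 * (L * e) = L * (2 * e) by ring.
  clear -h3 h2; lra.
(* For the upper bound the minimum is tested at k = m, where every functional contributes at most L
   |v - y_m|, and Phi (y_m) exceeds Phi v by no more than this. *)
apply: (@minimax_le _ _ _ _ (Ordinal mN1)) => i /=.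
rewrite -lB.
have := PhiL v (y m); rewrite ler_distl => /andP[h3 _].
have h4 : L * l i m (v - y m) <= L * e.
  by rewrite ler_wpM2l//; apply: le_trans (ler_norm _) (lle _ _ _).
by rewrite -/e in h3; clear -h3 h4; lra.
Qed.

Lemma dual_unit_ball_le (R : realType) (V : normedModType R)
    (l : {linear V -> R^o}) (x : V) : dual_unit_ball l -> `|l x| <= `|x|.
Proof.
move=> [_ l1]; have [->|x0] := eqVneq x 0; first by rewrite linear0 !normr0.
have nx : 0 < `|x| by rewrite normr_gt0.
rewrite -[leRHS]mulr1 -ler_pdivrMl// -[X in X * _]gtr0_norm ?invr_gt0// -normrM.
have -> : `|x|^-1 * l x = l (`|x|^-1 *: x) by rewrite linearZ.
rewrite -lee_fin; apply: le_trans l1; apply: ereal_sup_ubound => /=.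
exists (`|x|^-1 *: x) => //=.
by rewrite normrZ gtr0_norm ?invr_gt0// mulVf// gt_eqF.
Qed.

Lemma lipschitz_le (R : realType) (V Z : normedModType R) (f : V -> Z) :
  lipschitz f -> exists2 k : R, 0 <= k & forall x y, `|f x - f y| <= k * `|x - y|.
Proof.
move=> [M [_ fM]]; exists (`|M| + 1); first by rewrite addr_ge0.
move=> x y; apply: (fM (`|M| + 1) _ (x, y)) => //.
by rewrite (le_lt_trans (ler_norm _))// ltrDl.
Qed.

(** * Test functions and neighbourhoods of their supports *)

Section test_functions.
Context {R : realType} {n : nat}.
Local Notation Rn := 'rV[R]_n.+1.
Implicit Types (phi psi : Rn -> R) (Omega : set Rn).

Lemma continuously_differentiableD (t : R) k phi psi :
  continuously_differentiable k phi -> continuously_differentiable k psi ->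
  continuously_differentiable k (fun x => t * phi x + psi x).
Proof.
have cont (p q : Rn -> R) : continuous p -> continuous q ->
    continuous (fun x => t * p x + q x).
  move=> cp cq x.
  have h : {for x, continuous (fun x => t * p x)}.
    by apply: continuousM; [exact: cst_continuous|exact: cp].
  exact: (continuousD h (cq x)).
elim: k phi psi => [|k IH] phi psi /=; first exact: cont.
move=> [cp dp] [cq dq]; split; first exact: cont.
move=> j; have [dpj pj] := dp j; have [dqj qj] := dq j.
have h x : is_derive x (delta_mx ord0 j : Rn) (fun x => t * phi x + psi x)
    (t * partial j phi x + partial j psi x).
  have dph : is_derive x (delta_mx ord0 j : Rn) phi (partial j phi x).
    exact/derivableP.
  have dps : is_derive x (delta_mx ord0 j : Rn) psi (partial j psi x).
    exact/derivableP.
  exact: (is_deriveD (is_deriveZ t dph) dps).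
split=> [x|]; first exact: ex_derive.
have -> : partial j (fun x => t * phi x + psi x) =
    (fun x => t * partial j phi x + partial j psi x).
  by apply/funext => x; rewrite /partial derive_val.
exact: IH.
Qed.

Lemma test_function_subspace Omega :
  subspace_set (test_function Omega : set (Rn -> R^o)).
Proof.
split.
  have c0 k : continuously_differentiable k (fun _ : Rn => 0 : R).
    elim: k => [|k IH] /=; first exact: cst_continuous.
    split=> [|j]; first exact: cst_continuous.
    split=> [x|]; first exact: derivable_cst.
    suff -> : partial j (fun _ : Rn => 0 : R) = (fun=> 0) by [].
    by apply/funext => x; rewrite /partial derive_cst.
  have s0 : closure [set x : Rn | (fun=> 0 : R) x != 0] = set0.
    rewrite (_ : [set x : Rn | _] = set0) ?closure0//.
    by apply/seteqP; split => x //=; rewrite eqxx.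
  by split; [exact: c0| rewrite s0; exact: compact0 | rewrite s0; exact: sub0set].
move=> t phi psi [cp kp sp] [cq kq sq].
have sub : closure [set x | (t *: (phi : Rn -> R^o) + psi) x != 0] `<=`
    closure [set x | phi x != 0] `|` closure [set x | psi x != 0].
  rewrite -closureU; apply: closureS => x /=.
  have [p0|] := eqVneq (phi x) 0; last by left.
  have [q0|] := eqVneq (psi x) 0; last by right.
  rewrite (_ : _ x = t * phi x + psi x :> R); last by [].
  by rewrite p0 q0 mulr0 addr0 eqxx.
split.
- by move=> k; exact: continuously_differentiableD.
- apply: subclosed_compact sub; first exact: closed_closure.
  exact: compactU.
- by apply: subset_trans sub _ => x [/sp|/sq].
Qed.

Lemma partialD (t : R) phi psi j x :
  continuously_differentiable 1 phi -> continuously_differentiable 1 psi ->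
  partial j (fun x => t * phi x + psi x) x = t * partial j phi x + partial j psi x.
Proof.
move=> [_ /(_ j)[dp _]] [_ /(_ j)[dq _]].
have dph : is_derive x (delta_mx ord0 j : Rn) phi (partial j phi x).
  exact/derivableP.
have dps : is_derive x (delta_mx ord0 j : Rn) psi (partial j psi x).
  exact/derivableP.
rewrite /partial; have h := is_deriveD (is_deriveZ t dph) dps.
by have := @derive_val _ _ _ _ _ _ _ h.
Qed.

(** With 2 r below the distance from [K] to the complement of [Omega], [H] consists of the points of
    a large ball at distance at least [r] from that complement. Distances are expressed by
    quantifying over points, which also covers an empty complement. *)
Lemma compact_neighborhood Omega (K : set Rn) : open Omega -> compact K ->
  K `<=` Omega -> exists2 r : R, 0 < r &
    exists H : set Rn, [/\ compact H, H `<=` Omega &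
      forall x y, K x -> `|x - y| <= r -> H y].
Proof.
move=> oO cK KO.
have [r r0 rP] : exists2 r : R, 0 < r &
    forall x z, K x -> ~ Omega z -> 2 * r <= `|x - z|.
  have /compact_near_coveringP/(_ R (0 : R)^'+
      (fun r x => forall z, ~ Omega z -> 2 * r <= `|x - z|) _) := cK.
  case.
    move=> x /KO Ox; have [e /= e0 eP] : exists2 e : R, 0 < e & forall z, `|x - z| < e -> Omega z.
      have := oO _ Ox => /nbhs_ballP[e e0 eP]; exists e => // z xz.
      by apply: eP; rewrite -ball_normE.
    near=> x' r => z nOz.
    have : e <= `|x - z| by rewrite leNgt; apply/negP => /eP.
    have x'x : `|x - x'| < e / 2.
      near: x'; apply/nbhs_ballP; exists (e / 2) => /=; first by rewrite divr_gt0.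
      by move=> w; rewrite -ball_normE.
    have re : r < e / 4 by near: r; apply: nbhs_right_lt; rewrite divr_gt0.
    have := ler_distD x' x z; move: `|x - z| `|x - x'| `|x' - z| x'x => a b c x'x.
    rewrite /=; clear -x'x re; lra.
  move=> e /= e0 eP; exists (e / 2); first by rewrite divr_gt0.
  move=> x z Kx nOz; apply: eP => //=; last by rewrite divr_gt0.
  by rewrite sub0r normrN gtr0_norm ?divr_gt0// ltr_pdivrMr// ltr_pMr// ltr1n.
have [B KB] := compact_norm_le cK.
exists r => //; exists ([set y | `|y| <= B + r] `&`
  [set y | forall z, ~ Omega z -> r <= `|y - z|]); split.
- apply: compact_closedI; first exact: norm_le_compact.
  rewrite (_ : [set y | _] = \bigcap_(z in ~` Omega) [set y | r <= `|y - z|]).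
    apply: closed_bigI => z _.
    apply: (@closed_comp _ _ (fun y : Rn => `|y - z|) [set t | r <= t]).
      move=> w _; apply: lipschitz_on_space_continuous; exists 1 => // x y.
      rewrite mul1r (_ : x - y = (x - z) - (y - z)).
        exact: ler_dist_dist.
      by rewrite opprB addrA subrK.
    exact: closed_ge.
  by apply/seteqP; split => y.
- move=> y [_ /= yP]; apply: contrapT => /yP; rewrite subrr normr0.
  by rewrite leNgt r0.
- move=> x y Kx xy; split => /=.
    have -> : y = x - (x - y) by rewrite opprB addrC subrK.
    by rewrite (le_trans (ler_normB _ _))// lerD// KB.
  move=> z nOz; have := rP x z Kx nOz; have := ler_distD y x z.
  by clear -xy; lra.
Unshelve. all: by end_near.
Qed.

End test_functions.

Section functions_on_a_set.
Context d (T : measurableType d) (R : realType) (mu : {measure set T -> \bar R}).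
Implicit Types (A : set T) (h : T -> R).

Lemma measurable_fun_indicM A h : measurable A -> measurable_fun A h ->
  measurable_fun setT (fun x => h x * (\1_A x : R)).
Proof. by move=> mA /(measurable_restrictT h mA); rewrite patch_indic. Qed.

Lemma L1_indicM A h : measurable A -> mu.-integrable A (EFin \o h) <->
  mu.-integrable setT (EFin \o (fun x => h x * (\1_A x : R))).
Proof.
by move=> mA; rewrite (integrable_mkcond _ mA) restrict_EFin patch_indic.
Qed.

Lemma Rint_indicM A h : \int[mu]_(x in A) h x = \int[mu]_x (h x * (\1_A x : R)).
Proof. by rewrite Rintegral_mkcond patch_indic. Qed.

End functions_on_a_set.

#[local] Instance lebesgue_ae_filter (R : realType) (n : nat) :
  Filter (nbhs (almost_everywhere (lebesgue R n))).
Proof. exact: (@ae_filter_ringOfSetsType _ _ _ (lebesgue R n)). Qed.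

(** * Strongly measurable functions *)

Section strongly_measurable_functions.
Context {R : realType} {n : nat}.
Local Notation Rn := 'rV[R]_n.+1.
Local Notation leb := (lebesgue R n).
Implicit Types (Omega : set Rn).

Lemma simple_fun_preimage (V : Type) Omega (s : Rn -> V) (B : set V) :
  simple_fun Omega s -> lmeasurable (Omega `&` s @^-1` B).
Proof.
move=> [fs ms].
rewrite (_ : Omega `&` s @^-1` B =
    \bigcup_(v in (s @` Omega) `&` B) (Omega `&` s @^-1` [set v])).
  apply: fin_bigcup_measurable => [|v _]; last exact: ms.
  exact: sub_finite_set (@subIsetl _ _ _) fs.
apply/seteqP; split=> [x [Ox Bx]|x [v [_ Bv] [Ox /= sx]]].
  by exists (s x) => //; split=> //; exists x.
by split=> //=; rewrite sx.
Qed.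

Lemma simple_fun_comp (V Z : Type) Omega (s : Rn -> V) (f : V -> Z) :
  simple_fun Omega s -> simple_fun Omega (f \o s).
Proof.
move=> ss; split; first by rewrite -image_comp; exact: finite_image ss.1.
by move=> z; exact: (simple_fun_preimage (f @^-1` [set z]) ss).
Qed.

Lemma strongly_measurable_comp (V Z : normedModType R) Omega (u : Rn -> V)
    (f : V -> Z) : continuous f -> strongly_measurable Omega u ->
  strongly_measurable Omega (f \o u).
Proof.
move=> cf [s ss su]; exists (fun k => f \o s k) => [k|].
  exact: simple_fun_comp.
apply: filterS su => x su Ox /=.
by apply: (@continuous_cvg _ _ _ _ _ _ f (u x)); [exact: cf|exact: su].
Qed.

(** The compositions with simple functions converge only a.e.; their upper limit is measurable
    everywhere, and completeness of Lebesgue measure transfers measurability to the composition with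
    [u]. *)
Lemma strongly_measurable_lmeasurable (V : normedModType R) Omega (u : Rn -> V)
    (Phi : V -> R) : lmeasurable Omega -> continuous Phi ->
  strongly_measurable Omega u -> lmeasurable_fun Omega (Phi \o u).
Proof.
move=> mO cP [s ss su]; apply/measurable_EFinP.
apply: (@ae_measurable_fun _ _ _ leb
  (@measure_is_complete_caratheodory R Rn (@lebesgue_outer R n)) Omega
  (fun x : Rn => limn_esup (fun k => (Phi (s k x))%:E))).
  apply: filterS su => x su Ox.
  have cv : (Phi (s k x))%:E @[k --> \oo] --> (Phi (u x))%:E.
    apply/cvg_EFin; first exact: nearW.
    by apply: (@continuous_cvg _ _ _ _ _ _ Phi (u x)); [exact: cP|exact: su].
  by rewrite is_cvg_limn_esupE; [exact/cvg_lim|apply/cvg_ex; exists (Phi (u x))%:E].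
apply: measurable_fun_limn_esup => k; apply/measurable_EFinP => _ B mB.
exact: (simple_fun_preimage (Phi @^-1` B) (ss k)).
Qed.

(** The values of the approximating simple functions are countably many. The point 0 is put at index
    0 so that the errors of all finite McShane formulas are dominated by one multiple of the norm of
    [u]. *)
Lemma strongly_measurable_dense (V : normedModType R) Omega (u : Rn -> V) :
  strongly_measurable Omega u -> exists2 y : nat -> V, y 0%N = 0 &
    \forall x \ae leb, Omega x -> forall e, 0 < e -> exists m, `|u x - y m| < e.
Proof.
move=> [s ss su].
have : countable (\bigcup_k (s k @` Omega)).
  by apply: bigcup_countable => // k _; apply: finite_set_countable; exact: (ss k).1.
move=> /pfcard_geP[S0|[y]].
  exists (fun=> 0) => //; apply: aeW => x Ox.
  suff : (\bigcup_k (s k @` Omega)) (s 0%N x) by rewrite S0.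
  by exists 0%N => //; exists x.
exists (fun k => if k is k'.+1 then y k' else 0) => //.
apply: filterS su => x su Ox e e0.
have := su Ox => /cvgrPdist_lt/(_ e e0) [N _ /(_ N (leqnn N)) /= uN].
have [|m _ ym] := @surj _ _ _ _ y (s N x).
  by exists N => //; exists x.
by exists m.+1; rewrite ym.
Qed.

End strongly_measurable_functions.

Section banach_function_spaces.
Context {R : realType} {n : nat} (Omega : set 'rV[R]_n.+1)
  (X : banach_function_space Omega).
Context (mO : lmeasurable Omega).
Local Notation Rn := 'rV[R]_n.+1.
Local Notation leb := (lebesgue R n).

Lemma bfs_integrable (w : Rn -> R) (A : set Rn) : X w ->
  (\forall x \ae leb, Omega x -> 0 <= w x) -> lmeasurable A -> A `<=` Omega ->
  (leb A < +oo)%E -> leb.-integrable A (EFin \o w).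
Proof.
move=> Xw w0 mA AO Afin.
have mw : lmeasurable_fun Omega w := bfs_measurable Xw.
apply/integrableP; split.
  by apply/measurable_EFinP; exact: measurable_funS mw.
have [C C0 /(_ w Xw) le] := @bfs_integral _ _ _ X A mA AO Afin.
apply: le_lt_trans le _.
have [Xw1 _] : X (w \* \1_A) /\ bfs_norm X (w \* \1_A) <= bfs_norm X w.
  apply: bfs_le => //.
    apply: measurable_funM => //; exact: measurable_indic.
  apply: filterS w0 => x w0 /w0 {}w0.
  rewrite /= indicE; case: (_ \in _); rewrite ?mulr1 ?mulr0 ?normr0//.
  by rewrite ger0_norm.
by rewrite /extended_norm asboolT// -EFinM ltry.
Qed.

End banach_function_spaces.

(** * Composition with Lipschitz mappings *)

Section compact_supports.
Context {R : realType} {n : nat}.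
Local Notation Rn := 'rV[R]_n.+1.
Local Notation leb := (lebesgue R n).
Local Notation L1 f := (leb.-integrable [set: lebesgue_space R n] (EFin \o f)).
Implicit Types (K A : set Rn) (h psi : Rn -> R).

Lemma compact_subset_closed K : compact K -> closed K.
Proof. by apply: compact_closed; exact: norm_hausdorff. Qed.

Lemma closure_support_subset psi K : compact K -> (forall x, psi x != 0 -> K x) ->
  closure [set x | psi x != 0] `<=` K.
Proof.
move=> cK psiK; rewrite [X in _ `<=` X](closure_id K).1.
  exact: closureS.
exact: compact_subset_closed.
Qed.

Lemma integrable_on_compact K h : compact K ->
  leb.-integrable (K : set (lebesgue_space R n)) (EFin \o h) <->
  L1 (fun x => h x * (\1_K x : R)).
Proof. by move=> cK; exact: (@L1_indicM _ _ _ leb K h (compact_lmeasurable cK)). Qed.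

Lemma L1_compact_support h psi K A : compact K -> K `<=` A ->
  L1 (fun x => h x * (\1_K x : R)) -> continuous psi ->
  (forall x, psi x != 0 -> K x) -> L1 (fun x => h x * (\1_A x : R) * psi x).
Proof.
move=> cK KA hK cpsi psiK.
have -> : (fun x => h x * (\1_A x : R) * psi x) =
    (fun x => psi x * (h x * (\1_K x : R))).
  apply/funext => x; have [Kx|nKx] := pselect (K x).
    by rewrite !indicE !mem_set//; [rewrite mulrC|exact: KA].
  have -> : psi x = 0 by apply/eqP; apply: contra_notT nKx => /psiK.
  by rewrite mulr0 mul0r.
have [B KB] := compact_norm_le cK.
have [C C0 psiC] := continuous_bounded cpsi (fun x p => KB x (psiK x p)).
apply: (@L1_bounded_mul _ _ _ leb psi (fun x : Rn => h x * (\1_K x : R)) C _ psiC hK).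
exact: (continuous_lmeasurable_fun (open_lmeasurable openT) cpsi).
Qed.

Lemma le_gradient_length (du : 'I_n.+1 -> Rn -> R) j x :
  `|du j x| <= gradient_length du x.
Proof.
rewrite /gradient_length -[leLHS]sqrtr_sqr ler_wsqrtr//.
by rewrite (bigD1 j)//= -[leLHS]real_normK ?num_real// lerDl sumr_ge0.
Qed.

Lemma gradient_length_le (du : 'I_n.+1 -> Rn -> R) x c :
  (forall j, `|du j x| <= c) -> gradient_length du x <= n.+1%:R * c.
Proof.
move=> duc; have c0 : 0 <= c by exact: le_trans (duc ord0).
rewrite /gradient_length -[leRHS]ger0_norm ?mulr_ge0// -sqrtr_sqr ler_wsqrtr//.
apply: (@le_trans _ _ (\sum_(j < n.+1) c ^+ 2)).
  by apply: ler_sum => j _; rewrite ler_pXn2r ?nnegrE//.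
rewrite sumr_const card_ord exprMn -[leLHS]mulr_natl ler_wpM2r ?sqr_ge0//.
by rewrite -natrX ler_nat expnS expn1 leq_pmulr.
Qed.

End compact_supports.

Section lipschitz_composition.
Context {R : realType} {n : nat} (Omega : set 'rV[R]_n.+1)
  (X : banach_function_space Omega) (V : normedModType R).
Local Notation Rn := 'rV[R]_n.+1.
Local Notation leb := (lebesgue R n).
Local Notation L1 f := (leb.-integrable [set: lebesgue_space R n] (EFin \o f)).
Context (u : Rn -> V) (g : Rn -> R) (oO : open Omega).
Context (su : strongly_measurable Omega u) (Xu : X (fun x => `|u x|)) (Xg : X g)
  (g0 : \forall x \ae leb, Omega x -> 0 <= g x)
  (gu : forall l : {linear V -> R^o}, dual_unit_ball l ->
    exists2 du, weak_gradient Omega (l \o u) du &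
      \forall x \ae leb, Omega x -> gradient_length du x <= g x).

Let mO : lmeasurable Omega := open_lmeasurable oO.

Let mK (K : set Rn) : compact K -> lmeasurable K.
Proof. exact: compact_lmeasurable. Qed.

Let L1g (K : set Rn) : compact K -> K `<=` Omega ->
  L1 (fun x => `|g x| * (\1_K x : R)).
Proof.
move=> cK KO; apply/(integrable_on_compact _ cK).
have := bfs_integrable mO Xg g0 (mK cK) KO (lebesgue_compact_lty cK).
by move=> /integrable_norm.
Qed.

Let L1u (K : set Rn) : compact K -> K `<=` Omega ->
  L1 (fun x => `|u x| * (\1_K x : R)).
Proof.
move=> cK KO; apply/(integrable_on_compact _ cK).
apply: (bfs_integrable mO Xu _ (mK cK) KO (lebesgue_compact_lty cK)).
exact: aeW.
Qed.

(** The weak derivative of [l \o u] is tested against [chi] and bounded by [g]. The factors [\1_K]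
    turn locally integrable functions on [Omega] into integrable functions on the whole space
    without changing the integrals, as [chi] lives in [K]. *)
Lemma functional_gradient_bound (l : {linear V -> R^o}) (j : 'I_n.+1)
    (chi : Rn -> R) (K : set Rn) :
  dual_unit_ball l -> compact K -> K `<=` Omega ->
  (forall k, continuously_differentiable k chi) ->
  (forall x, chi x != 0 -> K x) ->
  `|\int[leb]_x (l (u x) * (\1_K x : R) * partial j chi x)| <=
  \int[leb]_x (`|g x| * (\1_K x : R) * `|chi x|).
Proof.
move=> lb cK KO cchi chiK.
have [du /(_ j)[_ [mdu du1] wp] dug] := gu lb.
have clK := closure_support_subset cK chiK.
have /wp : test_function Omega chi.
  split => //; last exact: subset_trans clK KO.
  exact: subclosed_compact (@closed_closure _ _) cK clK.
rewrite 2!(@Rint_indicM _ _ _ leb Omega) => e.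
have -> : \int[leb]_x (l (u x) * (\1_K x : R) * partial j chi x) =
    \int[leb]_x ((l \o u) x * partial j chi x * (\1_Omega x : R)).
  apply: eq_Rintegral => x _; have [Kx|nKx] := pselect (K x).
    by rewrite !indicE !mem_set//; [rewrite !mulr1|exact: KO].
  have -> : partial j chi x = 0.
    apply/eqP; apply: contra_notT nKx.
    exact: (derive_closed_support (compact_subset_closed cK) chiK).
  by rewrite !(mulr0, mul0r).
rewrite e normrN.
have -> : \int[leb]_x (du j x * chi x * (\1_Omega x : R)) =
    \int[leb]_x (du j x * (\1_K x : R) * chi x).
  apply: eq_Rintegral => x _; have [Kx|nKx] := pselect (K x).
    by rewrite !indicE !mem_set//; [rewrite !mulr1|exact: KO].
  have -> : chi x = 0 by apply/eqP; apply: contra_notT nKx => /chiK.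
  by rewrite !(mulr0, mul0r).
have duK : L1 (fun x => du j x * (\1_K x : R)).
  apply/(integrable_on_compact _ cK); apply/integrableP; split; last exact: du1.
  by apply/measurable_EFinP; exact: measurable_funS mdu.
have cc : continuous chi := cchi 0%N.
have i1 := L1_compact_support cK (@subset_refl _ K) duK cc chiK.
apply: le_trans (Rint_norm i1) _.
apply: Rint_le_ae; first exact: L1_norm.
  apply: (L1_compact_support cK (@subset_refl _ K) (L1g cK KO)).
    by move=> x; apply: (@continuous_comp _ _ _ chi (fun t : R => `|t|));
       [exact: cc|exact: norm_continuous].
  by move=> x; rewrite normr_eq0; exact: chiK.
apply: filterS dug => x dug; rewrite !normrM ler_wpM2r//.
have [Kx|nKx] := pselect (K x).
  rewrite indicE mem_set// normr1 !mulr1.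
  by rewrite (le_trans (le_gradient_length du j x))// (le_trans (dug (KO _ Kx)))// ler_norm.
by rewrite indicE memNset// normr0 !mulr0.
Qed.

Section bound.
Context (Phi : V -> R) (L : R)
  (PhiL : forall v w, `|Phi v - Phi w| <= L * `|v - w|).

Let Phi_continuous : continuous Phi.
Proof. exact: (@lipschitz_le_continuous R V R^o Phi L PhiL). Qed.

Lemma lipschitz_composition_lmeasurable : lmeasurable_fun Omega (Phi \o u).
Proof. exact: strongly_measurable_lmeasurable. Qed.

Lemma lipschitz_composition_L1 (K : set Rn) : compact K -> K `<=` Omega ->
  L1 (fun x => Phi (u x) * (\1_K x : R)).
Proof.
move=> cK KO.
have K1 := @L1_indic _ _ _ leb _ (mK cK) (lebesgue_compact_lty cK).
apply: (@L1_le _ _ _ leb _ (fun x : Rn => `|Phi 0| * (\1_K x : R) +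
  L * (`|u x| * (\1_K x : R)))).
- apply: measurable_fun_indicM; first exact: mK.
  exact: measurable_funS lipschitz_composition_lmeasurable.
- move=> x; rewrite mulrA -mulrDl normrM [X in _ * X <= _]ger0_norm//.
  rewrite ler_wpM2r//; have := PhiL (u x) 0; rewrite subr0.
  by have := ler_normD (Phi (u x) - Phi 0) (Phi 0); rewrite subrK; lra.
- by apply: L1D; [exact: (L1Z _ K1)|exact: (L1Z _ (L1u cK KO))].
Qed.

End bound.

Lemma lipschitz_composition_bound : exists2 M : R, 0 <= M &
  forall (Phi : V -> R) (L : R) (j : 'I_n.+1) (phi : Rn -> R), 0 <= L ->
  (forall v w, `|Phi v - Phi w| <= L * `|v - w|) -> test_function Omega phi ->
  `|\int[leb]_(x in Omega) (Phi (u x) * partial j phi x)| <=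
  \int[leb]_x (M * L * (`|g x| * (\1_Omega x : R)) * `|phi x|).
Proof.
have [M M0 HM] := @lipschitz_superposition_bound R n; exists M => //.
move=> Phi L j phi L0 PhiL [cphi cK0 K0O].
have phi1 := cphi 1%N; have cont_phi : continuous phi := cphi 0%N.
have cP : continuous (partial j phi) := (phi1.2 j).2.
set K0 := closure _ in cK0 K0O.
have phiK0 x : phi x != 0 -> K0 x by move=> px; exact: subset_closure.
have PK0 x : partial j phi x != 0 -> K0 x.
  exact: (derive_closed_support (@closed_closure _ _) phiK0).
(* The kernels used in the superposition bound reach slightly beyond the support of [phi]; [K]
   leaves room for them inside [Omega]. *)
have [r r0 [K [cK KO KP]]] := compact_neighborhood oO cK0 K0O.
have K0K : K0 `<=` K by move=> x K0x; apply: (KP x x K0x); rewrite subrr normr0 ltW.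
have [B KB] := compact_norm_le cK0.
have [y y0 yd] := strongly_measurable_dense su.
pose norming (p : nat * nat) (l : {linear V -> R^o}) :=
  [/\ dual_unit_ball l, l (y p.1 - y p.2) = `|y p.1 - y p.2| &
      forall x, `|l x| <= `|x| ].
have [l lP] : {l & forall p, norming p (l p)}.
  apply: choice => p.
  by have [l lb [ly lle]] := norming_functional (y p.1 - y p.2); exists l.
(* McShane's formula on the first N + 1 points, as a function of the numbers [l (i, k) (u x)]. It is
   [L]-Lipschitz for the sup norm, since minima and maxima are 1-Lipschitz for it. Outside [K] the
   cut-off in [a] spoils the formula, but there the derivative of [phi] vanishes. *)
pose T N (a : 'I_N.+1 * 'I_N.+1 -> R) : R := minimax (ord0 : 'I_N.+1)
  (fun i k => Phi (y k) + L * (a (i, k) - l (i : nat, k : nat) (y k))).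
pose a N (p : 'I_N.+1 * 'I_N.+1) (x : Rn) : R :=
  l (p.1 : nat, p.2 : nat) (u x) * (\1_K x : R).
have L1a N p : L1 (a N p).
  have [lb _ lle] := lP (p.1 : nat, p.2 : nat).
  apply: (lipschitz_composition_L1 (L := 1) _ cK KO) => v w.
  by rewrite mul1r; have := lle (v - w); rewrite linearB.
have mTa N : lmeasurable_fun setT (fun x => T N (a N ^~ x)).
  apply: measurable_minimax => i k.
  exact: (measurable_funD (measurable_cst _) (measurable_funM (measurable_cst _)
    (measurable_funB (L1_measurable (L1a N (i, k))) (measurable_cst _)))).
have bound N : `|\int[leb]_x (T N (a N ^~ x) * partial j phi x)| <=
    M * (L * \int[leb]_x (`|g x| * (\1_K x : R) * `|phi x|)).
  apply: (HM _ (a N) (T N) L (fun x => `|g x| * (\1_K x : R)) phi j K r B) => //.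
  - move=> p q d d0 pq; apply: minimax_dist => i k.
    rewrite [X in `|X|](_ : _ = L * (p (i, k) - q (i, k))); last by ring.
    by rewrite normrM ger0_norm// ler_wpM2l.
  - exact: L1g.
  - by move=> x /phiK0/KB.
  - by move=> x z /phiK0; exact: KP.
  - move=> p chi cchi chiK; have [lb _ _] := lP (p.1 : nat, p.2 : nat).
    exact: functional_gradient_bound.
have TPhi N m x : (m <= N)%N -> K x ->
    `|T N (a N ^~ x) - Phi (u x)| <= 2 * (L * `|u x - y m|).
  move=> mN Kx.
  have -> : T N (a N ^~ x) = minimax (ord0 : 'I_N.+1)
      (fun i k => Phi (y k) + L * (l (i : nat, k : nat) (u x) - l (i : nat, k : nat) (y k))).
    by rewrite /T /a indicE mem_set//; under eq_fun do under eq_fun do rewrite mulr1.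
  apply: (@mcshane_minimax _ _ _ _ _ (fun i k => l (i, k))) => //.
  - by move=> i k z; have [] := lP (i, k).
  - by move=> i k z z'; rewrite linearB.
  - by move=> i k; have [] := lP (i, k).
have P0 x : ~ K x -> partial j phi x = 0.
  by move=> nKx; apply/eqP; apply: contra_notT nKx => /PK0 /K0K.
have cnP : continuous (fun x => `|partial j phi x|).
  move=> x; apply: (@continuous_comp _ _ _ (partial j phi) (fun t : R => `|t|)).
    exact: cP.
  exact: norm_continuous.
have mT : lmeasurable (setT : set Rn) := open_lmeasurable openT.
have mP := continuous_lmeasurable_fun mT cP.
have PhiK := lipschitz_composition_L1 PhiL cK KO.
have iD : L1 (fun x => (`|Phi (u x)| + 2 * (L * `|u x|)) * (\1_K x : R) *
    (\1_K x : R) * `|partial j phi x|).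
  apply: (L1_compact_support cK (@subset_refl _ K)) => //.
  - have := L1D (L1_norm PhiK) (L1Z 2 (L1Z L (L1u cK KO))).
    congr (integrable _ _ _); apply/funext => x /=; congr EFin.
    rewrite indicE; case: (_ \in _); rewrite ?mulr1// !mulr0 normr0; ring.
  - by move=> x; rewrite normr_eq0 => /PK0/K0K.
have [||||_ cvg_int] := @Rint_dct _ _ _ leb
  (fun N (x : Rn) => T N (a N ^~ x) * partial j phi x)
  (fun x : Rn => Phi (u x) * (\1_K x : R) * partial j phi x) _ _ _ _ iD.
- by move=> N; exact: measurable_funM (mTa N) mP.
- exact: measurable_funM (L1_measurable PhiK) mP.
- apply: filterS yd => x yd; have [Kx|nKx] := pselect (K x); last first.
    by under eq_fun do rewrite P0// mulr0; rewrite P0// mulr0; exact: cvg_cst.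
  apply: (@cvgM R); last exact: cvg_cst.
  rewrite indicE mem_set// mulr1; apply/cvgrPdist_le => e e0.
  (* The error is at most 2 L |u x - y m| for all N >= m; the summand 1 avoids a division by zero
     when L = 0. *)
  have L1_gt0 : 0 < 2 * L + 1 by rewrite ltr_wpDl// mulr_ge0.
  have [m um] := yd (KO _ Kx) (e / (2 * L + 1)) (divr_gt0 e0 L1_gt0).
  exists m => // N /= mN; rewrite distrC; apply: le_trans (TPhi N m x mN Kx) _.
  move/ltW : um; rewrite ler_pdivlMr// => um.
  have := normr_ge0 (u x - y m); lra.
- move=> N x; have [Kx|nKx] := pselect (K x); last first.
    by rewrite P0// !mulr0 normr0 mulr0.
  rewrite normrM indicE mem_set// !mulr1 ler_wpM2r//.
  (* The index m = 0, with y 0 = 0, is available for every [N] and yields a bound that does not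
     depend on [N]. *)
  have := TPhi N 0%N x (leq0n _) Kx; rewrite y0 subr0.
  have := ler_normD (T N (a N ^~ x) - Phi (u x)) (Phi (u x)); rewrite subrK; lra.
have lim : `|\int[leb]_x (Phi (u x) * (\1_K x : R) * partial j phi x)| <=
    M * (L * \int[leb]_x (`|g x| * (\1_K x : R) * `|phi x|)).
  by apply: (cvgr_to_le (cvg_norm cvg_int)); exact: nearW.
move: lim; have -> : \int[leb]_x (Phi (u x) * (\1_K x : R) * partial j phi x) =
    \int[leb]_(x in Omega) (Phi (u x) * partial j phi x).
  rewrite (@Rint_indicM _ _ _ leb Omega); apply: eq_Rintegral => x _.
  have [Kx|nKx] := pselect (K x); last by rewrite P0// !(mulr0, mul0r).
  by rewrite !indicE !mem_set//; [rewrite !mulr1|exact: KO].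
move=> /le_trans; apply; rewrite mulrA -RintZ; last first.
  apply: (L1_compact_support cK (@subset_refl _ K) (L1g cK KO)).
    move=> x; apply: (@continuous_comp _ _ _ phi (fun t : R => `|t|)).
      exact: cont_phi.
    exact: norm_continuous.
  by move=> x; rewrite normr_eq0 => /phiK0/K0K.
rewrite le_eqVlt; apply/orP; left; apply/eqP; apply: eq_Rintegral => x _.
have [Kx|nKx] := pselect (K x).
  by rewrite !indicE !mem_set//; [rewrite !mulrA|exact: KO].
have -> : phi x = 0 by apply/eqP; apply: contra_notT nKx => /phiK0/K0K.
by rewrite normr0 !mulr0.
Qed.

End lipschitz_composition.

Section lipschitz_composition_gradient.
Context {R : realType} {n : nat} (Omega : set 'rV[R]_n.+1)
  (X : banach_function_space Omega) (V : normedModType R).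
Local Notation Rn := 'rV[R]_n.+1.
Local Notation leb := (lebesgue R n).
Local Notation L1 f := (leb.-integrable [set: lebesgue_space R n] (EFin \o f)).

(** [M] is chosen before [Phi], so all [Phi] with the same Lipschitz constant share one bound on
    their gradients; this uniformity gives (B). The factor n + 1 comes from bounding the Euclidean
    length by the components. *)
Lemma lipschitz_composition_weak_gradient (u : Rn -> V) (g : Rn -> R) :
  open Omega -> strongly_measurable Omega u -> X (fun x => `|u x|) -> X g ->
  (\forall x \ae leb, Omega x -> 0 <= g x) ->
  (forall l : {linear V -> R^o}, dual_unit_ball l ->
    exists2 du, weak_gradient Omega (l \o u) du &
      \forall x \ae leb, Omega x -> gradient_length du x <= g x) ->
  exists2 M : R, 0 <= M & forall (Phi : V -> R) (L : R), 0 <= L ->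
    (forall v w, `|Phi v - Phi w| <= L * `|v - w|) ->
    exists2 dPhi, weak_gradient Omega (Phi \o u) dPhi &
      (forall j, X (dPhi j)) /\
      \forall x \ae leb, Omega x -> gradient_length dPhi x <= n.+1%:R * (M * L) * g x.
Proof.
move=> oO su Xu Xg g0 gu.
have mO : lmeasurable Omega := open_lmeasurable oO.
have [M M0 bound] := lipschitz_composition_bound oO su Xu Xg g0 gu.
exists M => // Phi L L0 PhiL.
have ML0 : 0 <= M * L by rewrite mulr_ge0.
(* The absolute value is taken because [g] is nonnegative only a.e. on [Omega]; the indicator
   extends the bound by 0, and thereby forces the representing function to vanish outside
   [Omega]. *)
pose G (x : Rn) := M * L * (`|g x| * (\1_Omega x : R)).
have G0 x : 0 <= G x by rewrite !mulr_ge0.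
have mg : lmeasurable_fun Omega (fun x => `|g x|).
  exact: measurableT_comp (@normr_measurable _ _) (bfs_measurable Xg).
have mG : lmeasurable_fun setT G.
  exact: (measurable_funM (measurable_cst _) (measurable_fun_indicM mO mg)).
have gA (A : set Rn) : lmeasurable A -> A `<=` Omega -> (leb A < +oo)%E ->
    L1 (fun x => `|g x| * (\1_A x : R)).
  move=> mA AO Afin; apply/(@L1_indicM _ _ _ leb A (fun x : Rn => `|g x|) mA).
  by have := bfs_integrable mO Xg g0 mA AO Afin => /integrable_norm.
have GB (B : R) : leb.-integrable [set x : Rn | `|x| <= B] (EFin \o G).
  have mB := lmeasurable_norm_le (R := R) (n := n) B.
  apply/(@L1_indicM _ _ _ leb [set x : Rn | `|x| <= B] G mB).
  have := L1Z (M * L) (gA (Omega `&` [set x : Rn | `|x| <= B]) _ (@subIsetl _ _ _) _).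
  move=> h; have : L1 (fun x : Rn => M * L *
      (`|g x| * (\1_(Omega `&` [set x : Rn | `|x| <= B]) x : R))).
    apply: h; first exact: measurableI.
    by apply: (lebesgue_bounded_lty (M := B)) => x [].
  congr (integrable _ _ _); apply/funext => x /=; congr EFin.
  by rewrite /G indicI /= !mulrA.
have PhiK := lipschitz_composition_L1 oO su Xu PhiL.
have mPhi := lipschitz_composition_lmeasurable oO su PhiL.
have L1P phi j : test_function Omega phi ->
    L1 (fun x => Phi (u x) * (\1_Omega x : R) * partial j phi x).
  move=> [cphi cK KO]; apply: (L1_compact_support cK KO (PhiK _ cK KO)).
    exact: ((cphi 1%N).2 j).2.
  move=> x; apply: (derive_closed_support (@closed_closure _ _)) => y py.
  exact: subset_closure.
have PhiOE phi j : \int[leb]_(x in Omega) (Phi (u x) * partial j phi x) =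
    \int[leb]_x (Phi (u x) * (\1_Omega x : R) * partial j phi x).
  rewrite (@Rint_indicM _ _ _ leb Omega); apply: eq_Rintegral => x _.
  by rewrite mulrAC.
have loc : L1loc Omega (Phi \o u).
  split => // K cK KO.
  by have /(integrable_on_compact _ cK)/integrableP[] := PhiK K cK KO.
have rep j : exists v : Rn -> R, weak_partial Omega j (Phi \o u) v /\
    lmeasurable_fun setT v /\ forall x, `|v x| <= G x.
  have [||v [mv vG vF]] := @local_functional_representation R n G
    (test_function Omega : set (Rn -> R^o))
    (fun psi => - \int[leb]_(x in Omega) (Phi (u x) * partial j psi x))
    mG G0 GB (test_function_subspace _).
  - move=> t phi psi tphi tpsi; rewrite !PhiOE mulrN -opprD; congr -%R.
    rewrite -RintZ; last exact: L1P.
    rewrite -RintD; [|exact: (L1Z _ (L1P _ _ tphi))|exact: L1P].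
    apply: eq_Rintegral => x _.
    have [c1 _ _] := tphi; have [c2 _ _] := tpsi.
    have -> : partial j (t *: (phi : Rn -> R^o) + psi) x =
        t * partial j phi x + partial j psi x.
      exact: (partialD t j x (c1 1%N) (c2 1%N)).
    by ring.
  - move=> psi tpsi; have [cpsi cK KO] := tpsi.
    have cont_psi : continuous (psi : Rn -> R) := cpsi 0%N.
    split.
    + exact: (continuous_lmeasurable_fun (open_lmeasurable openT) cont_psi).
    + have gK := gA _ (compact_lmeasurable cK) KO (lebesgue_compact_lty cK).
      have supp (x : Rn) : psi x != 0 -> closure [set x | psi x != 0] x.
        by move=> px; exact: subset_closure.
      have := L1Z (M * L) (L1_compact_support cK KO gK cont_psi supp).
      by congr (integrable _ _ _); apply/funext => x /=; rewrite mulrA.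
    + apply: le_trans (bound Phi L j psi L0 PhiL tpsi).
      by rewrite -normrN; exact: ler_norm.
  have vO x : ~ Omega x -> v x = 0.
    move=> nOx; apply/eqP; rewrite -normr_le0; apply: le_trans (vG x) _.
    by rewrite /G indicE memNset// !mulr0.
  exists v; split; last by split.
  split => //.
    split => [|K cK KO]; first exact: measurable_funS mv.
    have : L1 (fun x => v x * (\1_K x : R)).
      have mK := compact_lmeasurable cK.
      apply: (@L1_le _ _ _ leb (fun x : Rn => v x * (\1_K x : R))
        (fun x : Rn => M * L * (`|g x| * (\1_K x : R)))).
      - by apply: measurable_fun_indicM => //; exact: measurable_funS mv.
      - move=> x; rewrite normrM [X in _ * X <= _]ger0_norm// mulrA ler_wpM2r//.
        have o1 : (\1_Omega x : R) <= 1 by rewrite indicE; case: (_ \in _).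
        by apply: le_trans (vG x) _; rewrite /G mulrA ler_piMr// mulr_ge0.
      - exact: (L1Z (M * L) (gA _ mK KO (lebesgue_compact_lty cK))).
    by move=> /(integrable_on_compact _ cK)/integrableP[].
  move=> phi tphi; have := vF phi tphi => /(congr1 -%R); rewrite opprK => ->.
  congr -%R; rewrite (@Rint_indicM _ _ _ leb Omega); apply: eq_Rintegral => x _.
  have [Ox|nOx] := pselect (Omega x); first by rewrite indicE mem_set// mulr1.
  by rewrite vO// !mul0r.
have [v vP] := choice rep.
have gE : \forall x \ae leb, Omega x -> forall j, `|v j x| <= M * L * g x.
  apply: filterS g0 => x gx Ox j; have [_ [_ /(_ x) vG]] := vP j.
  apply: le_trans vG _; rewrite /G indicE mem_set// mulr1 ger0_norm//.
  exact: gx.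
exists v; first by move=> j; have [] := vP j.
split.
  move=> j; have [_ [mv _]] := vP j.
  have [] // := @bfs_le _ _ _ X (v j) (fun x => M * L * g x) _ (bfsZ (M * L) Xg).
    exact: measurable_funS mv.
  by apply: filterS gE => x h Ox; exact: h.
apply: filterS gE => x h Ox; rewrite -mulrA; apply: gradient_length_le => j.
exact: h.
Qed.

End lipschitz_composition_gradient.

Theorem theorem4p2 (R : realType) (n : nat) (Omega : set 'rV[R]_n.+1)
    (X : banach_function_space Omega) (V Z : completeNormedModType R)
    (f : V -> Z) :
  open Omega ->
  lipschitz f ->
  (lebesgue R n Omega = +oo%E -> f 0 = 0) ->
  forall u : 'rV[R]_n.+1 -> V,
    reshetnyak_sobolev X u -> reshetnyak_sobolev X (f \o u).
Proof.
move=> oO /lipschitz_le[k k0 fk] f0 u [[su Xu] _ [g [Xg g0 gu]]].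
have mO : lmeasurable Omega := open_lmeasurable oO.
have cf : continuous f := lipschitz_le_continuous fk.
have sfu := strongly_measurable_comp cf su.
(* When [Omega] has finite measure, its indicator, and with it every constant, belongs to [X];
   otherwise the hypothesis makes this constant 0. *)
have Xf0 : X (fun=> `|f 0|).
  have [/f0 ->|fin] := eqVneq (lebesgue R n Omega) +oo%E.
    by rewrite normr0; exact: bfs0.
  have /(bfsZ `|f 0|) X1 : X (\1_Omega : 'rV[R]_n.+1 -> R).
    by apply: bfs_indic => //; rewrite ltey.
  have [] // := @bfs_le _ _ _ X (fun=> `|f 0|) _ _ X1; first exact: measurable_cst.
  by apply: aeW => x Ox; rewrite indicE mem_set// mulr1 normr_id.
have mfu : lmeasurable_fun Omega (fun x => `|f (u x)|).
  apply: (strongly_measurable_lmeasurable (Phi := fun z : Z => `|z|) mO _ sfu).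
  exact: norm_continuous.
have Xfu : X (fun x => `|f (u x)|).
  have [] // := @bfs_le _ _ _ X (fun x => `|f (u x)|) _ mfu (bfsD Xf0 (bfsZ k Xu)).
  apply: aeW => x _; rewrite normr_id /=.
  have := fk (u x) 0; rewrite subr0.
  by have := ler_normD (f (u x) - f 0) (f 0); rewrite subrK; lra.
have [M M0 grad] := lipschitz_composition_weak_gradient oO su Xu Xg g0 gu.
(* Every functional of the dual unit ball is 1-Lipschitz, so all the functions [l \o f] have the
   Lipschitz constant [k] of [f], and the bound obtained does not depend on [l]. *)
have gradl (l : {linear Z -> R^o}) : dual_unit_ball l ->
    exists2 dl, weak_gradient Omega (l \o (f \o u)) dl & (forall j, X (dl j)) /\
      \forall x \ae lebesgue R n, Omega x ->
        gradient_length dl x <= n.+1%:R * (M * k) * g x.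
  move=> lb; apply: (grad (l \o f) k k0) => v w /=.
  by rewrite -linearB; apply: le_trans (fk v w); exact: dual_unit_ball_le.
split => //.
- move=> l lb; have [dl wl [Xl _]] := gradl l lb; split; last by exists dl.
  have [] // := @bfs_le _ _ _ X (l \o (f \o u)) _ _ Xfu.
    apply: (strongly_measurable_lmeasurable (Phi := (l : Z -> R)) mO _ sfu).
    exact: lb.1.
  by apply: aeW => x _; exact: dual_unit_ball_le.
- exists (fun x => n.+1%:R * (M * k) * g x); split; first exact: bfsZ.
    by apply: filterS g0 => x gx Ox; rewrite !mulr_ge0// gx.
  by move=> l lb; have [dl wl [_ dlg]] := gradl l lb; exists dl.
Qed.
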